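(* Let $\omega$ be a joint operator radius, $J$ a WOT-closed two-sided ideal of $F_n^\infty$, and let $T:=[T_1,\ldots,T_n]$, $T_i\in B(\mathcal H)$, be a $C_0$-row contraction such that $\varphi(T_1,\ldots,T_n)=0$ for any $\varphi(S_1,\ldots,S_n)\in J$. Then the linear map $\Phi_T^J:\mathcal W_n^J\to B(\mathcal H)$ defined by $$\Phi_T^J[f(B_1,\ldots,B_n)g(B_1,\ldots,B_n)^*]:=f(T_1,\ldots,T_n)g(T_1,\ldots,T_n)^*$$ is a unital completely contractive linear map and $$\Phi_T^J\big(f(B_1,\ldots,B_n)g(B_1,\ldots,B_n)^*\big)=K_T^*[f(S_1,\ldots,S_n)g(S_1,\ldots,S_n)^*\otimes I]K_T$$ for any $f(S_1,\ldots,S_n),g(S_1,\ldots,S_n)\in F_n^\infty$, where $K_T$ is the Poisson kernel associated with $T$. Moreover: (i) if $\omega$ is admissible, then $$\omega\left([\Phi^J_{T,p}(F_1)]^*,\ldots,[\Phi^J_{T,p}(F_k)]^*\right)\le\omega(F_1^*,\ldots,F_k^* )$$ for any $F_1,\ldots,F_k\in M_p\otimes W_J^\infty$ and $k,p\in\mathbb N$; (ii) if $\omega$ is strongly admissible, then $$\omega\left(\Phi^J_{T,p}(X_1),\ldots,\Phi^J_{T,p}(X_k)\right)\le\omega(X_1,\ldots,X_k)$$ for any $X_1,\ldots,X_k\in M_p\otimes\mathcal W_n^J$ and $k,p\in\mathbb N$.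
   Context: All Hilbert spaces are complex, separable and nonzero; $n\in\mathbb N=\{1,2,\ldots\}$. $F^2(H_n)=\bigoplus_{k\ge0}H_n^{\otimes k}$ is the full Fock space of an $n$-dimensional Hilbert space with orthonormal basis $e_1,\ldots,e_n$; $S_i\psi=e_i\otimes\psi$; $F_n^\infty$ is the WOT-closed algebra generated by $S_1,\ldots,S_n,I$. $\mathbb F_n^+$ is the unital free semigroup on $g_1,\ldots,g_n$ with identity $g_0$; for $\alpha=g_{i_1}\cdots g_{i_k}$, $|\alpha|=k$, $e_\alpha=e_{i_1}\otimes\cdots\otimes e_{i_k}$, $T_\alpha=T_{i_1}\cdots T_{i_k}$; $e_{g_0}=1$, $T_{g_0}=I$. $M_p$ is the algebra of $p\times p$ complex matrices. A row contraction ($\sum T_iT_i^*\le I$) is $C_0$ if $\text{SOT-}\lim_{k\to\infty}\sum_{|\alpha|=k}T_\alpha T_\alpha^*=0$. For such $T$ and $f=f(S_1,\ldots,S_n)\in F_n^\infty$ with $f1=\sum_\alpha a_\alpha e_\alpha$, $f(T_1,\ldots,T_n):=\text{SOT-}\lim_{r\to1}\sum_{k=0}^\infty\sum_{|\alpha|=k}r^{|\alpha|}a_\alpha T_\alpha$ (the limit exists). The Poisson kernel is $K_T:\mathcal H\to F^2(H_n)\otimes\mathcal H$, $K_Th=\sum_\alpha e_\alpha\otimes\Delta T_\alpha^*h$, $\Delta=(I-\sum T_iT_i^* )^{1/2}$ (an isometry for $C_0$-row contractions). $\mathcal M_J:=\overline{JF^2(H_n)}$, $\mathcal N_J:=F^2(H_n)\ominus\mathcal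 M_J$, $B_i:=P_{\mathcal N_J}S_i|_{\mathcal N_J}$. $W_J^\infty$ is the WOT-closed algebra generated by $B_1,\ldots,B_n,I$; one has $W_J^\infty=P_{\mathcal N_J}F_n^\infty|_{\mathcal N_J}=\{f(B_1,\ldots,B_n):f\in F_n^\infty\}$. $\mathcal W_n^J:=\mathrm{span}\{f(B_1,\ldots,B_n)g(B_1,\ldots,B_n)^*:f(B_1,\ldots,B_n),g(B_1,\ldots,B_n)\in W_J^\infty\}$. $\Phi^J_{T,p}:=I_{M_p}\otimes\Phi_T^J$; on $W_J^\infty\subset\mathcal W_n^J$, $\Phi_T^J(f(B_1,\ldots,B_n))=f(T_1,\ldots,T_n)$. A joint operator radius $\omega$ is a family of maps $\omega:B(\mathcal H)^{(d)}\to[0,\infty)$ ($\mathcal H$ any separable Hilbert space, $d=1,2,\ldots$) with $\omega(T_1,\ldots,T_d)=\omega(T_{\sigma(1)},\ldots,T_{\sigma(d)})$ for every permutation $\sigma$ and $\omega(T_1,\ldots,T_d,0)=\omega(T_1,\ldots,T_d)$. It is admissible if always: (a) $\omega(U^*T_1U,\ldots,U^*T_dU)=\omega(T_1,\ldots,T_d)$ for unitary $U:\mathcal K\to\mathcal H$; (b) $\omega(I_{\mathcal G}\otimes T_1,\ldots,I_{\mathcal G}\otimes T_d)=\omega(T_1,\ldots,T_d)$ for any separable $\mathcal G$; (c) $\omega(T_1|_{\mathcal M},\ldots,T_d|_{\mathcal M})\le\omega(T_1,\ldots,T_d)$ for any subspace $\mathcal M$ invariant under each $T_i$. It is strongly admissible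 if it satisfies (a), (b) and (c$'$) $\omega(P_{\mathcal M}T_1|_{\mathcal M},\ldots,P_{\mathcal M}T_d|_{\mathcal M})\le\omega(T_1,\ldots,T_d)$ for any closed subspace $\mathcal M\subseteq\mathcal H$. *)

(* Defs.v *)
From HB Require Import structures.
From mathcomp Require Import all_boot all_order all_algebra perm sesquilinear complex.
From mathcomp Require Import boolp classical_sets functions reals topology normedtype sequences.
Set Implicit Arguments.
Unset Strict Implicit.
Unset Printing Implicit Defensive.
Import Order.TTheory GRing.Theory Num.Theory.
Import numFieldNormedType.Exports.
Local Open Scope classical_set_scope.
Local Open Scope ring_scope.

Section Norm.
Variables (R : realType) (V : lmodType R[i]) (f : {dot V for Num.conj}).
Local Notation "''[' u , v ]" := (f u v).

(* The norm is real-valued: the library's norm on R[i] takes values in R[i]. *)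
Definition dnorm (u : V) : R := Num.sqrt (complex.Re '[u, u]).

Lemma dnorm_def u : '[u, u] = (dnorm u ^+ 2)%:C%C.
Proof.
have := dnorm_ge0 f u; case E : '[u, u] => [a b].
by rewrite lecE /= => /andP[/eqP -> a0]; rewrite /dnorm E /= sqr_sqrtr.
Qed.

Lemma dnormr_ge0 u : 0 <= dnorm u.
Proof. exact: sqrtr_ge0. Qed.

Lemma dnormr0 : dnorm 0 = 0.
Proof. by rewrite /dnorm linear0r /= sqrtr0. Qed.

Lemma dnormr_eq0 u : dnorm u = 0 -> u = 0.
Proof.
move=> h; apply/eqP; rewrite -(dnorm_eq0 f); apply/eqP.
by rewrite dnorm_def h expr0n.
Qed.

Lemma dnormrZ a u : dnorm (a *: u) = complex.Re `|a| * dnorm u.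
Proof.
apply/eqP; rewrite -(@eqrXn2 _ 2) ?mulr_ge0 ?dnormr_ge0 //; last first.
  by rewrite normc_def /= sqrtr_ge0.
apply/eqP/complexI; rewrite -dnorm_def dnormZ dnorm_def exprMn [RHS]rmorphM.
by congr (_ * _); rewrite normc_def rmorphXn.
Qed.

Lemma dnormrN u : dnorm (- u) = dnorm u.
Proof. by rewrite /dnorm linearNl linearNr opprK. Qed.

Lemma dnormr_sub u v : dnorm (u - v) = dnorm (v - u).
Proof. by rewrite -dnormrN opprB. Qed.

Lemma dnormrD_sqr u v :
  dnorm (u + v) ^+ 2 = dnorm u ^+ 2 + dnorm v ^+ 2 + 2 * complex.Re '[u, v].
Proof.
apply: complexI; rewrite -dnorm_def dnormD !rmorphD /= -!dnorm_def.
by congr (_ + _); rewrite addcJ rmorphM rmorph_nat.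
Qed.

Lemma dot_Re_le u v : complex.Re '[u, v] <= dnorm u * dnorm v.
Proof.
have [/dnormr_eq0 ->|u0] := eqVneq (dnorm u) 0.
  by rewrite linear0l /= dnormr0 mul0r.
have [/dnormr_eq0 ->|v0] := eqVneq (dnorm v) 0.
  by rewrite linear0r /= dnormr0 mulr0.
pose a := (dnorm v)%:C%C : R[i]; pose b := (dnorm u)%:C%C : R[i].
have := sqr_ge0 (dnorm (a *: u - b *: v)).
rewrite dnormrD_sqr linearNr linearZl_LR linearZr_LR /= dnormrN !dnormrZ.
have nC (x : R) : complex.Re `|x%:C%C : R[i]| = `|x|.
  by rewrite normc_def /= expr0n /= addr0 sqrtr_sqr.
have CJ (x : R) : (x%:C%C : R[i])^* = x%:C%C by exact: conjc_real.
rewrite !nC !ger0_norm ?dnormr_ge0 // CJ mulrA -rmorphM /=.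
case: '[u, v] => x y /=; rewrite mul0r subr0.
have -> : dnorm u * dnorm v = dnorm v * dnorm u by rewrite mulrC.
rewrite mulrN subr_ge0 -mulr2n -(mulr_natl (_ ^+ 2)) ler_pM2l //.
by rewrite expr2 ler_pM2l // mulr_gt0 // lt_def dnormr_ge0 ?u0 ?v0.
Qed.

Lemma ler_dnormD u v : dnorm (u + v) <= dnorm u + dnorm v.
Proof.
rewrite -(@ler_pXn2r _ 2) ?nnegrE ?addr_ge0 ?dnormr_ge0 //.
rewrite dnormrD_sqr sqrrD [leRHS]addrAC lerD2l -[leRHS]mulr_natl.
by rewrite ler_pM2l // dot_Re_le.
Qed.

Lemma ler_dist_dnorm u v : `|dnorm u - dnorm v| <= dnorm (u - v).
Proof.
rewrite ler_norml lerNl opprB !lerBlDr {1}dnormr_sub; apply/andP; split.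
  by apply: le_trans (ler_dnormD _ _); rewrite subrK.
by apply: le_trans (ler_dnormD _ _); rewrite subrK.
Qed.

Lemma ler_dnorm_sum (I : Type) (s : seq I) (u : I -> V) :
  dnorm (\sum_(i <- s) u i) <= \sum_(i <- s) dnorm (u i).
Proof.
elim/big_ind2: _ => //; first by rewrite dnormr0.
by move=> x a y b xa yb; apply: le_trans (ler_dnormD _ _) (lerD xa yb).
Qed.

Lemma dnormrD_sqr_le u v :
  dnorm (u + v) ^+ 2 <= 2 * dnorm u ^+ 2 + 2 * dnorm v ^+ 2.
Proof.
have := sqr_ge0 (dnorm (u - v)); rewrite !dnormrD_sqr dnormrN linearNr /=.
rewrite raddfN /= mulrN subr_ge0 => h.
by apply: le_trans (lerD (lexx _) h) _; rewrite -mulrDr mulr_natl mulr2n.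
Qed.
End Norm.

Definition dcvg (R : realType) (V : lmodType R[i]) (f : {dot V for Num.conj})
    (X : Type) (F : set_system X) (u : X -> V) (l : V) : Prop :=
  dnorm f (u x - l) @[x --> F] --> (0 : R).

Definition dcauchy (R : realType) (V : lmodType R[i])
    (f : {dot V for Num.conj}) (u : nat -> V) : Prop :=
  forall e : R, 0 < e -> exists N : nat,
    forall j k, (N <= j)%N -> (N <= k)%N -> dnorm f (u j - u k) < e.

Record hilbert (R : realType) := Hilbert {
  hcar :> lmodType R[i];
  hdot : {dot hcar for Num.conj};
  hcomplete : forall u : nat -> hcar, dcauchy hdot u ->
    exists l : hcar, dcvg hdot \oo u l }.

Definition hnorm (R : realType) (H : hilbert R) (x : H) : R := dnorm (hdot H) x.

Definition hcvg (R : realType) (H : hilbert R) (X : Type) (F : set_system X)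
    (u : X -> H) (l : H) : Prop := dcvg (hdot H) F u l.

Definition inner (R : realType) (H : hilbert R) (x y : H) : R[i] := hdot H x y.

Notation "''[' x , y ]" := (inner x y) : ring_scope.

Section Inner.
Variables (R : realType) (H : hilbert R).
Implicit Types (a : R[i]) (x y z : H).

Lemma innerDl x y z : '[x + y, z] = '[x, z] + '[y, z].
Proof. exact: linearDl. Qed.
Lemma innerDr x y z : '[x, y + z] = '[x, y] + '[x, z].
Proof. exact: linearDr. Qed.
Lemma innerBl x y z : '[x - y, z] = '[x, z] - '[y, z].
Proof. exact: linearBl. Qed.
Lemma innerZl a x y : '[a *: x, y] = a * '[x, y].
Proof. exact: linearZl_LR. Qed.
Lemma innerZr a x y : '[x, a *: y] = a^* * '[x, y].
Proof. exact: linearZr_LR. Qed.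
Lemma inner0l y : '[0 : H, y] = 0.
Proof. exact: linear0l. Qed.
Lemma innerC x y : '[x, y] = '[y, x]^*.
Proof. by rewrite /inner (hermitian_subproof x y) expr0 mul1r. Qed.
Lemma inner_hnorm x : '[x, x] = (hnorm x ^+ 2)%:C%C.
Proof. exact: dnorm_def. Qed.
End Inner.

Lemma dcvgP (R : realType) (V : lmodType R[i]) (f : {dot V for Num.conj})
    (u : nat -> V) l :
  dcvg f \oo u l <-> forall e : R, 0 < e -> exists N : nat,
    forall k, (N <= k)%N -> dnorm f (u k - l) < e.
Proof.
split=> [/cvgrPdist_lt h e e0|h].
  have [N _ hN] := h e e0; exists N => k /hN /=.
  by rewrite sub0r normrN ger0_norm ?dnormr_ge0.
apply/cvgrPdist_lt => e /h[N hN]; exists N => // k /hN /=.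
by rewrite sub0r normrN ger0_norm ?dnormr_ge0.
Qed.

Lemma dcauchy_Rcvg (R : realType) (v : nat -> R) :
  (forall e, 0 < e -> exists N : nat, forall j k, (N <= j)%N -> (N <= k)%N ->
    `|v j - v k| < e) ->
  exists l, forall e, 0 < e -> exists N : nat, forall k, (N <= k)%N ->
    `|v k - l| < e.
Proof.
move=> h; have /cauchy_cvgP/cvg_ex[l /cvgrPdist_lt hl] : cauchy (v @ \oo).
  apply/cauchy_ballP => e e0; have [N hN] := h e e0.
  pose S := v @` [set k | (N <= k)%N].
  exists (S, S) => /=; first by split; exists N => // k kN; exists k.
  by move=> [_ _] /= [[j jN <-] [k kN <-]]; exact: hN.
exists l => e /hl[N _ hN]; exists N => k /hN /=; by rewrite distrC.
Qed.

Section Scalars.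
Variable R : realType.
Local Notation C := R[i].

Definition scalar_dot (x y : C^o) : C := x * y^*.

Lemma scalar_dot_bilinear :
  bilinear_for ( *%R : GRing.Scale.law _ _) (Num.conj \; *%R : GRing.Scale.law _ _) scalar_dot.
Proof.
split=> [y a x x'|x a y y']; rewrite /scalar_dot; first by rewrite mulrDl -mulrA.
by rewrite rmorphD rmorphM /= mulrDr mulrCA.
Qed.
Lemma scalar_dot_herm x y : scalar_dot x y = (-1) ^+ false * (scalar_dot y x)^*.
Proof. by rewrite expr0 mul1r rmorphM /= conjCK mulrC. Qed.
Lemma scalar_dot_gt0 x : x != 0 -> 0 < scalar_dot x x.
Proof. by rewrite /scalar_dot -normCK => x0; rewrite exprn_gt0 ?normr_gt0. Qed.
HB.instance Definition _ :=
  bilinear_isBilinear.Build C C^o C^o C _ _ scalar_dot scalar_dot_bilinear.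
HB.instance Definition _ :=
  isHermitianSesquilinear.Build C C^o false Num.conj scalar_dot scalar_dot_herm.
HB.instance Definition _ := isDotProduct.Build C C^o scalar_dot scalar_dot_gt0.

Lemma scalar_dnorm x : dnorm scalar_dot x = complex.Re `|x|.
Proof.
have E : complex.Re (scalar_dot x x) = complex.Re `|x| ^+ 2.
  by rewrite /scalar_dot -normCK normc_def -rmorphXn.
rewrite /dnorm; transitivity (Num.sqrt (complex.Re `|x| ^+ 2)).
  by congr (Num.sqrt _).
by rewrite sqrtr_sqr ger0_norm // normc_def sqrtr_ge0.
Qed.

Lemma scalar_complete (u : nat -> C^o) : dcauchy scalar_dot u ->
  exists l : C^o, dcvg scalar_dot \oo u l.
Proof.
move=> uc.
have le_re (z : C) : `|complex.Re z| <= complex.Re `|z|.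
  by rewrite normc_def /= -sqrtr_sqr ler_wsqrtr // lerDl sqr_ge0.
have le_im (z : C) : `|complex.Im z| <= complex.Re `|z|.
  by rewrite normc_def /= -sqrtr_sqr ler_wsqrtr // lerDr sqr_ge0.
have le_c (z : C) : complex.Re `|z| <= `|complex.Re z| + `|complex.Im z|.
  rewrite normc_def /= -[leRHS]ger0_norm ?addr_ge0 // -sqrtr_sqr ler_wsqrtr //.
  by rewrite sqrrD !real_normK ?num_real // addrAC lerDl mulrn_wge0 ?mulr_ge0.
have [a ha] : exists l, forall e, 0 < e -> exists N : nat, forall k, (N <= k)%N ->
    `|complex.Re (u k) - l| < e.
  apply: (@dcauchy_Rcvg R (fun k => complex.Re (u k))) => e /uc[N hN].
  exists N => j k jN kN; apply: le_lt_trans (hN _ _ jN kN).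
  rewrite scalar_dnorm; apply: le_trans (le_re _).
  by case: (u j) (u k) => [? ?] [? ?].
have [b hb] : exists l, forall e, 0 < e -> exists N : nat, forall k, (N <= k)%N ->
    `|complex.Im (u k) - l| < e.
  apply: (@dcauchy_Rcvg R (fun k => complex.Im (u k))) => e /uc[N hN].
  exists N => j k jN kN; apply: le_lt_trans (hN _ _ jN kN).
  rewrite scalar_dnorm; apply: le_trans (le_im _).
  by case: (u j) (u k) => [? ?] [? ?].
exists (Complex a b); apply/dcvgP => e e0.
have [N1 h1] := ha _ (divr_gt0 e0 (ltr0Sn _ 1)).
have [N2 h2] := hb _ (divr_gt0 e0 (ltr0Sn _ 1)).
exists (maxn N1 N2) => k; rewrite geq_max => /andP[/h1 k1 /h2 k2].
rewrite scalar_dnorm [ltRHS]splitr; apply: le_lt_trans (le_c _) _.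
by move: k1 k2; case: (u k) => [? ?] /= k1 k2; exact: ltrD.
Qed.

Definition scalar_hilbert : hilbert R :=
  @Hilbert R C^o scalar_dot scalar_complete.

End Scalars.

(* Unconditional convergence in norm of the sum of a family of vectors. *)
Definition has_sum (R : realType) (H : hilbert R) (I : eqType) (x : I -> H)
    (s : H) : Prop :=
  forall e : R, 0 < e -> exists F0 : seq I,
    forall F, uniq F -> {subset F0 <= F} -> hnorm (\sum_(i <- F) x i - s) < e.

Section HasSum.
Variables (R : realType) (I : eqType).
Local Notation C := R[i].
Local Notation K := (scalar_hilbert R).

Lemma has_sum_unique (H : hilbert R) (x : I -> H) s t :
  has_sum x s -> has_sum x t -> s = t.
Proof.
move=> xs xt; apply/eqP; rewrite -subr_eq0; apply/eqP/(@dnormr_eq0 _ _ (hdot H)).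
apply/eqP; rewrite eq_le dnormr_ge0 andbT; apply/ler_addgt0Pr => e e0; rewrite add0r.
have [F0 h0] := xs _ (divr_gt0 e0 (ltr0Sn _ 1)).
have [F1 h1] := xt _ (divr_gt0 e0 (ltr0Sn _ 1)).
pose F := undup (F0 ++ F1).
have k0 := h0 F (undup_uniq _); have k1 := h1 F (undup_uniq _).
apply: ltW; rewrite [ltRHS]splitr.
rewrite -(subrKA (\sum_(i <- F) x i)).
apply: le_lt_trans (ler_dnormD _ _ _) _; rewrite (dnormr_sub _ s); apply: ltrD.
  by apply: k0 => i iF; rewrite mem_undup mem_cat iF.
by apply: k1 => i iF; rewrite mem_undup mem_cat iF orbT.
Qed.

Lemma has_sumD (H : hilbert R) (x y : I -> H) s t :
  has_sum x s -> has_sum y t -> has_sum (fun i => x i + y i) (s + t).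
Proof.
move=> xs yt e e0.
have [F0 h0] := xs _ (divr_gt0 e0 (ltr0Sn _ 1)).
have [F1 h1] := yt _ (divr_gt0 e0 (ltr0Sn _ 1)).
exists (F0 ++ F1) => F uF sF; rewrite big_split /= opprD addrACA [ltRHS]splitr.
apply: le_lt_trans (ler_dnormD _ _ _) _; apply: ltrD.
  by apply: h0 => // i iF; rewrite sF // mem_cat iF.
by apply: h1 => // i iF; rewrite sF // mem_cat iF orbT.
Qed.

Lemma has_sumZ (H : hilbert R) (x : I -> H) s (a : C) :
  has_sum x s -> has_sum (fun i => a *: x i) (a *: s).
Proof.
move=> xs e e0; pose b := complex.Re `|a|.
have b0 : 0 <= b by rewrite /b normc_def sqrtr_ge0.
have [F0 h0] := xs _ (divr_gt0 e0 (ltr_wpDl b0 ltr01)).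
exists F0 => F uF sF; rewrite -scaler_sumr -scalerBr /hnorm dnormrZ -/b.
have := h0 F uF sF; rewrite ltr_pdivlMr ?ltr_wpDl // => h.
apply: le_lt_trans h; rewrite mulrC ler_wpM2l ?dnormr_ge0 // ?lerDl ?ler01 //.
Qed.

Lemma has_sum_finite (H : hilbert R) (x : I -> H) (F0 : seq I) :
  uniq F0 -> (forall i, i \notin F0 -> x i = 0) ->
  has_sum x (\sum_(i <- F0) x i).
Proof.
move=> u0 h e e0; exists F0 => F uF sF.
suff -> : \sum_(i <- F) x i = \sum_(i <- F0) x i by rewrite subrr /hnorm dnormr0.
rewrite (bigID (mem F0)) /= [X in _ + X]big1 ?addr0; last by move=> i /h.
rewrite -big_filter; apply: perm_big; apply: uniq_perm; rewrite ?filter_uniq //.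
by move=> i; rewrite mem_filter /=; case iF : (i \in F0) => //=; exact: sF.
Qed.

Lemma has_sum_ge0 (x : I -> R) (B : R) : (forall i, 0 <= x i) ->
  (forall F, uniq F -> \sum_(i <- F) x i <= B) ->
  exists s : R, [/\ has_sum (fun i => (x i)%:C%C : K) (s%:C%C : K),
    s <= B & forall F, uniq F -> \sum_(i <- F) x i <= s].
Proof.
move=> x0 xB; pose S := [set r | exists2 F, uniq F & r = \sum_(i <- F) x i].
have S0 : S 0 by exists [::]; rewrite ?big_nil.
have hS : has_sup S.
  by split; [exists 0 | exists B => _ [F uF ->]; exact: xB].
have leS F : uniq F -> \sum_(i <- F) x i <= sup S.
  by move=> uF; apply: (sup_upper_bound hS); exists F.
exists (sup S); split=> //; last first.
  by apply: ge_sup; [exists 0|move=> _ [F uF ->]; exact: xB].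
move=> e e0; have [_ [F0 u0 ->] h0] := sup_adherent e0 hS.
exists F0 => F uF sF.
rewrite /hnorm scalar_dnorm.
have -> : \sum_(i <- F) ((x i)%:C%C : K) - (sup S)%:C%C = (\sum_(i <- F) x i - sup S)%:C%C.
  by rewrite rmorphB rmorph_sum.
rewrite normc_def /= expr0n /= addr0 sqrtr_sqr ler0_norm ?subr_le0 ?leS //.
rewrite opprB ltrBlDl -ltrBlDr; apply: lt_le_trans h0 _.
rewrite [leRHS](bigID (mem F0)) /= -[leLHS]addr0 lerD ?sumr_ge0 //.
rewrite -[leRHS]big_filter; rewrite le_eqVlt; apply/orP; left; apply/eqP/perm_big/uniq_perm; rewrite ?filter_uniq //.
by move=> i; rewrite mem_filter /=; case iF : (i \in F0) => //=; rewrite sF.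
Qed.

End HasSum.

(* The Hilbert sum of copies of H indexed by I: square-summable families. *)
Definition l2_pred (R : realType) (I : choiceType) (H : hilbert R) :
    {pred I -> H} :=
  fun f => `[< exists M : R, forall F : seq I, uniq F ->
                 \sum_(i <- F) hnorm (f i) ^+ 2 <= M >].

Lemma l2_pred_submod (R : realType) (I : choiceType) (H : hilbert R) :
  submod_closed (@l2_pred R I H).
Proof.
split=> [|a f g /asboolP[M hM] /asboolP[N hN]]; apply/asboolP.
  exists 0 => F _; rewrite big1 // => i _.
  by rewrite /hnorm dnormr0 expr0n.
pose b := complex.Re `|a| ^+ 2.
have b0 : 0 <= b by rewrite sqr_ge0.
exists (2 * (b * M) + 2 * N) => F uF.
apply: (@le_trans _ _ (\sum_(i <- F)
   (2 * (b * hnorm (f i) ^+ 2) + 2 * hnorm (g i) ^+ 2))).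
  apply: ler_sum => i _; apply: le_trans (dnormrD_sqr_le _ _ _) _.
  by rewrite dnormrZ exprMn.
rewrite big_split /= -!mulr_sumr.
by rewrite lerD // ler_pM2l ?hN // ler_wpM2l ?hM.
Qed.
HB.instance Definition _ (R : realType) (I : choiceType) (H : hilbert R) :=
  GRing.isSubmodClosed.Build R[i] (I -> H) (@l2_pred R I H)
    (@l2_pred_submod R I H).

Record l2 (R : realType) (I : choiceType) (H : hilbert R) := L2 {
  l2_fun :> I -> H;
  _ : l2_fun \in @l2_pred R I H }.

HB.instance Definition _ (R : realType) (I : choiceType) (H : hilbert R) :=
  [isSub for @l2_fun R I H].
HB.instance Definition _ (R : realType) (I : choiceType) (H : hilbert R) :=
  [Choice of l2 I H by <:].
HB.instance Definition _ (R : realType) (I : choiceType) (H : hilbert R) :=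
  [SubChoice_isSubLmodule of l2 I H by <:].

Definition l2_dot (R : realType) (I : choiceType) (H : hilbert R)
    (f g : l2 I H) : R[i] :=
  xget 0 [set s : R[i] | @has_sum R (scalar_hilbert R) I (fun i => '[f i, g i]) s].

Section L2.
Variables (R : realType) (I : choiceType) (H : hilbert R).
Local Notation C := R[i].
Local Notation K := (scalar_hilbert R).
Local Notation hs x s := (@has_sum R K I x s).

Lemma l2E (a : C) (f g : l2 I H) i : (a *: f + g) i = a *: f i + g i.
Proof. by []. Qed.
Lemma l2DE (f g : l2 I H) i : (f + g) i = f i + g i.
Proof. by []. Qed.
Lemma l2BE (f g : l2 I H) i : (f - g) i = f i - g i.
Proof. by []. Qed.
Lemma l2ZE (a : C) (f : l2 I H) i : (a *: f) i = a *: f i.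
Proof. by []. Qed.

Lemma l2_bound (f : l2 I H) : exists M : R, forall F : seq I, uniq F ->
  \sum_(i <- F) hnorm (f i) ^+ 2 <= M.
Proof. by case: f => f fP; apply/asboolP. Qed.

Lemma l2_sqr_sum (f : l2 I H) : exists s, hs (fun i => (hnorm (f i) ^+ 2)%:C%C) s.
Proof.
have [M hM] := l2_bound f.
have [s [h _ _]] := @has_sum_ge0 R I (fun i => hnorm (f i) ^+ 2) M
  (fun i => sqr_ge0 _) hM.
by exists s%:C%C.
Qed.

Lemma l2_Re_sum (f g : l2 I H) : exists s,
  hs (fun i => (complex.Re '[f i, g i])%:C%C) s.
Proof.
have [s1 h1] := l2_sqr_sum (f + g).
have [s2 h2] := l2_sqr_sum f; have [s3 h3] := l2_sqr_sum g.
have := has_sumZ 2^-1 (has_sumD h1 (has_sumZ (-1) (has_sumD h2 h3))).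
move=> h; eexists; move: h; congr (has_sum _ _); apply/funext => i.
rewrite l2DE {1}/hnorm dnormrD_sqr -/(inner _ _).
rewrite /GRing.scale /= -[(_ + _)%:C%C + _]/(_ + _).
rewrite mulN1r !rmorphD /= [X in X - _]addrC addrK rmorphM rmorph_nat mulrA mulVf ?mul1r //.
by rewrite pnatr_eq0.
Qed.

Lemma l2_dotP (f g : l2 I H) : hs (fun i => '[f i, g i]) (l2_dot f g).
Proof.
apply: (@xgetPex C 0 [set s | hs (fun i => '[f i, g i]) s]).
have [s1 h1] := l2_Re_sum f g.
have [s2 h2] := l2_Re_sum f ('i%C *: g).
have := has_sumD h1 (has_sumZ 'i%C h2).
move=> h; eexists; move: h; congr (has_sum _ _); apply/funext => i.
rewrite l2ZE innerZr.
by case: '[f i, g i] => a b /=; rewrite /GRing.scale /=; simpc.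
Qed.

Lemma l2_dotE (f g : l2 I H) s : hs (fun i => '[f i, g i]) s -> l2_dot f g = s.
Proof. exact: (has_sum_unique (l2_dotP f g)). Qed.

Lemma conjC_sum (x : I -> C) (s : C) : hs x s -> hs (fun i => (x i)^*) s^*.
Proof.
move=> h e /h[F0 h0]; exists F0 => F uF sF; move: (h0 F uF sF).
rewrite /hnorm !scalar_dnorm.
have -> : \sum_(i <- F) ((x i)^* : K) - s^* = (\sum_(i <- F) x i - s : C)^*.
  by rewrite rmorphB rmorph_sum.
by rewrite norm_conjC.
Qed.

Lemma l2_dot_herm (f g : l2 I H) : l2_dot f g = (-1) ^+ false * (l2_dot g f)^*.
Proof.
rewrite expr0 mul1r; apply: l2_dotE; have := conjC_sum (l2_dotP g f).
by congr (has_sum _ _); apply/funext => i; rewrite -innerC.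
Qed.

Lemma l2_dot_linl (g : l2 I H) a (f f' : l2 I H) : l2_dot (a *: f + f') g = a * l2_dot f g + l2_dot f' g.
Proof.
apply: l2_dotE; have := has_sumD (has_sumZ a (l2_dotP f g)) (l2_dotP f' g).
by congr (has_sum _ _); apply/funext => i; rewrite l2E innerDl innerZl.
Qed.

Lemma l2_dot_bilinear :
  bilinear_for ( *%R : GRing.Scale.law _ _) (Num.conj \; *%R : GRing.Scale.law _ _)
    (@l2_dot R I H).
Proof.
split=> [g a f f'|f a g g']; first exact: l2_dot_linl.
rewrite l2_dot_herm l2_dot_linl expr0 mul1r rmorphD rmorphM /=.
by rewrite [l2_dot f g]l2_dot_herm [l2_dot f g']l2_dot_herm !expr0 !mul1r.
Qed.

Lemma l2_dot_sqr (f : l2 I H) (B : R) :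
  (forall F, uniq F -> \sum_(i <- F) hnorm (f i) ^+ 2 <= B) ->
  exists s : R, [/\ l2_dot f f = s%:C%C, s <= B &
    forall F, uniq F -> \sum_(i <- F) hnorm (f i) ^+ 2 <= s].
Proof.
move=> hM; have [s [h sB hs]] := @has_sum_ge0 R I (fun i => hnorm (f i) ^+ 2) B
  (fun i => sqr_ge0 _) hM.
exists s; split=> //; apply: l2_dotE; move: h; congr (has_sum _ _).
by apply/funext => i; rewrite inner_hnorm.
Qed.

Lemma l2_dot_gt0 (f : l2 I H) : f != 0 -> 0 < l2_dot f f.
Proof.
move=> f0; have [i fi] : exists i, f i != 0.
  apply: contra_notP (elimN eqP f0) => h; apply/val_inj/funext => i.
  by apply: contra_notP h => /eqP; exists i.
have [M /l2_dot_sqr[s [-> _ hs]]] := l2_bound f.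
rewrite ltcR; apply: lt_le_trans (hs [:: i] isT).
rewrite big_seq1 exprn_gt0 // lt_def dnormr_ge0 andbT.
by apply: contra_neq fi => /dnormr_eq0.
Qed.

HB.instance Definition _ := bilinear_isBilinear.Build C (l2 I H) (l2 I H) C _ _
  (@l2_dot R I H) l2_dot_bilinear.
HB.instance Definition _ := isHermitianSesquilinear.Build C (l2 I H) false
  Num.conj (@l2_dot R I H) l2_dot_herm.
HB.instance Definition _ := isDotProduct.Build C (l2 I H) (@l2_dot R I H) l2_dot_gt0.

Lemma l2_dnorm_ge (f : l2 I H) F : uniq F ->
  \sum_(i <- F) hnorm (f i) ^+ 2 <= dnorm (@l2_dot R I H) f ^+ 2.
Proof.
move=> uF; have [M /l2_dot_sqr[s [E _ hs]]] := l2_bound f.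
suff -> : dnorm (@l2_dot R I H) f ^+ 2 = s by exact: hs.
by apply: complexI; rewrite -dnorm_def.
Qed.

Lemma l2_dnorm_le (f : l2 I H) B : 0 <= B ->
  (forall F, uniq F -> \sum_(i <- F) hnorm (f i) ^+ 2 <= B ^+ 2) ->
  dnorm (@l2_dot R I H) f <= B.
Proof.
move=> B0 /l2_dot_sqr[s [E sB _]].
rewrite -(@ler_pXn2r _ 2) ?nnegrE ?dnormr_ge0 //.
suff -> : dnorm (@l2_dot R I H) f ^+ 2 = s by [].
by apply: complexI; rewrite -dnorm_def.
Qed.

Lemma l2_coord_le (f : l2 I H) i : hnorm (f i) <= dnorm (@l2_dot R I H) f.
Proof.
rewrite -(@ler_pXn2r _ 2) ?nnegrE ?dnormr_ge0 //.
by have := l2_dnorm_ge f (isT : uniq [:: i]); rewrite big_seq1.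
Qed.

Lemma l2_complete (u : nat -> l2 I H) : dcauchy (@l2_dot R I H) u ->
  exists l : l2 I H, dcvg (@l2_dot R I H) \oo u l.
Proof.
move=> uc.
have /boolp.choice[l hl] : forall i, exists l : H, hcvg \oo (fun k => u k i) l.
  move=> i.
  apply: hcomplete => e /uc[N hN]; exists N => j k jN kN.
  by apply: le_lt_trans (hN _ _ jN kN); rewrite -l2BE l2_coord_le.
have tail e : 0 < e -> exists N, forall k, (N <= k)%N -> forall F, uniq F ->
    \sum_(i <- F) hnorm (u k i - l i) ^+ 2 <= e ^+ 2.
  move=> e0; have [N hN] := uc _ e0; exists N => k kN F uF.
  have cvS : \sum_(i <- F) hnorm (u k i - u j i) ^+ 2 @[j --> \oo] -->
      \sum_(i <- F) hnorm (u k i - l i) ^+ 2.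
    elim: (F) => [|i s IHs].
      by rewrite big_nil; under eq_fun do rewrite big_nil; exact: cvg_cst.
    rewrite big_cons; under eq_fun do rewrite big_cons.
    apply: cvgD => {IHs}//; rewrite expr2; under eq_fun do rewrite expr2.
    have c : hnorm (u k i - u j i) @[j --> \oo] --> hnorm (u k i - l i).
      apply/cvgrPdist_le => d d0; have [M hM] := (dcvgP _ _ _).1 (hl i) _ d0.
      exists M => // j /hM /ltW; apply: le_trans.
      apply: le_trans (ler_dist_dnorm _ _ _) _.
      by rewrite opprB addrC addrA subrK.
    exact: cvgM.
  rewrite -(cvg_lim _ cvS) //; apply: limr_le; first by apply/cvg_ex; eexists; exact: cvS.
  exists N => // j jN /=.
  apply: (@le_trans _ _ (dnorm (@l2_dot R I H) (u k - u j) ^+ 2)).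
    exact: (l2_dnorm_ge (u k - u j)).
  by rewrite ler_pXn2r ?nnegrE ?dnormr_ge0 ?ltW // hN.
have [N hN] := tail 1 ltr01.
have dP : (u N : I -> H) - l \in @l2_pred R I H.
  by apply/asboolP; exists (1 ^+ 2) => F uF; exact: hN.
have lP : l \in @l2_pred R I H.
  by rewrite -[l](subKr (u N : I -> H)) rpredB // (valP (u N)).
exists (L2 lP); apply/dcvgP => e e0.
have e2 := divr_gt0 e0 (ltr0Sn R 1).
have [M hM] := tail _ e2; exists M => k kM.
apply: (@le_lt_trans _ _ (e / 2)); last by rewrite ltr_pdivrMr // ltr_pMr // ltr1n.
by apply: l2_dnorm_le; [exact: ltW|exact: hM].
Qed.

Definition l2_hilbert : hilbert R := @Hilbert R (l2 I H) (@l2_dot R I H) l2_complete.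
End L2.

Definition lspan (R : realType) (V : lmodType R[i]) (S : set V) : set V :=
  [set x | exists (m : nat) (c : 'I_m -> R[i]) (v : 'I_m -> V),
     (forall j, S (v j)) /\ x = \sum_j c j *: v j].

Definition hclosure (R : realType) (H : hilbert R) (S : set H) : set H :=
  [set x | forall e : R, 0 < e -> exists2 y, S y & hnorm (x - y) < e].

Definition hseparable (R : realType) (H : hilbert R) : Prop :=
  exists u : nat -> H, hclosure (range u) = setT.

Definition hnontrivial (R : realType) (H : hilbert R) : Prop :=
  exists x : H, x != 0.

Record hsubspace (R : realType) (H : hilbert R) := HSubspace {
  subspace_set : set H;
  subspace_submod : submod_closed (fun x => `[< subspace_set x >]);
  subspace_closed : forall (u : nat -> H) (l : H),
    (forall k, subspace_set (u k)) -> hcvg \oo u l -> subspace_set l }.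

Definition subspace_pred (R : realType) (H : hilbert R) (M : hsubspace H) :
  {pred H} := fun x => `[< subspace_set M x >].
HB.instance Definition _ (R : realType) (H : hilbert R) (M : hsubspace H) :=
  GRing.isSubmodClosed.Build R[i] H (subspace_pred M) (subspace_submod M).

Record subvec (R : realType) (H : hilbert R) (M : hsubspace H) := SubVec {
  subvec_val :> H;
  _ : subvec_val \in subspace_pred M }.
HB.instance Definition _ (R : realType) (H : hilbert R) (M : hsubspace H) :=
  [isSub for @subvec_val R H M].
HB.instance Definition _ (R : realType) (H : hilbert R) (M : hsubspace H) :=
  [Choice of subvec M by <:].
HB.instance Definition _ (R : realType) (H : hilbert R) (M : hsubspace H) :=
  [SubChoice_isSubLmodule of subvec M by <:].

Definition sub_dot (R : realType) (H : hilbert R) (M : hsubspace H)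
  (x y : subvec M) : R[i] := '[val x, val y].

Section SubHilbert.
Variables (R : realType) (H : hilbert R) (M : hsubspace H).
Local Notation C := R[i].

Lemma sub_dot_bilinear :
  bilinear_for ( *%R : GRing.Scale.law _ _) (Num.conj \; *%R : GRing.Scale.law _ _)
    (@sub_dot R H M).
Proof.
have vE a (x y : subvec M) : val (a *: x + y) = a *: val x + val y by [].
split=> [y a x x'|x a y y']; rewrite /sub_dot vE.
  by rewrite innerDl innerZl.
by rewrite innerDr innerZr.
Qed.
Lemma sub_dot_herm (x y : subvec M) : sub_dot x y = (-1) ^+ false * (sub_dot y x)^*.
Proof. exact: hermitian_subproof. Qed.
Lemma sub_dot_gt0 (x : subvec M) : x != 0 -> 0 < sub_dot x x.
Proof. by move=> x0; rewrite /sub_dot dnorm_gt0. Qed.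
HB.instance Definition _ := bilinear_isBilinear.Build C (subvec M) (subvec M) C
  _ _ (@sub_dot R H M) sub_dot_bilinear.
HB.instance Definition _ := isHermitianSesquilinear.Build C (subvec M) false
  Num.conj (@sub_dot R H M) sub_dot_herm.
HB.instance Definition _ := isDotProduct.Build C (subvec M) (@sub_dot R H M) sub_dot_gt0.

Lemma sub_complete (u : nat -> subvec M) : dcauchy (@sub_dot R H M) u ->
  exists l : subvec M, dcvg (@sub_dot R H M) \oo u l.
Proof.
move=> uc; have [l ul] : exists l : H, hcvg \oo (fun k => val (u k)) l.
  by apply: hcomplete => e /uc[N hN]; exists N.
have lM : l \in subspace_pred M.
  apply/asboolP/(subspace_closed _ ul) => k.
  by have := valP (u k) => /asboolP.
by exists (SubVec lM).
Qed.

Definition sub_hilbert : hilbert R :=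
  @Hilbert R (subvec M) (@sub_dot R H M) sub_complete.
End SubHilbert.

Lemma orthocomp_submod (R : realType) (H : hilbert R) (S : set H) :
  submod_closed (fun x : H => `[< forall s, S s -> '[x, s] = 0 >]).
Proof.
split=> [|a x y /asboolP hx /asboolP hy]; apply/asboolP => s Ss.
  by rewrite inner0l.
by rewrite innerDl innerZl hx // hy // mulr0 addr0.
Qed.

Lemma orthocomp_closed (R : realType) (H : hilbert R) (S : set H)
    (u : nat -> H) (l : H) :
  (forall k s, S s -> '[u k, s] = 0) -> hcvg \oo u l ->
  forall s, S s -> '[l, s] = 0.
Proof.
move=> hu /dcvgP ul s Ss; set z := '[l, s]; apply/eqP; rewrite -normr_eq0.
pose t := z *: s; pose b := dnorm (hdot H) t.
have E k : '[l, t] = '[l - u k, t].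
  by rewrite innerBl [in X in _ - X]/t innerZr hu // mulr0 subr0.
have zE : '[l, t] = `|z| ^+ 2 by rewrite innerZr normCKC.
suff h : complex.Re (`|z| ^+ 2) <= 0.
  move: h; rewrite normc_def -rmorphXn /= => h.
  rewrite (_ : Num.sqrt _ = 0) //; apply/eqP; rewrite -sqrf_eq0.
  by rewrite eq_le h sqr_ge0.
rewrite -zE; apply/ler_addgt0Pr => e e0; rewrite add0r.
have b0 : 0 < b + 1 by rewrite ltr_wpDl // dnormr_ge0.
have [N /(_ N (leqnn _)) hN] := ul _ (divr_gt0 e0 b0).
rewrite (E N); apply: le_trans (dot_Re_le _ _ _) _.
rewrite dnormr_sub; move: hN; rewrite ltr_pdivlMr // => /ltW; apply: le_trans.
by rewrite ler_wpM2l ?dnormr_ge0 // lerDl.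
Qed.

Definition orthocomp (R : realType) (H : hilbert R) (S : set H) : hsubspace H :=
  @HSubspace R H [set x | forall s, S s -> '[x, s] = 0]
    (orthocomp_submod S) (@orthocomp_closed R H S).

Definition bop_pred (R : realType) (H K : hilbert R) : {pred H -> K} :=
  fun f => `[< linear f /\
               exists M : R, forall x, hnorm (f x) <= M * hnorm x >].

Lemma bop_pred_submod (R : realType) (H K : hilbert R) :
  submod_closed (@bop_pred R H K).
Proof.
split=> [|a f g /asboolP[lf [M hM]] /asboolP[lg [N hN]]]; apply/asboolP; split.
- by move=> b x y; rewrite /GRing.zero /= scaler0 addr0.
- by exists 0 => x; rewrite mul0r /hnorm dnormr0.
- move=> b x y; rewrite addrfctE /= !scalrfctE lf lg !scalerDr !scalerA [a * b]mulrC.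
  by rewrite addrACA.
- exists (complex.Re `|a| * M + N) => x.
  rewrite addrfctE scalrfctE; apply: le_trans (ler_dnormD _ _ _) _.
  rewrite mulrDl; apply: lerD; last exact: hN.
  rewrite dnormrZ -mulrA.
  by apply: ler_wpM2l; [rewrite normc_def sqrtr_ge0|exact: hM].
Qed.
HB.instance Definition _ (R : realType) (H K : hilbert R) :=
  GRing.isSubmodClosed.Build R[i] (H -> K) (@bop_pred R H K)
    (@bop_pred_submod R H K).

Record bop (R : realType) (H K : hilbert R) := Bop {
  bop_fun :> H -> K;
  _ : bop_fun \in @bop_pred R H K }.
HB.instance Definition _ (R : realType) (H K : hilbert R) :=
  [isSub for @bop_fun R H K].
HB.instance Definition _ (R : realType) (H K : hilbert R) :=
  [Choice of bop H K by <:].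
HB.instance Definition _ (R : realType) (H K : hilbert R) :=
  [SubChoice_isSubLmodule of bop H K by <:].

Lemma bop_linear (R : realType) (H K : hilbert R) (A : bop H K) : linear A.
Proof. by case: A => f fP; have /asboolP[] := fP. Qed.
HB.instance Definition _ (R : realType) (H K : hilbert R) (A : bop H K) :=
  GRing.isLinear.Build R[i] H K _ (bop_fun A) (bop_linear A).

Lemma bop_bounded (R : realType) (H K : hilbert R) (A : bop H K) :
  exists2 M : R, 0 <= M & forall x, hnorm (A x) <= M * hnorm x.
Proof.
case: A => f fP; have /asboolP[_ [M hM]] := fP; exists `|M| => // x /=.
by apply: le_trans (hM x) _; rewrite ler_wpM2r ?dnormr_ge0 // ler_norm.
Qed.

Lemma id_bop_subproof (R : realType) (H : hilbert R) :
  (idfun : H -> H) \in @bop_pred R H H.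
Proof. by apply/asboolP; split=> //; exists 1 => x; rewrite mul1r. Qed.
Definition id_bop (R : realType) (H : hilbert R) : bop H H :=
  Bop (id_bop_subproof H).

Lemma comp_bop_subproof (R : realType) (H K L : hilbert R) (A : bop K L)
  (B : bop H K) : (A \o B : H -> L) \in @bop_pred R H L.
Proof.
apply/asboolP; split; first by move=> a x y /=; rewrite !linearP.
have [M M0 hM] := bop_bounded A; have [N N0 hN] := bop_bounded B.
exists (M * N) => x; apply: le_trans (hM _) _.
by rewrite -mulrA ler_wpM2l.
Qed.
Definition comp_bop (R : realType) (H K L : hilbert R) (A : bop K L)
  (B : bop H K) : bop H L := Bop (comp_bop_subproof A B).
Notation "A \oB B" := (comp_bop A B)
  (at level 40, left associativity) : ring_scope.

Lemma incl_bop_subproof (R : realType) (H : hilbert R) (M : hsubspace H) :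
  (fun x : sub_hilbert M => subvec_val x) \in @bop_pred R (sub_hilbert M) H.
Proof. by apply/asboolP; split=> //; exists 1 => x; rewrite mul1r. Qed.
Definition incl_bop (R : realType) (H : hilbert R) (M : hsubspace H) :
  bop (sub_hilbert M) H := Bop (incl_bop_subproof M).

(* Operators given by a description (here and below: projection, adjoint,
   positive square root, tensor product, functional calculus, Poisson kernel)
   are defined by choice; each exists and is unique under its usual hypotheses,
   and xget 0 returns 0 otherwise. The projection is H -> M, not H -> H. *)
Definition proj_bop (R : realType) (H : hilbert R) (M : hsubspace H) :
    bop H (sub_hilbert M) :=
  xget 0 [set P : bop H (sub_hilbert M) | forall x m, subspace_set M m -> '[x - incl_bop M (P x), m] = 0].

Definition compression (R : realType) (H : hilbert R) (M : hsubspace H)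
    (A : bop H H) : bop (sub_hilbert M) (sub_hilbert M) :=
  proj_bop M \oB A \oB incl_bop M.

Definition adj (R : realType) (H K : hilbert R) (A : bop H K) : bop K H :=
  xget 0 [set B : bop K H | forall x y, '[A x, y] = '[x, B y]].

Definition pos_bop (R : realType) (H : hilbert R) (A : bop H H) : Prop :=
  forall x, 0 <= '[A x, x].

Definition sqrt_bop (R : realType) (H : hilbert R) (A : bop H H) : bop H H :=
  xget 0 [set D : bop H H | pos_bop D /\ D \oB D = A].

Definition opnorm (R : realType) (H K : hilbert R) (A : bop H K) : R :=
  inf [set M : R | 0 <= M /\ forall x, hnorm (A x) <= M * hnorm x].

Definition unitary_bop (R : realType) (H K : hilbert R) (U : bop H K) : Prop :=
  adj U \oB U = id_bop H /\ U \oB adj U = id_bop K.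

Definition sot_cvg (R : realType) (H K : hilbert R) (X : Type)
    (F : set_system X) (A : X -> bop H K) (B : bop H K) : Prop :=
  forall h : H, hcvg F (fun t => A t h) (B h).

(* A basic WOT-neighbourhood of A is given by finitely many pairs (x, y) and e > 0. *)
Definition wot_closure (R : realType) (H K : hilbert R) (S : set (bop H K)) :
    set (bop H K) :=
  [set A | forall (s : seq (H * K)) (e : R), 0 < e ->
     exists2 B, S B &
       forall p, p \in s -> complex.Re `|'[A p.1, p.2] - '[B p.1, p.2]| < e].

Definition wot_closed (R : realType) (H K : hilbert R) (S : set (bop H K)) : Prop :=
  wot_closure S `<=` S.

Definition linear_set (R : realType) (V : lmodType R[i]) (S : set V) : Prop :=
  S 0 /\ forall (a : R[i]) x y, S x -> S y -> S (a *: x + y).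

Definition subalgebra (R : realType) (H : hilbert R) (S : set (bop H H)) : Prop :=
  linear_set S /\ forall A B, S A -> S B -> S (A \oB B).

Definition wot_algebra (R : realType) (H : hilbert R) (G : set (bop H H)) :
    set (bop H H) :=
  [set A | forall S : set (bop H H),
     G `<=` S -> subalgebra S -> wot_closed S -> S A].

(* tau exhibits L as the Hilbert space tensor product of G and H; this
   determines L up to a unitary that respects the elementary tensors. *)
Record hilbert_tensor (R : realType) (G H L : hilbert R) (tau : G -> H -> L) :
    Prop := HilbertTensor {
  tensor_linearl : forall h, linear (fun g => tau g h);
  tensor_linearr : forall g, linear (tau g);
  tensor_inner : forall g g' h h',
    '[tau g h, tau g' h'] = '[g, g'] * '[h, h'];
  tensor_total :
    hclosure (lspan [set x | exists g h, x = tau g h]) = setT }.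

Definition tensor_bop (R : realType) (G H L : hilbert R) (tau : G -> H -> L)
    (A : bop G G) (B : bop H H) : bop L L :=
  xget 0 [set X : bop L L | forall g h, X (tau g h) = tau (A g) (B h)].

Lemma l2_delta_subproof (R : realType) (I : choiceType) (H : hilbert R) (i : I) (h : H) :
  (fun j => if j == i then h else 0) \in @l2_pred R I H.
Proof.
apply/asboolP; exists (hnorm h ^+ 2) => F uF.
have [iF|iF] := boolP (i \in F).
  rewrite (bigD1_seq i) //= eqxx big1 ?addr0 // => j /negPf ->.
  by rewrite /hnorm dnormr0 expr0n.
rewrite big_seq big1 ?sqr_ge0 // => j jF; case: eqP => [ji|_].
  by rewrite -ji jF in iF.
by rewrite /hnorm dnormr0 expr0n.
Qed.
Definition l2_delta (R : realType) (I : choiceType) (H : hilbert R) (i : I) (h : H) :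
    l2_hilbert I H :=
  L2 (l2_delta_subproof i h).

(* l2(I; H) as the tensor product of l2(I) and H. *)
Section L2Tensor.
Variables (R : realType) (I : choiceType) (H : hilbert R).
Local Notation K := (scalar_hilbert R).

Lemma l2_tens_subproof (x : l2 I K) (h : H) :
  (fun i => (x i : R[i]) *: h) \in @l2_pred R I H.
Proof.
apply/asboolP; have [M hM] := l2_bound x.
exists (M * hnorm h ^+ 2) => F uF.
apply: le_trans (ler_wpM2r (sqr_ge0 _) (hM F uF)); rewrite mulr_suml.
by apply: ler_sum => i _; rewrite {1}/hnorm dnormrZ exprMn [hnorm (x i)]scalar_dnorm.
Qed.
Definition l2_tens (x : l2_hilbert I K) (h : H) : l2_hilbert I H :=
  L2 (l2_tens_subproof x h).

Lemma l2_tensP : hilbert_tensor l2_tens.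
Proof.
split.
- move=> h a x y; apply/val_inj/funext => i /=.
  by rewrite [LHS](scalerDl (h : H) (a * (x i : R[i])) (y i)) -scalerA.
- move=> x a h h'; apply/val_inj/funext => i /=.
  transitivity (a *: ((x i : R[i]) *: h : H) + (x i : R[i]) *: h'); last by [].
  by rewrite scalerDr !scalerA [a * _]mulrC.
- move=> x y h k; apply: l2_dotE.
  have := has_sumZ '[h, k] (l2_dotP x y); rewrite mulrC.
  congr (has_sum _ _); apply/funext => i /=.
  by rewrite innerZl innerZr /GRing.scale /= mulrC -mulrA.
apply/seteqP; split=> // f _ e e0.
have [M /l2_dot_sqr[s [Es _ hs]]] := l2_bound f.
have nf : dnorm (@l2_dot R I H) f ^+ 2 = s by apply: complexI; rewrite -dnorm_def.
have e2 : 0 < (e / 2) ^+ 2 by rewrite exprn_gt0 // divr_gt0.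
have [F uF hF] : exists2 F, uniq F &
    s - (e / 2) ^+ 2 <= \sum_(i <- F) hnorm (f i) ^+ 2.
  have [F0 h0] := l2_dotP f f e2; exists (undup F0); first exact: undup_uniq.
  have := h0 _ (undup_uniq F0) (fun i => etrans (mem_undup F0 i)).
  have -> : \sum_(i <- undup F0) ('[f i, f i] : K) - l2_dot f f =
      (\sum_(i <- undup F0) hnorm (f i) ^+ 2 - s)%:C%C.
    rewrite Es rmorphB rmorph_sum; congr (_ - _).
    by apply: eq_bigr => i _; rewrite inner_hnorm.
  rewrite /hnorm scalar_dnorm normc_def /= expr0n /= addr0 sqrtr_sqr.
  by rewrite ltr_norml => /andP[/ltW + _]; rewrite lerBrDl addrC.
pose y : l2_hilbert I H := \sum_(i <- F) l2_tens (@l2_delta R I K i 1) (f i).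
have yE j : y j = if j \in F then f j else 0.
  have -> : y j = \sum_(i <- F) (if j == i then f i else 0).
    rewrite /y; elim: (F) => [|i G IH]; first by rewrite !big_nil.
    rewrite !big_cons -IH l2DE; congr (_ + _) => /=.
    by case: eqP => _; rewrite ?scale1r ?scale0r.
  case: ifP => jF; last first.
    rewrite big_seq big1 // => i iF; case: eqP => // ji.
    by rewrite ji iF in jF.
  rewrite (bigD1_seq j) //= eqxx big1 ?addr0 // => i.
  by rewrite eq_sym => /negPf ->.
exists y.
  exists (size F), (fun=> 1), (fun k => l2_tens (@l2_delta R I K (tnth (in_tuple F) k) 1)
    (f (tnth (in_tuple F) k))); split.
    by move=> k; do 2 eexists.
  by rewrite /y big_tnth; apply: eq_bigr => k _; rewrite scale1r.
apply: (@le_lt_trans _ _ (e / 2)); last by rewrite ltr_pdivrMr // ltr_pMr // ltr1n.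
apply: l2_dnorm_le => [|G uG]; first by rewrite divr_ge0 ?ltW.
have uFG : uniq (F ++ [seq i <- G | i \notin F]).
  rewrite cat_uniq uF filter_uniq // andbT; apply/hasPn => i.
  by rewrite mem_filter => /andP[].
have := hs _ uFG; rewrite big_cat /= => h.
have {h} h : \sum_(i <- G | i \notin F) hnorm (f i) ^+ 2 <= (e / 2) ^+ 2.
  rewrite -big_filter -(lerD2l (\sum_(i <- F) hnorm (f i) ^+ 2)).
  by apply: le_trans h _; rewrite -lerBlDr.
apply: le_trans h; rewrite (bigID (mem F)) /= big1 ?add0r => [|i iF].
  apply: ler_sum => i iF.
  apply: (@le_trans _ _ (hnorm (f i - y i) ^+ 2)); first by [].
  by rewrite yE (negPf iF) subr0.
transitivity (hnorm (f i - y i) ^+ 2); first by [].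
by rewrite yE iF subrr /hnorm dnormr0 expr0n.
Qed.
End L2Tensor.

(* M_p (x) B(H, K) is identified with the p x p matrices over B(H, K), acting
   from H^p to K^p. *)
Section MatrixOperators.
Variables (R : realType) (H K : hilbert R) (p : nat).

Lemma ler_sum_uniq (f : 'I_p -> K) (F : seq 'I_p) : uniq F ->
  \sum_(i <- F) hnorm (f i) ^+ 2 <= \sum_i hnorm (f i) ^+ 2.
Proof.
move=> uF; rewrite [leRHS](bigID (mem F)) /= big_uniq //= lerDl.
by apply: sumr_ge0 => i _; exact: sqr_ge0.
Qed.

Lemma mx_bop_l2 (X : 'M[bop H K]_p) (x : l2_hilbert 'I_p H) :
  (fun i => \sum_j X i j (x j)) \in @l2_pred R 'I_p K.
Proof.
apply/asboolP; exists (\sum_i hnorm (\sum_j X i j (x j)) ^+ 2) => F uF.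
exact: ler_sum_uniq.
Qed.

Lemma mx_bop_subproof (X : 'M[bop H K]_p) :
  (fun x : l2_hilbert 'I_p H => L2 (mx_bop_l2 X x) : l2_hilbert 'I_p K)
    \in @bop_pred R (l2_hilbert 'I_p H) (l2_hilbert 'I_p K).
Proof.
apply/asboolP; split=> [a x y|].
  apply/val_inj/funext => i /=.
  transitivity (a *: (\sum_j X i j (x j)) + \sum_j X i j (y j)); last by [].
  rewrite scaler_sumr -big_split /=; apply: eq_bigr => j _.
  exact: (bop_linear (X i j)).
have /boolp.choice[M hM] : forall ij : 'I_p * 'I_p, exists m : R,
    0 <= m /\ forall x, hnorm (X ij.1 ij.2 x) <= m * hnorm x.
  by move=> [i j]; have [m m0 hm] := bop_bounded (X i j); exists m.
exists (Num.sqrt (\sum_i (\sum_j M (i, j)) ^+ 2)) => x.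
apply: l2_dnorm_le => [|F uF].
  by rewrite mulr_ge0 ?sqrtr_ge0 ?dnormr_ge0.
apply: le_trans (ler_sum_uniq _ uF) _.
rewrite exprMn sqr_sqrtr; last by apply: sumr_ge0 => i _; exact: sqr_ge0.
rewrite mulr_suml; apply: ler_sum => i _; rewrite -exprMn.
have S0 : 0 <= \sum_j M (i, j) by apply: sumr_ge0 => j _; have [] := hM (i, j).
rewrite ler_pXn2r ?nnegrE ?mulr_ge0 ?dnormr_ge0 //=.
apply: le_trans (ler_dnorm_sum _ _ _) _; rewrite mulr_suml.
apply: ler_sum => j _; have [m0 hm] := hM (i, j).
apply: le_trans (hm _) _; apply: ler_wpM2l => //.
exact: l2_coord_le.
Qed.
Definition mx_bop (X : 'M[bop H K]_p) :
  bop (l2_hilbert 'I_p H) (l2_hilbert 'I_p K) := Bop (mx_bop_subproof X).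
End MatrixOperators.

(* The full Fock space on C^n, in the coordinates given by its orthonormal
   basis (e_w), w ranging over the words in n letters. *)
Section Fock.
Variables (R : realType) (n : nat).
Local Notation K := (scalar_hilbert R).

Definition fock : hilbert R := l2_hilbert (seq 'I_n) K.

Definition fock_basis (w : seq 'I_n) : fock := @l2_delta R (seq 'I_n) K w 1.

Definition creation_fun (i : 'I_n) (x : l2 (seq 'I_n) K) (w : seq 'I_n) : K :=
  if w is j :: v then if j == i then x v else 0 else 0.

Lemma creation_fun_sum (i : 'I_n) (x : l2 (seq 'I_n) K) (F : seq (seq 'I_n)) :
  uniq F -> \sum_(w <- F) hnorm (creation_fun i x w) ^+ 2 <=
            dnorm (@l2_dot R (seq 'I_n) K) x ^+ 2.
Proof.
move=> uF; pose g (w : seq 'I_n) :=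
  if w is j :: v then if j == i then Some v else None else None.
have gK : ocancel g (cons i) by case=> //= j v; case: eqP => //= ->.
have := l2_dnorm_ge x (pmap_uniq gK uF); apply: le_trans.
elim: F {uF} => [|w F IH]; first by rewrite !big_nil.
rewrite big_cons; case: w => [|j v] /=.
  by rewrite /hnorm dnormr0 expr0n add0r.
case: eqP => _ /=; first by rewrite big_cons lerD2l.
by rewrite /hnorm dnormr0 expr0n add0r.
Qed.

Lemma creation_l2 (i : 'I_n) (x : fock) :
  creation_fun i x \in @l2_pred R (seq 'I_n) K.
Proof. by apply/asboolP; eexists => F uF; exact: creation_fun_sum. Qed.

Lemma creation_subproof (i : 'I_n) :
  (fun x : fock => L2 (creation_l2 i x) : fock) \in @bop_pred R fock fock.
Proof.
apply/asboolP; split=> [a x y|].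
  apply/val_inj/funext => -[|j v] /=.
    by apply: esym; apply: etrans (addr0 _) (mulr0 _).
  rewrite /GRing.add /= /GRing.scale /=.
  case: (j == i) => //.
  by apply: esym; apply: etrans (addr0 _) (mulr0 _).
exists 1 => x; rewrite mul1r; apply: l2_dnorm_le => [|F uF].
  exact: dnormr_ge0.
exact: creation_fun_sum.
Qed.
Definition creation (i : 'I_n) : bop fock fock := Bop (creation_subproof i).

Lemma creation_basis (i : 'I_n) (w : seq 'I_n) :
  creation i (fock_basis w) = fock_basis (i :: w).
Proof.
apply/val_inj/funext => -[|j v] //=; rewrite eqseq_cons.
by case: (j == i).
Qed.

Definition Finf : set (bop fock fock) :=
  wot_algebra (range creation `|` [set id_bop fock]).

Definition wot_ideal (J : set (bop fock fock)) : Prop :=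
  [/\ J `<=` Finf, linear_set J,
      forall f g, Finf f -> J g -> J (f \oB g) /\ J (g \oB f) &
      wot_closed J].

(* The coefficient a_w in f 1 = sum_w a_w e_w. *)
Definition fcoef (f : bop fock fock) (w : seq 'I_n) : R[i] :=
  (f (fock_basis [::])) w.

Variable H : hilbert R.
Implicit Type T : 'I_n -> bop H H.

Fixpoint word_bop T (w : seq 'I_n) : bop H H :=
  if w is i :: v then T i \oB word_bop T v else id_bop H.

Definition defect T : bop H H := id_bop H - \sum_i T i \oB adj (T i).

Definition row_contraction T : Prop := pos_bop (defect T).

Definition C0_row T : Prop :=
  sot_cvg \oo (fun k => \sum_(w : k.-tuple 'I_n)
                          word_bop T w \oB adj (word_bop T w)) 0.

(* A = SOT-lim_(r -> 1-) sum_k sum_(|w| = k) r^k a_w T_w, where fr r is the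
   inner sum. *)
Definition is_fcalc T (f : bop fock fock) (A : bop H H) : Prop :=
  exists fr : R -> bop H H,
    (forall r : R, 0 < r < 1 ->
      sot_cvg \oo (fun m => \sum_(k < m) \sum_(w : k.-tuple 'I_n)
        ((r ^+ k)%:C%C * fcoef f w) *: word_bop T w) (fr r)) /\
    sot_cvg (1 : R)^'- fr A.

Definition fcalc T (f : bop fock fock) : bop H H := xget 0 (is_fcalc T f).

Definition poisson T : bop H (l2_hilbert (seq 'I_n) H) :=
  xget 0 [set X : bop H (l2_hilbert (seq 'I_n) H) | forall h : H,
    has_sum (fun w => l2_tens (fock_basis w)
                        (sqrt_bop (defect T) (adj (word_bop T w) h))) (X h)].

End Fock.

Section ConstrainedShifts.
Variables (R : realType) (n : nat) (J : set (bop (fock R n) (fock R n))).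

Definition MJ : set (fock R n) :=
  hclosure (lspan [set x | exists f y, J f /\ x = f y]).

Definition NJ : hilbert R := sub_hilbert (orthocomp MJ).

Definition BJ (i : 'I_n) : bop NJ NJ :=
  compression (orthocomp MJ) (creation R i).

Definition WJinf : set (bop NJ NJ) :=
  wot_algebra (range BJ `|` [set id_bop NJ]).

Definition WJ : set (bop NJ NJ) :=
  lspan [set X | exists f g, [/\ Finf f, Finf g, WJinf (fcalc BJ f),
    WJinf (fcalc BJ g) & X = fcalc BJ f \oB adj (fcalc BJ g)]].

(* Phi_T^J, as a total function of which only the restriction to WJ matters. *)
Definition is_PhiJ (H : hilbert R) (T : 'I_n -> bop H H)
    (Phi : bop NJ NJ -> bop H H) : Prop :=
  (forall (a : R[i]) X Y, WJ X -> WJ Y ->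
     Phi (a *: X + Y) = a *: Phi X + Phi Y) /\
  (forall f g, Finf f -> Finf g ->
     Phi (fcalc BJ f \oB adj (fcalc BJ g)) = fcalc T f \oB adj (fcalc T g)).

End ConstrainedShifts.

(* Only the values on separable nonzero H and d > 0 are meaningful. *)
Definition radius_family (R : realType) : Type :=
  forall (H : hilbert R) (d : nat), ('I_d -> bop H H) -> R.

Section JointRadius.
Variables (R : realType) (omega : radius_family R).

Definition hproper (H : hilbert R) : Prop := hseparable H /\ hnontrivial H.

Definition joint_radius : Prop :=
  forall (H : hilbert R) (d : nat) (T : 'I_d -> bop H H),
    hproper H -> (0 < d)%N ->
    [/\ 0 <= omega T,
        forall s : 'S_d, omega (fun i => T (s i)) = omega T &
        omega (fun i : 'I_d.+1 => oapp T 0 (unlift ord_max i)) = omega T].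

Definition radius_unitary : Prop :=
  forall (H K : hilbert R) (U : bop K H) (d : nat) (T : 'I_d -> bop H H),
    hproper H -> hproper K -> (0 < d)%N -> unitary_bop U ->
    omega (fun i => adj U \oB T i \oB U) = omega T.

Definition radius_ampliation : Prop :=
  forall (G H L : hilbert R) (tau : G -> H -> L) (d : nat)
    (T : 'I_d -> bop H H),
    hproper G -> hproper H -> (0 < d)%N -> hilbert_tensor tau ->
    omega (fun i => tensor_bop tau (id_bop G) (T i)) = omega T.

(* A i is the restriction of T i to M, so that M is invariant under T i. *)
Definition radius_restriction : Prop :=
  forall (H : hilbert R) (M : hsubspace H) (d : nat) (T : 'I_d -> bop H H)
    (A : 'I_d -> bop (sub_hilbert M) (sub_hilbert M)),
    hproper H -> hnontrivial (sub_hilbert M) -> (0 < d)%N ->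
    (forall i x, incl_bop M (A i x) = T i (incl_bop M x)) ->
    omega A <= omega T.

Definition radius_compression : Prop :=
  forall (H : hilbert R) (M : hsubspace H) (d : nat) (T : 'I_d -> bop H H),
    hproper H -> hnontrivial (sub_hilbert M) -> (0 < d)%N ->
    omega (fun i => compression M (T i)) <= omega T.

Definition admissible : Prop :=
  [/\ radius_unitary, radius_ampliation & radius_restriction].

Definition strongly_admissible : Prop :=
  [/\ radius_unitary, radius_ampliation & radius_compression].

End JointRadius.

(* Main.v *)
Require Import Defs.
From HB Require Import structures.
From mathcomp Require Import all_boot all_order all_algebra complex.
From mathcomp Require Import boolp classical_sets reals.
From mathcomp Require Import topology normedtype sequences realfun ring lra.
(** The Poisson kernel [K = K_T] of a [C_0]-row contraction is an isometry with
    [K T_i^* = (S_i^* (x) I) K]; comparing Taylor sums on elementary tensors gives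
    [f(T) K^* = K^* (f (x) I)], hence von Neumann's inequality for [f(rT)] and the
    formula [f(T) = K^* (f (x) I) K].  As [J] annihilates [T], the range of [K] lies
    in [N_J (x) H], and [X |-> K^* (X (x) I) K] is the required map.  An ampliation
    of [K] is then an isometry [V] with [Phi(X) = V^* (I (x) X) V], which yields
    complete contractivity and (ii); for (i), [V] also intertwines the adjoints.
    For (i) one needs that every element of [W_J^oo] is of the form [f(B)]: it
    commutes with the compressed right shifts, and a commutant lifting theorem
    provides an operator commuting with the right shifts themselves. *)
Set Implicit Arguments.
Unset Strict Implicit.
Unset Printing Implicit Defensive.
Import Order.TTheory GRing.Theory Num.Theory.
Import numFieldNormedType.Exports.
Local Open Scope classical_set_scope.
Local Open Scope ring_scope.

(** * Hilbert spaces *)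

(** Since [fcalc], [poisson], [sqrt_bop] and [tensor_bop] are choices, each identity about them
    rests on an existence proof. The limit [r -> 1] needs a bound on [f(r T)] uniform in [r]; this
    is why von Neumann's inequality precedes the formula for [f(T)]. It comes from the Poisson
    kernel of [r T], which is pure for every [r < 1]. The map is defined by its Poisson formula on
    all operators on [N_J], so an element of the span with several expressions as a sum of products
    [f(B) g(B)^*] causes no trouble. Parts (i) and (ii) differ because [V^* (I (x) X) V] compresses
    [I (x) X] to the range of [V] for every [X], whereas invariance of that range is obtained for
    [I (x) F^*] with [F] having entries [f(B)]. An element of [W_J^oo] is only given through a WOT
    closure, so its symbol [f] has to be recovered. Right shifts serve for this because [F_n^oo] is
    their commutant: commutation is WOT-closed and survives compression to [N_J]. *)

Section Cabs.
Variable R : realType.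
Implicit Types z w : R[i].

Definition cabs z : R := complex.Re `|z|.

Lemma cabsE z : `|z| = (cabs z)%:C%C.
Proof. by rewrite /cabs normc_def. Qed.
Lemma cabs_ge0 z : 0 <= cabs z.
Proof. by rewrite /cabs normc_def /= sqrtr_ge0. Qed.
Lemma cabsM z w : cabs (z * w) = cabs z * cabs w.
Proof. by apply: complexI; rewrite -cabsE normrM rmorphM /= !cabsE. Qed.
Lemma cabsD z w : cabs (z + w) <= cabs z + cabs w.
Proof. by rewrite -lecR rmorphD /= -!cabsE ler_normD. Qed.
Lemma cabs_eq0 z : cabs z = 0 -> z = 0.
Proof. by move=> h; apply/eqP; rewrite -normr_eq0 cabsE h. Qed.
Lemma cabsJ z : cabs z^* = cabs z.
Proof. by rewrite /cabs norm_conjC. Qed.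
Lemma cabsN z : cabs (- z) = cabs z.
Proof. by rewrite /cabs normrN. Qed.
Lemma cabsR (x : R) : 0 <= x -> cabs x%:C%C = x.
Proof.
by move=> x0; apply: complexI; rewrite -cabsE ger0_norm // lecR.
Qed.
Lemma mul_conj_cabs z : z * z^* = (cabs z ^+ 2)%:C%C.
Proof. by rewrite -normCK cabsE rmorphXn. Qed.
Lemma conjR (x : R) : (x%:C%C : R[i])^* = x%:C%C.
Proof. exact: conjc_real. Qed.
Lemma conjM z w : (z * w)^* = z^* * w^*. Proof. exact: rmorphM. Qed.
Lemma ReJ z : complex.Re z^* = complex.Re z. Proof. by case: z. Qed.
Lemma ReD z w : complex.Re (z + w) = complex.Re z + complex.Re w.
Proof. by rewrite raddfD. Qed.
Lemma ReB z w : complex.Re (z - w) = complex.Re z - complex.Re w.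
Proof. by rewrite raddfB. Qed.
Lemma ReR (x : R) z : complex.Re (x%:C%C * z) = x * complex.Re z.
Proof. by case: z => a b /=; rewrite mul0r subr0. Qed.
End Cabs.

Section Hilbert.
Variable R : realType.
Implicit Types H K : hilbert R.
Local Notation Re := complex.Re.

Lemma hnorm_ge0 H (x : H) : 0 <= hnorm x. Proof. exact: dnormr_ge0. Qed.
Hint Resolve hnorm_ge0 : core.
Lemma hnorm0 H : hnorm (0 : H) = 0. Proof. exact: dnormr0. Qed.
Lemma hnorm_eq0 H (x : H) : hnorm x = 0 -> x = 0. Proof. exact: dnormr_eq0. Qed.
Lemma hnormZ H a (x : H) : hnorm (a *: x) = cabs a * hnorm x.
Proof. exact: dnormrZ. Qed.
Lemma hnormN H (x : H) : hnorm (- x) = hnorm x. Proof. exact: dnormrN. Qed.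
Lemma hnormD H (x y : H) : hnorm (x + y) <= hnorm x + hnorm y.
Proof. exact: ler_dnormD. Qed.
Lemma hnormBC H (x y : H) : hnorm (x - y) = hnorm (y - x).
Proof. exact: dnormr_sub. Qed.
Lemma hnormB H (x y : H) : hnorm (x - y) <= hnorm x + hnorm y.
Proof. by rewrite -(hnormN y); exact: hnormD. Qed.
Lemma hnorm_triangle H (y x z : H) : hnorm (x - z) <= hnorm (x - y) + hnorm (y - z).
Proof. by rewrite -(subrKA y); exact: hnormD. Qed.
Lemma hnorm_sum H (I : Type) (s : seq I) (P : pred I) (u : I -> H) :
  hnorm (\sum_(i <- s | P i) u i) <= \sum_(i <- s | P i) hnorm (u i).
Proof.
elim/big_ind2: _ => //; first by rewrite hnorm0.
by move=> x a y b xa yb; apply: le_trans (hnormD _ _) (lerD xa yb).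
Qed.
Lemma hnormD_sqr H (x y : H) :
  hnorm (x + y) ^+ 2 = hnorm x ^+ 2 + hnorm y ^+ 2 + 2 * Re '[x, y].
Proof. exact: dnormrD_sqr. Qed.
Lemma hnormD_sqr_le H (x y : H) :
  hnorm (x + y) ^+ 2 <= 2 * hnorm x ^+ 2 + 2 * hnorm y ^+ 2.
Proof. exact: dnormrD_sqr_le. Qed.
Lemma Re_inner_le H (x y : H) : Re '[x, y] <= hnorm x * hnorm y.
Proof. exact: dot_Re_le. Qed.
Lemma Re_innerxx H (x : H) : Re '[x, x] = hnorm x ^+ 2.
Proof. by rewrite inner_hnorm. Qed.
Lemma hnorm_sqr_le H (K : hilbert R) (x : H) (y : K) :
  hnorm x ^+ 2 <= hnorm y ^+ 2 -> hnorm x <= hnorm y.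
Proof. by rewrite ler_pXn2r ?nnegrE. Qed.

Lemma inner0r H (x : H) : '[x, 0] = 0. Proof. exact: linear0r. Qed.
Lemma innerBr H (x y z : H) : '[x, y - z] = '[x, y] - '[x, z].
Proof. exact: linearBr. Qed.
Lemma innerNr H (x y : H) : '[x, - y] = - '[x, y]. Proof. exact: linearNr. Qed.
Lemma inner_suml H (I : Type) (s : seq I) (P : pred I) (u : I -> H) y :
  '[\sum_(i <- s | P i) u i, y] = \sum_(i <- s | P i) '[u i, y].
Proof.
by elim/big_ind2: _ => [|a u1 b u2 <- <-|//]; rewrite ?inner0l ?innerDl.
Qed.
Lemma inner_sumr H (I : Type) (s : seq I) (P : pred I) (u : I -> H) y :
  '[y, \sum_(i <- s | P i) u i] = \sum_(i <- s | P i) '[y, u i].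
Proof.
by elim/big_ind2: _ => [|a u1 b u2 <- <-|//]; rewrite ?inner0r ?innerDr.
Qed.
Lemma Re_innerC H (x y : H) : Re '[x, y] = Re '[y, x].
Proof. by rewrite innerC ReJ. Qed.

Lemma cabs_inner_le H (x y : H) : cabs '[x, y] <= hnorm x * hnorm y.
Proof.
set c := '[x, y]; have [->|c0] := eqVneq (cabs c) 0; first by rewrite mulr_ge0.
have cp : 0 < cabs c by rewrite lt_def c0 cabs_ge0.
(* Rotating and scaling [y] by [c] turns the inner product into the real number [|c|^2]. *)
have := Re_inner_le x (c *: y).
rewrite innerZr -/c mulrC mul_conj_cabs /= hnormZ mulrCA expr2.
by rewrite ler_pM2l.
Qed.

Lemma inner_eq0 H (x : H) : (forall y, '[x, y] = 0) -> x = 0.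
Proof.
move=> /(_ x) h; apply: hnorm_eq0; apply/eqP; rewrite -sqrf_eq0 -Re_innerxx h.
by [].
Qed.

Lemma inner_ext H (x y : H) : (forall z, '[x, z] = '[y, z]) -> x = y.
Proof.
move=> h; apply/eqP; rewrite -subr_eq0; apply/eqP/inner_eq0 => z.
by rewrite innerBl h subrr.
Qed.

Lemma inner_conj0 H (x y : H) : '[x, y] = 0 -> '[y, x] = 0.
Proof. by move=> h; rewrite innerC h conjC0. Qed.

Lemma parallelogram H (x y : H) :
  hnorm (x + y) ^+ 2 + hnorm (x - y) ^+ 2 = 2 * hnorm x ^+ 2 + 2 * hnorm y ^+ 2.
Proof. by rewrite !hnormD_sqr hnormN innerNr raddfN /=; ring. Qed.

Lemma hcvgP H (X : Type) (F : set_system X) {FF : Filter F} (u : X -> H) l :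
  hcvg F u l <-> forall e, 0 < e -> \forall x \near F, hnorm (u x - l) < e.
Proof.
split=> [/cvgrPdist_lt h e /h|h].
  apply: filterS => x /=; rewrite sub0r normrN ger0_norm //; exact: hnorm_ge0.
apply/cvgrPdist_lt => e /h; apply: filterS => x /=.
by rewrite sub0r normrN ger0_norm //; exact: hnorm_ge0.
Qed.

Lemma hcvg_seqP H (u : nat -> H) l :
  hcvg \oo u l <-> forall e, 0 < e -> exists N : nat,
    forall k, (N <= k)%N -> hnorm (u k - l) < e.
Proof. exact: dcvgP. Qed.

Lemma hcvg_unique H (X : Type) (F : set_system X) {FF : ProperFilter F}
    (u : X -> H) l m : hcvg F u l -> hcvg F u m -> l = m.
Proof.
move=> /hcvgP ul /hcvgP um; apply/eqP; rewrite -subr_eq0; apply/eqP/hnorm_eq0.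
apply/eqP; rewrite eq_le hnorm_ge0 andbT; apply/ler_addgt0Pr => e e0; rewrite add0r.
have e2 := divr_gt0 e0 (ltr0Sn R 1).
have [x [h1 h2]] := filter_ex (filterI (ul _ e2) (um _ e2)).
apply: le_trans (hnorm_triangle (u x) _ _) _.
by rewrite hnormBC [leRHS]splitr lerD // ltW.
Qed.

Lemma hcvg_cst H (X : Type) (F : set_system X) {FF : Filter F} (l : H) :
  hcvg F (fun=> l) l.
Proof. by apply/hcvgP => e e0; apply: nearW => x; rewrite subrr hnorm0. Qed.

Lemma hcvgD H (X : Type) (F : set_system X) {FF : Filter F} (u v : X -> H) l m :
  hcvg F u l -> hcvg F v m -> hcvg F (fun x => u x + v x) (l + m).
Proof.
move=> /hcvgP ul /hcvgP um; apply/hcvgP => e e0.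
have e2 := divr_gt0 e0 (ltr0Sn R 1).
apply: filterS2 (ul _ e2) (um _ e2) => x h1 h2.
rewrite opprD addrACA; apply: le_lt_trans (hnormD _ _) _.
by rewrite [ltRHS]splitr ltrD.
Qed.

Section BopApp.
Variables (H K : hilbert R) (A : bop H K).
Lemma bopD x y : A (x + y) = A x + A y. Proof. exact: linearD. Qed.
Lemma bopB x y : A (x - y) = A x - A y. Proof. exact: linearB. Qed.
Lemma bopZ a x : A (a *: x) = a *: A x. Proof. exact: linearZ. Qed.
Lemma bop0 : A 0 = 0. Proof. exact: linear0. Qed.
Lemma bop_sum (I : Type) (s : seq I) (P : pred I) (u : I -> H) :
  A (\sum_(i <- s | P i) u i) = \sum_(i <- s | P i) A (u i).
Proof. exact: linear_sum. Qed.
End BopApp.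

Lemma hcvg_bop H K (A : bop H K) (X : Type) (F : set_system X) {FF : Filter F}
  (u : X -> H) l : hcvg F u l -> hcvg F (fun x => A (u x)) (A l).
Proof.
have [M M0 hM] := bop_bounded A; move=> /hcvgP ul; apply/hcvgP => e e0.
have M1 : 0 < M + 1 by rewrite ltr_wpDl.
apply: filterS (ul _ (divr_gt0 e0 M1)) => x; rewrite ltr_pdivlMr // => h.
rewrite -bopB; apply: le_lt_trans (hM _) _; apply: le_lt_trans h.
by rewrite mulrC ler_wpM2l // lerDl.
Qed.

Lemma hcvgZ H (a : R[i]) (X : Type) (F : set_system X) {FF : Filter F}
  (u : X -> H) l : hcvg F u l -> hcvg F (fun x => a *: u x) (a *: l).
Proof. by move=> h; apply: (hcvg_bop (a *: id_bop H) h). Qed.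

Lemma hcvgB H (X : Type) (F : set_system X) {FF : Filter F} (u v : X -> H) l m :
  hcvg F u l -> hcvg F v m -> hcvg F (fun x => u x - v x) (l - m).
Proof.
move=> ul vm; apply: hcvgD => //.
exact: (hcvg_bop (- id_bop H) vm).
Qed.

Lemma hcvg_hnorm_le H (X : Type) (F : set_system X) {FF : ProperFilter F}
    (u : X -> H) l (c : R) :
  hcvg F u l -> (\forall x \near F, hnorm (u x) <= c) -> hnorm l <= c.
Proof.
move=> /hcvgP ul hc; apply/ler_addgt0Pr => e e0.
have [x [h1 h2]] := filter_ex (filterI (ul _ e0) hc).
rewrite -(subrK (u x) l) addrC; apply: le_trans (hnormD _ _) _.
by rewrite lerD // hnormBC ltW.
Qed.

Lemma hcvg_near_le H K (X : Type) (F : set_system X) {FF : Filter F}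
    (u : X -> H) (v : X -> K) l m :
  (\forall x \near F, hnorm (u x - l) <= hnorm (v x - m)) -> hcvg F v m -> hcvg F u l.
Proof.
move=> h /hcvgP vm; apply/hcvgP => e /vm; apply: filterS2 h => x.
exact: le_lt_trans.
Qed.

End Hilbert.
#[global] Hint Extern 0 (is_true (_ <= hnorm _)) => (exact: hnorm_ge0) : core.
#[global] Hint Extern 0 (is_true (_ <= cabs _)) => (exact: cabs_ge0) : core.

(** * Closed subspaces and orthogonal projections *)

Section Closures.
Variable R : realType.
Implicit Types H K : hilbert R.

Lemma bopP H K (A B : bop H K) : (forall x, A x = B x) -> A = B.
Proof. by move=> h; apply/val_inj/funext. Qed.

Lemma subspaceP H (M : hsubspace H) (x : H) :
  reflect (subspace_set M x) (x \in subspace_pred M).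
Proof. exact: asboolP. Qed.

Lemma subspace_linear H (M : hsubspace H) : linear_set (subspace_set M).
Proof.
split=> [|a x y /subspaceP Mx /subspaceP My]; apply/subspaceP; first exact: rpred0.
by rewrite rpredD ?rpredZ.
Qed.

Lemma linear_set_submod H (S : set H) :
  linear_set S -> submod_closed (fun x : H => `[< S x >]).
Proof.
move=> [S0 SP]; split=> [|a x y /asboolP Sx /asboolP Sy]; apply/asboolP => //.
exact: SP.
Qed.

Lemma hclosure_linear H (S : set H) : linear_set S -> linear_set (hclosure S).
Proof.
move=> [S0 SP]; split=> [e e0|a x y Sx Sy e e0].
  by exists 0; rewrite ?subrr ?hnorm0.
have c1 : 0 < cabs a + 1 by rewrite ltr_wpDl // cabs_ge0.
have e2 := divr_gt0 e0 (ltr0Sn R 1).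
have [x' Sx' hx] := Sx _ (divr_gt0 e2 c1); have [y' Sy' hy] := Sy _ e2.
exists (a *: x' + y'); first exact: SP.
rewrite opprD addrACA -scalerBr [ltRHS]splitr.
apply: le_lt_trans (hnormD _ _) _; apply: ltrD hy => //; rewrite hnormZ.
move: hx; rewrite ltr_pdivlMr //; apply: le_lt_trans.
by rewrite mulrC ler_wpM2l // lerDl.
Qed.

Lemma hclosure_closed H (S : set H) (u : nat -> H) l :
  (forall k, hclosure S (u k)) -> hcvg \oo u l -> hclosure S l.
Proof.
move=> Su /hcvg_seqP ul e e0; have e2 := divr_gt0 e0 (ltr0Sn R 1).
have [N /(_ N (leqnn _)) hN] := ul _ e2; have [y Sy hy] := Su N _ e2.
exists y => //; apply: le_lt_trans (hnorm_triangle (u N) _ _) _.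
by rewrite [ltRHS]splitr hnormBC ltrD.
Qed.

Definition closure_subspace H (S : set H) (lS : linear_set S) : hsubspace H :=
  @HSubspace R H (hclosure S) (linear_set_submod (hclosure_linear lS))
    (@hclosure_closed H S).

Lemma sub_hclosure H (S : set H) : S `<=` hclosure S.
Proof. by move=> x Sx e e0; exists x; rewrite ?subrr ?hnorm0. Qed.

Lemma lspan_linear (V : lmodType R[i]) (S : set V) : linear_set (lspan S).
Proof.
split; first by exists 0%N, (fun=> 0), (fun=> 0); split; [case|rewrite big_ord0].
move=> a x y [m [c [v [Sv ->]]]] [m' [c' [v' [Sv' ->]]]].
exists (m + m')%N, (fun i => match fintype.split i with inl j => a * c j | inr j => c' j end),
  (fun i => match fintype.split i with inl j => v j | inr j => v' j end); split.
  by move=> j; case: fintype.split => k.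
rewrite big_split_ord /= scaler_sumr; congr (_ + _); apply: eq_bigr => i _.
  by rewrite (unsplitK (inl i)) scalerA.
by rewrite (unsplitK (inr i)).
Qed.

Lemma sub_lspan (V : lmodType R[i]) (S : set V) : S `<=` lspan S.
Proof.
move=> x Sx; exists 1%N, (fun=> 1), (fun=> x); split=> //.
by rewrite big_ord1 scale1r.
Qed.

Lemma lspan_ind (V : lmodType R[i]) (S P : set V) :
  linear_set P -> S `<=` P -> lspan S `<=` P.
Proof.
move=> [P0 PP] SP x [m [c [v [Sv ->]]]].
apply: big_ind => //; first by move=> y z Py Pz; rewrite -[y]scale1r; exact: PP.
by move=> i _; rewrite -[_ *: _]addr0; apply: PP => //; exact: SP.
Qed.

Lemma hclosure_ind H (S : set H) (M : hsubspace H) :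
  S `<=` subspace_set M -> hclosure S `<=` subspace_set M.
Proof.
move=> SM x Sx.
have /choice[y hy] : forall k : nat, exists y, S y /\ hnorm (x - y) < k.+1%:R^-1.
  by move=> k; have [|y] := Sx k.+1%:R^-1; [rewrite invr_gt0|exists y].
apply: (@subspace_closed _ _ M y) => [k|]; first by apply: SM; have [] := hy k.
apply/hcvg_seqP => e e0; have [N hN] := ltr_add_invr e0; rewrite add0r in hN.
exists N => k kN; rewrite hnormBC; have [_ h] := hy k; apply: lt_trans h _.
by apply: le_lt_trans hN; rewrite lef_pV2 ?posrE // ler_nat.
Qed.

(** A minimizing sequence for the distance from [x] to [M] is Cauchy by the parallelogram law, and
    minimality at its limit forces orthogonality. *)
Lemma projection_exists H (M : hsubspace H) (x : H) :
  exists2 m, subspace_set M m & forall y, subspace_set M y -> '[x - m, y] = 0.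
Proof.
have [M0 ML] := subspace_linear M.
pose S := [set r | exists2 m, subspace_set M m & r = hnorm (x - m) ^+ 2].
have hS : has_inf S.
  split; first by exists (hnorm (x - 0) ^+ 2); exists 0.
  by exists 0 => _ [m _ ->]; exact: sqr_ge0.
pose d := inf S.
have dle m : subspace_set M m -> d <= hnorm (x - m) ^+ 2.
  by move=> Mm; apply: (ge_inf hS.2); exists m.
have /choice[u hu] : forall k : nat, exists m, subspace_set M m /\
    hnorm (x - m) ^+ 2 < d + k.+1%:R^-1.
  move=> k; have e0 : 0 < (k.+1%:R^-1 : R) by rewrite invr_gt0.
  by have [_ [m Mm ->] hm] := inf_adherent e0 hS; exists m.
have Mu k : subspace_set M (u k) by have [] := hu k.
(* The midpoint of [u j] and [u k] lies in [M], so its distance to [x] squared is at least [d]; the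
   parallelogram law leaves only the two excesses. *)
have key j k : hnorm (u j - u k) ^+ 2 <= 2 * j.+1%:R^-1 + 2 * k.+1%:R^-1.
  have := parallelogram (x - u k) (x - u j).
  have -> : x - u k - (x - u j) = u j - u k.
    by rewrite opprB addrC addrA subrK.
  have -> : x - u k + (x - u j) = 2 *: (x - 2^-1 *: (u k + u j)).
    rewrite scalerBr scalerA divff ?pnatr_eq0 // scale1r opprD addrACA.
    by rewrite scaler_nat mulr2n.
  rewrite hnormZ exprMn.
  have -> : cabs (2 : R[i]) = 2 by rewrite -[RHS](@cabsR R) // rmorph_nat.
  have : d <= hnorm (x - 2^-1 *: (u k + u j)) ^+ 2.
    apply: (dle); rewrite -[_ *: _]addr0; apply: (ML) => //.
    by rewrite -[u k]scale1r; apply: (ML).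
  have [_ hj] := hu j; have [_ hk] := hu k.
  move: hj hk; set aj := hnorm (x - u j) ^+ 2; set ak := hnorm (x - u k) ^+ 2.
  set ij := j.+1%:R^-1; set ik := k.+1%:R^-1; set b := hnorm _ ^+ 2; set c := hnorm _ ^+ 2.
  by rewrite expr2; lra.
have [l ul] : exists l, hcvg \oo u l.
  apply: hcomplete => e e0.
  have e4 : 0 < e ^+ 2 / 4 by rewrite divr_gt0 ?exprn_gt0.
  have [N hN] := ltr_add_invr e4; rewrite add0r in hN.
  exists N => j k jN kN; rewrite -(@ltr_pXn2r _ 2) ?nnegrE ?dnormr_ge0 ?(ltW e0) //.
  apply: le_lt_trans (key j k) _.
  have hle i : (N <= i)%N -> (i.+1%:R^-1 : R) < e ^+ 2 / 4.
    by move=> iN; apply: le_lt_trans hN; rewrite lef_pV2 ?posrE // ler_nat.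
  move: (hle j jN) (hle k kN); set a := j.+1%:R^-1; set b := k.+1%:R^-1.
  by move=> ha hb; lra.
have Ml : subspace_set M l by exact: (subspace_closed Mu ul).
have dl : hnorm (x - l) ^+ 2 <= d.
  apply/ler_addgt0Pr => e e0.
  have ->: d + e = Num.sqrt (d + e) ^+ 2.
    rewrite sqr_sqrtr // addr_ge0 ?(ltW e0) //.
    by apply: lb_le_inf; [case: hS|move=> _ [m _ ->]; exact: sqr_ge0].
  rewrite ler_pXn2r ?nnegrE ?sqrtr_ge0 //.
  have c : hcvg \oo (fun k => x - u k) (x - l) by apply: hcvgB => //; exact: hcvg_cst.
  apply: (hcvg_hnorm_le c); have [N hN] := ltr_add_invr e0; rewrite add0r in hN.
  exists N => // k /= kN; have [_ hk] := hu k.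
  rewrite -[hnorm _]ger0_norm // -sqrtr_sqr ler_wsqrtr //.
  apply: ltW; apply: lt_trans hk _; rewrite ltrD2l; apply: le_lt_trans hN.
  by rewrite lef_pV2 ?posrE // ler_nat.
exists l => // y My; set z := x - l; set c := '[z, y].
have [y0|y0] := eqVneq (hnorm y) 0.
  by rewrite /c (hnorm_eq0 y0) inner0r.
have yp : 0 < hnorm y by rewrite lt_def y0 hnorm_ge0.
(* [a y] is the projection of [z] on the line of [y]: moving [l] by it would lower the squared
   distance by [|c|^2 / |y|^2], so [c] vanishes. *)
pose t : R := hnorm y ^- 2; pose a := t%:C%C * c.
have My' : subspace_set M (l + a *: y) by rewrite addrC; exact: ML.
have := le_trans dl (dle _ My'); rewrite opprD addrA -/z.
rewrite [hnorm (z - _) ^+ 2]hnormD_sqr hnormN hnormZ innerNr innerZr -/c raddfN /=.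
have -> : a^* * c = t%:C%C * (c * c^*)
  by rewrite /a conjM conjR -mulrA [c^* * _]mulrC.
rewrite ReR mul_conj_cabs /=.
rewrite /a cabsM cabsR ?invr_ge0 ?exprn_ge0 // => h.
apply: cabs_eq0; apply/eqP; rewrite -sqrf_eq0 eq_le sqr_ge0 andbT.
have tp : 0 < t by rewrite invr_gt0 exprn_gt0.
rewrite -(pmulr_rle0 _ tp).
have E : (t * cabs c * hnorm y) ^+ 2 = t * cabs c ^+ 2.
  by rewrite /t; field.
move: h; rewrite E; set b := t * _; lra.
Qed.

(** Projecting [x] on the closed span leaves a remainder orthogonal to [S], which the hypothesis
    kills. *)
Lemma dense_of_orth H (S : set H) : (forall x : H, (forall s, S s -> '[x, s] = 0) -> x = 0) ->
  hclosure (lspan S) = setT.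
Proof.
move=> h; apply/seteqP; split=> // x _.
have [m Mm hm] := projection_exists (closure_subspace (lspan_linear S)) x.
suff -> : x = m by [].
apply/eqP; rewrite -subr_eq0; apply/eqP/h => s Ss; apply: hm.
by apply: sub_hclosure; exact: sub_lspan.
Qed.

Lemma orth_hspan H (S : set H) x : (forall s, S s -> '[x, s] = 0) ->
  forall y, hclosure (lspan S) y -> '[x, y] = 0.
Proof.
move=> h y Sy; apply: inner_conj0.
have := @hclosure_ind H (lspan S) (orthocomp [set x]); apply => //.
apply: lspan_ind; first exact: subspace_linear.
by move=> s Ss _ ->; apply: inner_conj0; exact: h.
Qed.

End Closures.

(** * Bounded operators *)

Section Operators.
Variable R : realType.
Implicit Types H K L : hilbert R.

Definition bounded_by H K (A : bop H K) (M : R) : Prop :=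
  0 <= M /\ forall x, hnorm (A x) <= M * hnorm x.

Lemma bounded_byP H K (A : bop H K) : exists M, bounded_by A M.
Proof. by have [M M0 hM] := bop_bounded A; exists M. Qed.

Lemma bopDE H K (A B : bop H K) x : (A + B) x = A x + B x. Proof. by []. Qed.
Lemma bopBE H K (A B : bop H K) x : (A - B) x = A x - B x. Proof. by []. Qed.
Lemma bopZE H K a (A : bop H K) x : (a *: A) x = a *: A x. Proof. by []. Qed.
Lemma bop0E H K x : (0 : bop H K) x = 0. Proof. by []. Qed.
Lemma bop_sumE H K (I : Type) (s : seq I) (P : pred I) (A : I -> bop H K) x :
  (\sum_(i <- s | P i) A i) x = \sum_(i <- s | P i) A i x.
Proof. by elim/big_ind2: _ => // B y C z <- <-. Qed.
Lemma compE H K L (A : bop K L) (B : bop H K) x : (A \oB B) x = A (B x).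
Proof. by []. Qed.
Lemma id_bopE H (x : H) : id_bop H x = x. Proof. by []. Qed.
Lemma compA H K L N (A : bop L N) (B : bop K L) (C : bop H K) :
  A \oB (B \oB C) = A \oB B \oB C.
Proof. exact/val_inj. Qed.
Lemma comp_id H K (A : bop H K) : A \oB id_bop H = A.
Proof. exact/val_inj. Qed.
Lemma id_comp H K (A : bop H K) : id_bop K \oB A = A.
Proof. exact/val_inj. Qed.

Lemma bop_build H K (f : H -> K) (M : R) :
  linear f -> (forall x, hnorm (f x) <= M * hnorm x) ->
  exists A : bop H K, forall x, A x = f x.
Proof.
move=> lf hM; have fP : f \in @bop_pred R H K by apply/asboolP; split=> //; exists M.
by exists (Bop fP).
Qed.

Lemma comp_bounded H K L (A : bop K L) (B : bop H K) M N :
  bounded_by A M -> bounded_by B N -> bounded_by (A \oB B) (M * N).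
Proof.
move=> [M0 hM] [N0 hN]; split=> [|x]; first exact: mulr_ge0.
by apply: le_trans (hM _) _; rewrite -mulrA ler_wpM2l ?hN.
Qed.

Lemma add_bounded H K (A B : bop H K) M N :
  bounded_by A M -> bounded_by B N -> bounded_by (A + B) (M + N).
Proof.
move=> [M0 hM] [N0 hN]; split=> [|x]; first exact: addr_ge0.
by apply: le_trans (hnormD _ _) _; rewrite mulrDl lerD ?hM ?hN.
Qed.

Lemma scale_bounded H K a (A : bop H K) M :
  bounded_by A M -> bounded_by (a *: A) (cabs a * M).
Proof.
move=> [M0 hM]; split=> [|x]; first exact: mulr_ge0.
rewrite -[_ x]/(a *: A x).
by rewrite hnormZ -mulrA ler_wpM2l ?hM.
Qed.

Lemma bounded_widen H K (A : bop H K) M N :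
  bounded_by A M -> M <= N -> bounded_by A N.
Proof.
move=> [M0 hM] MN; split=> [|x]; first exact: le_trans MN.
by apply: le_trans (hM x) _; rewrite ler_wpM2r.
Qed.

(* Closing up a bounded linear relation gives an operator on the closure of its
   domain, which is then extended by zero to the orthogonal complement. *)
Lemma bop_extension H K (Q : H -> K -> Prop) (M : R) :
  0 <= M -> Q 0 0 ->
  (forall a x y x' y', Q x y -> Q x' y' -> Q (a *: x + x') (a *: y + y')) ->
  (forall x y, Q x y -> hnorm y <= M * hnorm x) ->
  exists2 Z : bop H K, bounded_by Z M & forall x y, Q x y -> Z x = y.
Proof.
move=> M0 Q0 QL QM.
have Qinj x y y' : Q x y -> Q x y' -> y = y'.
  move=> Qy Qy'; have := QL (-1) _ _ _ _ Qy' Qy; rewrite !scaleN1r addNr => /QM.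
  rewrite hnorm0 mulr0 => h; apply/eqP; rewrite -subr_eq0 addrC; apply/eqP/hnorm_eq0.
  by apply/eqP; rewrite eq_le h hnorm_ge0.
pose Qc x y := exists u v, [/\ forall k : nat, Q (u k) (v k), hcvg \oo u x & hcvg \oo v y].
have Qsub x y : Q x y -> Qc x y.
  by move=> Qxy; exists (fun=> x), (fun=> y); split=> //; exact: hcvg_cst.
have QcL a x y x' y' : Qc x y -> Qc x' y' -> Qc (a *: x + x') (a *: y + y').
  move=> [u [v [Quv ux vy]]] [u' [v' [Quv' ux' vy']]].
  exists (fun k => a *: u k + u' k), (fun k => a *: v k + v' k); split.
  - by move=> k; exact: QL.
  - by apply: hcvgD => //; exact: hcvgZ.
  - by apply: hcvgD => //; exact: hcvgZ.
have QcM x y : Qc x y -> hnorm y <= M * hnorm x.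
  move=> [u [v [Quv ux /hcvg_seqP vy]]]; move: ux => /hcvg_seqP ux.
  apply/ler_addgt0Pr => e e0.
  have M1 : 0 < M + 1 by rewrite ltr_wpDl.
  have d0 := divr_gt0 (divr_gt0 e0 (ltr0Sn R 1)) M1.
  have [N1 h1] := ux _ d0; have [N2 h2] := vy _ (divr_gt0 e0 (ltr0Sn R 1)).
  pose k := maxn N1 N2; have k1 := h1 k (leq_maxl _ _); have k2 := h2 k (leq_maxr _ _).
  have a1 : hnorm y <= hnorm (v k) + e / 2.
    rewrite -{1}(subrK (v k) y) addrC; apply: le_trans (hnormD _ _) _.
    by rewrite lerD2l hnormBC ltW.
  have a2 : M * hnorm (u k) <= M * hnorm x + e / 2.
    have : hnorm (u k) <= hnorm x + hnorm (u k - x).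
      by rewrite -{1}(subrK x (u k)) addrC; exact: hnormD.
    move=> /(ler_wpM2l M0) h; apply: le_trans h _; rewrite mulrDr lerD2l.
    move: k1; rewrite ltr_pdivlMr // => /ltW; apply: le_trans.
    by rewrite mulrC ler_wpM2l // lerDl.
  by have := QM _ _ (Quv k); move: a1 a2; lra.
have Qcinj x y y' : Qc x y -> Qc x y' -> y = y'.
  move=> Qy Qy'; have := QcL (-1) _ _ _ _ Qy' Qy; rewrite !scaleN1r addNr => /QcM.
  rewrite hnorm0 mulr0 => h; apply/eqP; rewrite -subr_eq0 addrC; apply/eqP/hnorm_eq0.
  by apply/eqP; rewrite eq_le h hnorm_ge0.
pose D := [set x | exists y, Qc x y].
have lD : linear_set D.
  split=> [|a x x' [y Qxy] [y' Qxy']]; first by exists 0; exact: Qsub.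
  by exists (a *: y + y'); exact: QcL.
have cD (u : nat -> H) l : (forall k, D (u k)) -> hcvg \oo u l -> D l.
  move=> Du ul.
  have {Du} /choice[w hw] : forall k : nat, exists p : H * K,
      Q p.1 p.2 /\ hnorm (p.1 - u k) < k.+1%:R^-1.
    move=> k; have [y [a [b [Qab /hcvg_seqP au _]]]] := Du k.
    have k0 : 0 < (k.+1%:R^-1 : R) by rewrite invr_gt0.
    by have [N /(_ _ (leqnn _)) hN] := au _ k0; exists (a N, b N); split; [exact: Qab|].
  have Qw k : Q (w k).1 (w k).2 by have [] := hw k.
  have w1 : hcvg \oo (fun k => (w k).1) l.
    apply/hcvg_seqP => e e0; have e2 := divr_gt0 e0 (ltr0Sn R 1).
    have [N1 h1] := (hcvg_seqP _ _).1 ul _ e2.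
    have [N2 hN2] := ltr_add_invr e2; rewrite add0r in hN2.
    exists (maxn N1 N2) => k; rewrite geq_max => /andP[k1 k2].
    apply: le_lt_trans (hnorm_triangle (u k) _ _) _.
    rewrite [ltRHS]splitr ltrD // ?h1 //; have [_ h] := hw k.
    by apply: lt_trans h _; apply: le_lt_trans hN2; rewrite lef_pV2 ?posrE // ler_nat.
  have [y wy] : exists y, hcvg \oo (fun k => (w k).2) y.
    apply: hcomplete => e e0; have M1 : 0 < M + 1 by rewrite ltr_wpDl.
    have d0 := divr_gt0 (divr_gt0 e0 (ltr0Sn R 1)) M1.
    have [N hN] := (hcvg_seqP _ _).1 w1 _ d0; exists N => j k /hN hj /hN hk.
    have := QL (-1) _ _ _ _ (Qw k) (Qw j).
    rewrite !scaleN1r ![- _ + _]addrC => /QM h; apply: le_lt_trans h _.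
    have : hnorm ((w j).1 - (w k).1) < e / (M + 1).
      apply: le_lt_trans (hnorm_triangle l _ _) _; rewrite (hnormBC l).
      have -> : e / (M + 1) = e / 2 / (M + 1) + e / 2 / (M + 1).
        by rewrite -mulrDl -splitr.
      exact: ltrD.
    rewrite ltr_pdivlMr //; apply: le_lt_trans.
    by rewrite mulrC ler_wpM2l // lerDl.
  by exists y, (fun k => (w k).1), (fun k => (w k).2); split=> // k; have [] := hw k.
pose DS := @HSubspace R H D (linear_set_submod lD) cD.
have /choice[P hP] : forall x, exists m, D m /\ forall y, D y -> '[x - m, y] = 0.
  by move=> x; have [m] := projection_exists DS x; exists m.
have /choice[g hg] : forall x, exists y, Qc (P x) y by move=> x; have [] := hP x.
have PL : linear P.
  move=> a x x'; apply/eqP; rewrite -subr_eq0; apply/eqP.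
  set d := _ - _; have Dd : D d.
    have [Dx _] := hP x; have [Dx' _] := hP x'; have [Dxx _] := hP (a *: x + x').
    have -> : d = -1 *: (a *: P x + P x') + P (a *: x + x') by rewrite scaleN1r addrC.
    by apply: (lD.2); [exact: (lD.2)|].
  apply: hnorm_eq0; apply/eqP; rewrite -sqrf_eq0 -Re_innerxx.
  have -> : '[d, d] = 0.
    have E : d = a *: (x - P x) + (x' - P x') - (a *: x + x' - P (a *: x + x')).
      by rewrite /d scalerBr addrACA -opprD opprB [RHS]addrC [RHS]addrA subrK.
    have [_ h] := hP x; have [_ h'] := hP x'; have [_ h''] := hP (a *: x + x').
    by rewrite {1}E innerBl innerDl innerZl h // h' // h'' // mulr0 addr0 subr0.
  by [].
have PN x : hnorm (P x) <= hnorm x.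
  apply: hnorm_sqr_le; have [DP h] := hP x.
  rewrite -{2}(subrK (P x) x) hnormD_sqr (h _ DP) mulr0 addr0 lerDr.
  exact: sqr_ge0.
have gL : linear g.
  by move=> a x x'; apply: Qcinj (hg _) _; rewrite PL; exact: QcL.
have gM x : hnorm (g x) <= M * hnorm x.
  by apply: le_trans (QcM _ _ (hg x)) _; rewrite ler_wpM2l.
have [Z hZ] := bop_build gL gM; exists Z; first by split=> // x; rewrite hZ.
move=> x y /Qsub Qxy; rewrite hZ; apply: (Qcinj x) => //.
suff E : P x = x by move: (hg x); rewrite E.
have [DP h] := hP x; apply/eqP; rewrite eq_sym -subr_eq0; apply/eqP.
apply: hnorm_eq0; apply/eqP; rewrite -sqrf_eq0 -Re_innerxx h //.
have -> : x - P x = -1 *: P x + x by rewrite scaleN1r addrC.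
by apply: (lD.2) => //; exists y.
Qed.

End Operators.

(** * Riesz representation, adjoints and projections as operators *)

Section Adjoints.
Variable R : realType.
Implicit Types H K L : hilbert R.

Lemma riesz H (phi : H -> R[i]) (M : R) :
  (forall a x y, phi (a *: x + y) = a * phi x + phi y) ->
  (forall x, cabs (phi x) <= M * hnorm x) ->
  exists z, forall x, phi x = '[x, z].
Proof.
move=> lphi hM.
have phi0 : phi 0 = 0.
  by have := lphi 1 0 0; rewrite scaler0 addr0 mul1r => /esym/eqP; rewrite -subr_eq0 addrK => /eqP.
pose S := [set x | phi x = 0].
have lS : linear_set S.
  by split=> // a x y Sx Sy; rewrite /S /= lphi Sx Sy mulr0 addr0.
have cS (u : nat -> H) l : (forall k, S (u k)) -> hcvg \oo u l -> S l.
  move=> Su ul; apply: cabs_eq0; apply/eqP; rewrite eq_le cabs_ge0 andbT.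
  apply/ler_addgt0Pr => e e0; rewrite add0r.
  have M1 : 0 < `|M| + 1 by rewrite ltr_wpDl.
  have [N /(_ _ (leqnn _)) hN] := (hcvg_seqP _ _).1 ul _ (divr_gt0 e0 M1).
  have -> : phi l = - phi (u N - l).
    have -> : u N - l = -1 *: l + u N by rewrite scaleN1r addrC.
    by rewrite lphi Su addr0 mulN1r opprK.
  rewrite cabsN; apply: le_trans (hM _) _.
  move: hN; rewrite ltr_pdivlMr // => /ltW; apply: le_trans.
  by rewrite mulrC ler_wpM2l // (le_trans (ler_norm _)) // lerDl.
have [[x0 px0]|all0] := pselect (exists x, phi x != 0); last first.
  exists 0 => x; rewrite inner0r; apply/eqP.
  by apply: contra_notT all0 => px; exists x.
have [m Sm hm] := projection_exists (@HSubspace R H S (linear_set_submod lS) cS) x0.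
pose z := x0 - m.
have pz : phi z != 0.
  have -> : z = -1 *: m + x0 by rewrite /z scaleN1r addrC.
  by rewrite lphi (Sm : phi m = 0) mulr0 add0r.
have z0 : '[z, z] != 0.
  apply: contra_neq pz => h; have -> // : z = 0.
  by apply: hnorm_eq0; apply/eqP; rewrite -sqrf_eq0 -Re_innerxx h.
(* [x - (phi x / phi z) z] lies in the kernel of [phi] and is therefore orthogonal to [z]; this
   dictates the scalar. *)
exists ((phi z / '[z, z])^* *: z) => x; rewrite innerZr conjCK.
have : '[x - (phi x / phi z) *: z, z] = 0.
  apply: inner_conj0; apply: hm.
  have -> : x - (phi x / phi z) *: z = - (phi x / phi z) *: z + x by rewrite scaleNr addrC.
  by rewrite /= /S /= lphi mulNr divfK // addNr.
rewrite innerBl innerZl => /eqP; rewrite subr_eq0 => /eqP ->.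
by move: (phi x) (phi z) '[z, z] pz z0 => a b c b0 c0; field; rewrite ?b0 ?c0.
Qed.

Lemma adj_exists H K (A : bop H K) :
  exists B : bop K H, forall x y, '[A x, y] = '[x, B y].
Proof.
have [M M0 hM] := bop_bounded A.
have /choice[B hB] : forall y, exists z, forall x, '[A x, y] = '[x, z].
  move=> y; apply: (riesz (phi := fun x => '[A x, y]) (M := M * hnorm y)).
    by move=> a x x'; rewrite bopD bopZ innerDl innerZl.
  move=> x; apply: le_trans (cabs_inner_le _ _) _.
  by rewrite mulrAC ler_wpM2r.
have BL : linear B.
  move=> a y y'; apply: inner_ext => z; apply: (can_inj (@conjCK _)).
  rewrite -!innerC -hB innerDr innerZr innerDr innerZr.
  by rewrite !hB.
have BM y : hnorm (B y) <= M * hnorm y.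
  have [->|B0] := eqVneq (hnorm (B y)) 0; first by rewrite mulr_ge0.
  have Bp : 0 < hnorm (B y) by rewrite lt_def B0 hnorm_ge0.
  rewrite -(ler_pM2l Bp) -expr2 -Re_innerxx -hB.
  apply: le_trans (Re_inner_le _ _) _.
  by rewrite mulrA [_ * M]mulrC ler_wpM2r.
by have [C hC] := bop_build BL BM; exists C => x y; rewrite hC hB.
Qed.

Lemma adjP H K (A : bop H K) x y : '[A x, y] = '[x, adj A y].
Proof.
exact: (@xgetPex _ 0 [set B : bop K H | forall x y, '[A x, y] = '[x, B y]] (adj_exists A)).
Qed.

Lemma adjP' H K (A : bop H K) x y : '[adj A y, x] = '[y, A x].
Proof. by rewrite innerC -adjP -innerC. Qed.

Lemma adjE H K (A : bop H K) (B : bop K H) :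
  (forall x y, '[A x, y] = '[x, B y]) -> adj A = B.
Proof.
move=> h; apply: bopP => y; apply: inner_ext => z; apply: (can_inj (@conjCK _)).
by rewrite -!innerC -adjP.
Qed.

Lemma adjK H K (A : bop H K) : adj (adj A) = A.
Proof. by apply: adjE => x y; rewrite adjP'. Qed.

Lemma adj_comp H K L (A : bop K L) (B : bop H K) :
  adj (A \oB B) = adj B \oB adj A.
Proof. by apply: adjE => x y /=; rewrite !adjP. Qed.

Lemma adj_id H : adj (id_bop H) = id_bop H.
Proof. exact: adjE. Qed.

Lemma adjZ H K a (A : bop H K) : adj (a *: A) = a^* *: adj A.
Proof.
apply: adjE => x y; by rewrite !bopZE innerZl innerZr conjCK adjP.
Qed.

Lemma adj_bounded H K (A : bop H K) M : bounded_by A M -> bounded_by (adj A) M.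
Proof.
move=> [M0 hM]; split=> // y; set B := adj A.
have [->|B0] := eqVneq (hnorm (B y)) 0; first by rewrite mulr_ge0.
have Bp : 0 < hnorm (B y) by rewrite lt_def B0 hnorm_ge0.
rewrite -(ler_pM2l Bp) -expr2 -Re_innerxx -adjP.
apply: le_trans (Re_inner_le _ _) _.
by rewrite mulrA [_ * M]mulrC ler_wpM2r.
Qed.

(** The nearest point is the only one with this orthogonality, so linearity follows from uniqueness
    and the bound from Pythagoras; this makes the choice in [proj_bop] effective. *)
Lemma projP H (M : hsubspace H) x m :
  subspace_set M m -> '[x - incl_bop M (proj_bop M x), m] = 0.
Proof.
move: x m; rewrite -[forall x, _]/([set P : bop H (sub_hilbert M) |
  forall x m, subspace_set M m -> '[x - incl_bop M (P x), m] = 0] (proj_bop M)).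
apply: xgetPex => /=.
have /choice[f hf] : forall x, exists y : sub_hilbert M,
    forall m, subspace_set M m -> '[x - incl_bop M y, m] = 0.
  move=> x; have [m Mm hm] := projection_exists M x.
  have mP : m \in subspace_pred M by exact/subspaceP.
  by exists (SubVec mP).
pose fE := fun (x : H) => (f x : subvec M).
have fM (y : sub_hilbert M) : subspace_set M (incl_bop M y).
  by case: y => y yP; exact/subspaceP.
have funiq x (y z : sub_hilbert M) :
    (forall m, subspace_set M m -> '[x - incl_bop M y, m] = 0) ->
    (forall m, subspace_set M m -> '[x - incl_bop M z, m] = 0) -> y = z.
  move=> hy hz; apply/val_inj/eqP; rewrite -subr_eq0; apply/eqP; apply: hnorm_eq0.
  apply/eqP; rewrite -sqrf_eq0 -Re_innerxx.
  have E : incl_bop M y - incl_bop M z = (x - incl_bop M z) - (x - incl_bop M y).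
    by rewrite opprB [RHS]addrC [RHS]addrA subrK.
  have Mm : subspace_set M (incl_bop M y - incl_bop M z) by rewrite -bopB.
  rewrite -[val y]/(incl_bop M y) -[val z]/(incl_bop M z).
  by rewrite {1}E innerBl hz // hy // subr0.
have fL : linear f.
  move=> a x y; apply: (funiq (a *: x + y)) => [|m Mm]; first exact: hf.
  rewrite bopD bopZ opprD addrACA -scalerBr innerDl innerZl hf // hf // mulr0.
  exact: addr0.
have fB x : hnorm (f x) <= 1 * hnorm x.
  rewrite mul1r; apply: hnorm_sqr_le.
  rewrite -{2}(subrK (incl_bop M (f x)) x) hnormD_sqr hf // mulr0 addr0.
  by rewrite -[hnorm (incl_bop M _)]/(hnorm (f x)) lerDr sqr_ge0.
by have [P hP] := bop_build fL fB; exists P => x m Mm; rewrite hP hf.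
Qed.

Section Projection.
Variables (H : hilbert R) (M : hsubspace H).
Local Notation P := (proj_bop M).
Local Notation V := (incl_bop M).

Lemma incl_in y : subspace_set M (V y).
Proof. by case: y => y yP; exact/subspaceP. Qed.
Lemma incl_inj : injective V. Proof. exact: val_inj. Qed.
Lemma incl_inner x y : '[V x, V y] = '[x, y]. Proof. by []. Qed.
Lemma adj_incl : adj V = P.
Proof.
apply: adjE => x y; rewrite -[RHS]incl_inner.
apply/eqP; rewrite -subr_eq0 -innerBr; apply/eqP/inner_conj0/projP.
exact: incl_in.
Qed.
Lemma adj_proj : adj P = V. Proof. by rewrite -adj_incl adjK. Qed.
Lemma inner_proj x y : '[P x, y] = '[x, V y]. Proof. by rewrite adjP adj_proj. Qed.
Lemma proj_inclK y : P (V y) = y.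
Proof. by apply: inner_ext => z; rewrite inner_proj. Qed.
Lemma incl_projK x : subspace_set M x -> V (P x) = x.
Proof.
move=> Mx; have xP : x \in subspace_pred M by exact/subspaceP.
by rewrite -[x]/(V (SubVec xP)) proj_inclK.
Qed.
Lemma proj_incl_comp : P \oB V = id_bop _.
Proof. by apply: bopP => x; exact: proj_inclK. Qed.
Lemma incl_bounded : bounded_by V 1.
Proof. by split=> // x; rewrite mul1r. Qed.
Lemma proj_bounded : bounded_by P 1.
Proof. by rewrite -adj_incl; exact/adj_bounded/incl_bounded. Qed.
End Projection.

Lemma sot_limit H K (A : nat -> bop H K) M :
  (forall k, bounded_by (A k) M) -> (forall x, dcauchy (hdot K) (fun k => A k x)) ->
  exists2 B, bounded_by B M & sot_cvg \oo A B.
Proof.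
move=> hM hC.
have /choice[f hf] : forall x, exists l, hcvg \oo (fun k => A k x) l.
  by move=> x; exact: hcomplete.
have fL : linear f.
  move=> a x y; apply: (hcvg_unique (hf _)).
  have -> : (fun k => A k (a *: x + y)) = (fun k => a *: A k x + A k y).
    by apply/funext => k; rewrite bopD bopZ.
  by apply: hcvgD => //; exact: hcvgZ.
have fM x : hnorm (f x) <= M * hnorm x.
  by apply: (hcvg_hnorm_le (hf x)); apply: nearW => k; have [] := hM k.
have [B hB] := bop_build fL fM; exists B; last by move=> x; rewrite hB.
by split=> [|x]; [have [] := hM 0%N|rewrite hB].
Qed.

(** Passes an adjointness relation to the limit; it yields self-adjointness of the limit in the
    square root iteration. *)
Lemma hcvg_inner_eq H K (X : Type) (F : set_system X) {FF : ProperFilter F}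
    (u : X -> H) (v : X -> K) l m y x :
  hcvg F u l -> hcvg F v m -> (forall t, '[u t, y] = '[x, v t]) -> '[l, y] = '[x, m].
Proof.
move=> /hcvgP ul /hcvgP vm h; apply/eqP; rewrite -subr_eq0; apply/eqP/cabs_eq0.
apply/eqP; rewrite eq_le cabs_ge0 andbT.
apply/ler_addgt0Pr => e e0; rewrite add0r.
have e2 := divr_gt0 e0 (ltr0Sn R 1).
have y1 : 0 < hnorm y + 1 by rewrite ltr_wpDl.
have x1 : 0 < hnorm x + 1 by rewrite ltr_wpDl.
have [t [h1 h2]] := filter_ex (filterI (ul _ (divr_gt0 e2 y1)) (vm _ (divr_gt0 e2 x1))).
have -> : '[l, y] - '[x, m] = '[x, v t - m] - '[u t - l, y].
  by rewrite innerBl innerBr h opprB [RHS]addrC [RHS]addrA subrK.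
apply: le_trans (cabsD _ _) _; rewrite cabsN [leRHS]splitr.
apply: lerD; apply: le_trans (cabs_inner_le _ _) _.
  move: h2; rewrite ltr_pdivlMr // => /ltW; apply: le_trans.
  by rewrite mulrC ler_wpM2l // lerDl.
move: h1; rewrite ltr_pdivlMr // => /ltW; apply: le_trans.
by rewrite ler_wpM2l // lerDl.
Qed.

End Adjoints.

(** * Positive square roots *)

Section SquareRoot.
Variable R : realType.
Implicit Types H K L : hilbert R.
Local Notation Re := complex.Re.

(** The order on [R[i]] makes a nonnegative number real, so the quadratic form of [A] is real;
    polarizing with [x + y] and [x + i y] gives symmetry. *)
Lemma pos_bop_sa H (A : bop H H) : pos_bop A -> forall x y, '[A x, y] = '[x, A y].
Proof.
move=> pA x y; rewrite [RHS]innerC; set a := '[A x, y]; set b := '[A y, x].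
have im z : complex.Im '[A z, z] = 0.
  by have := pA z; case: '[_, _] => u v; rewrite lecE /= => /andP[/eqP].
have h1 : complex.Im (a + b) = 0.
  have := im (x + y); rewrite bopD !innerDl !innerDr -/a -/b.
  by rewrite !raddfD /= !im addr0 add0r.
have h2 : complex.Im ('i%C * (b - a)) = 0.
  have := im (x + 'i%C *: y).
  rewrite bopD bopZ !innerDl !innerDr !innerZl !innerZr -/a -/b.
  have -> : ('i%C : R[i])^* = - 'i%C by rewrite /Num.conj /=; simpc.
  have -> : 'i%C * (- 'i%C * '[A y, y]) = '[A y, y].
    by rewrite mulrA mulrN -expr2 sqr_i opprK mul1r.
  have -> : '[A x, x] + - 'i%C * a + ('i%C * b + '[A y, y]) =
    '[A x, x] + 'i%C * (b - a) + '[A y, y] by ring.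
  by rewrite !raddfD /= !im add0r addr0.
move: h1 h2; case: a => p q; case: b => r s /= /eqP; rewrite addr_eq0 => /eqP ->.
rewrite mul0r mul1r add0r => /eqP; rewrite subr_eq0 => /eqP ->.
by [].
Qed.

(** Positivity is tested at [x - A x / c], and the term of third order in [A] is absorbed by the
    bound [c]. No square root of [A] is available at this point. *)
Lemma pos_sqr_le H (A : bop H H) c : pos_bop A -> bounded_by A c -> 0 < c ->
  forall x, hnorm (A x) ^+ 2 <= c * Re '[A x, x].
Proof.
move=> pA [_ hc] c0 x; pose t := c^-1; pose y := A x; pose z := x - t%:C%C *: y.
have := pA z; rewrite lecE => /andP[_] /=.
have -> : Re '[A z, z] = Re '[A x, x] - 2 * t * hnorm y ^+ 2 + t ^+ 2 * Re '[A y, y].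
  rewrite /z bopB bopZ -/y !innerBl !innerBr !innerZl !innerZr !conjR.
  rewrite (pos_bop_sa pA y x) -/y !ReB !ReR !Re_innerxx.
  by rewrite expr2; ring.
move=> h0; have h1 : Re '[A y, y] <= c * hnorm y ^+ 2.
  apply: le_trans (Re_inner_le _ _) _.
  by rewrite expr2 mulrA ler_wpM2r.
have tc : t * c = 1 by rewrite mulVf // gt_eqF.
have t0 : 0 < t by rewrite invr_gt0.
rewrite -(ler_pM2l t0) (mulrA t c) tc mul1r -/y.
have : t ^+ 2 * Re '[A y, y] <= t * hnorm y ^+ 2.
  have -> : t * hnorm y ^+ 2 = t ^+ 2 * (c * hnorm y ^+ 2).
    by rewrite expr2 -mulrA (mulrA t c) tc mul1r.
  by rewrite ler_wpM2l // exprn_ge0 // ltW.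
by move: h0; move: (t ^+ 2 * _) (hnorm y ^+ 2) => u v; lra.
Qed.

Lemma pos_sub_contr H (A : bop H H) : pos_bop A -> bounded_by A 1 ->
  bounded_by (id_bop H - A) 1.
Proof.
move=> pA bA; split=> // x; rewrite mul1r bopBE; apply: hnorm_sqr_le.
rewrite hnormD_sqr hnormN innerNr raddfN /= Re_innerC.
have := pos_sqr_le pA bA ltr01 x; rewrite mul1r.
have := sqr_ge0 (hnorm (A x)); lra.
Qed.

(* The iteration [Y' = (B + Y^2) / 2] for [1 - sqrt (1 - B)]: the increments are
   dominated by those of the same scalar iteration started at [B = 1]. *)
Fixpoint sqrt_iter H (B : bop H H) (k : nat) : bop H H :=
  if k is j.+1 then 2^-1 *: (B + sqrt_iter B j \oB sqrt_iter B j) else 0.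
Fixpoint scalar_sqrt_iter (k : nat) : R :=
  if k is j.+1 then (1 + scalar_sqrt_iter j ^+ 2) / 2 else 0.

Lemma scalar_sqrt_iter_bnd k : 0 <= scalar_sqrt_iter k <= 1.
Proof.
elim: k => [|k /andP[h0 h1]] /=; first by rewrite lexx ler01.
have : scalar_sqrt_iter k ^+ 2 <= 1 by rewrite expr_le1.
have := sqr_ge0 (scalar_sqrt_iter k).
by move: (_ ^+ 2) => u *; apply/andP; split; lra.
Qed.

Lemma half_bounded H K (A : bop H K) M : bounded_by A M -> bounded_by (2^-1 *: A) (M / 2).
Proof.
move=> /(scale_bounded 2^-1) h; apply: bounded_widen h _.
rewrite -[2^-1 : R[i]](_ : (2^-1 : R)%:C%C = _); last by rewrite fmorphV rmorph_nat.
by rewrite cabsR ?invr_ge0 // mulrC.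
Qed.

Lemma sqrt_iter_bounded H (B : bop H H) k : bounded_by B 1 ->
  bounded_by (sqrt_iter B k) (scalar_sqrt_iter k) /\
  bounded_by (sqrt_iter B k.+1 - sqrt_iter B k)
     (scalar_sqrt_iter k.+1 - scalar_sqrt_iter k).
Proof.
move=> hB.
have step j : bounded_by (sqrt_iter B j) (scalar_sqrt_iter j) ->
    bounded_by (sqrt_iter B j.+1) (scalar_sqrt_iter j.+1).
  by move=> h /=; apply/half_bounded/add_bounded => //; exact: comp_bounded.
elim: k => [|k [h1 h2]].
  have h0 : bounded_by (sqrt_iter B 0) (scalar_sqrt_iter 0).
    by split=> // x; rewrite mul0r hnorm0.
  by split=> //; rewrite /= !subr0; exact: (step 0%N).
split; first exact: step.
move: (step _ h1) h2.
rewrite -[sqrt_iter B k.+2]/(2^-1 *: (B + sqrt_iter B k.+1 \oB sqrt_iter B k.+1)).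
rewrite -[scalar_sqrt_iter k.+2]/((1 + scalar_sqrt_iter k.+1 ^+ 2) / 2).
have EZ : sqrt_iter B k.+1 = 2^-1 *: (B + sqrt_iter B k \oB sqrt_iter B k) by [].
have Ez : scalar_sqrt_iter k.+1 = (1 + scalar_sqrt_iter k ^+ 2) / 2 by [].
move: h1 EZ Ez; move: (sqrt_iter B k) (sqrt_iter B k.+1) => Y Z.
move: (scalar_sqrt_iter k) (scalar_sqrt_iter k.+1) => y z h1 EZ Ez h2 h3.
(* [Z^2 - Y^2 = Z (Z - Y) + (Z - Y) Y] holds without commutation, and its scalar version below has
   nonnegative terms, so bounds transfer term by term. *)
have -> : 2^-1 *: (B + Z \oB Z) - Z = 2^-1 *: (Z \oB (Z - Y) + (Z - Y) \oB Y).
  transitivity (2^-1 *: (B + Z \oB Z) - 2^-1 *: (B + Y \oB Y)); first by rewrite -EZ.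
  rewrite -scalerBr opprD addrACA subrr add0r; congr (_ *: _).
  by apply: bopP => x; rewrite bopDE !compE !bopBE !compE bopB addrA subrK.
have -> : (1 + z ^+ 2) / 2 - z = (z * (z - y) + (z - y) * y) / 2.
  transitivity ((1 + z ^+ 2) / 2 - (1 + y ^+ 2) / 2); first by rewrite -Ez.
  by field.
by apply/half_bounded/add_bounded; exact: comp_bounded.
Qed.

(** The equation [2 Y = B + Y^2] says that [(I - Y)^2 = I - B]. *)
Lemma sqrt_contr H (B : bop H H) : bounded_by B 1 -> (forall x y, '[B x, y] = '[x, B y]) ->
  exists Y : bop H H, [/\ bounded_by Y 1, forall x y, '[Y x, y] = '[x, Y y] &
    2 *: Y = B + Y \oB Y].
Proof.
move=> hB sB; pose Y k := sqrt_iter B k; pose y k : R := scalar_sqrt_iter k.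
have YS k : Y k.+1 = 2^-1 *: (B + Y k \oB Y k) by [].
have hY k : bounded_by (Y k) (y k) by case: (sqrt_iter_bounded k hB).
have hY1 k : bounded_by (Y k) 1.
  by apply: bounded_widen (hY k) _; case/andP: (scalar_sqrt_iter_bnd k).
have sY k : forall u v, '[Y k u, v] = '[u, Y k v].
  elim: k => [|k IH] u v; first by rewrite inner0l inner0r.
  rewrite YS !bopZE !bopDE !compE innerZl innerZr !innerDl !innerDr sB !IH.
  by congr (_ * _); rewrite fmorphV rmorph_nat.
have mono i j : (i <= j)%N -> bounded_by (Y j - Y i) (y j - y i).
  elim: j => [|j IH]; first by rewrite leqn0 => /eqP ->; rewrite !subrr; split=> // x; rewrite mul0r hnorm0.
  rewrite leq_eqVlt ltnS => /orP[/eqP ->|/IH h].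
    by rewrite !subrr; split=> // x; rewrite mul0r hnorm0.
  have [_ h'] := sqrt_iter_bounded j hB.
  have := add_bounded h' h.
  by rewrite !addrA !subrK.
(* The scalar iteration is nondecreasing and at most [1], hence Cauchy; by [mono] its increments
   dominate those of [Y]. *)
have yC e : 0 < e -> exists N : nat, forall i j, (N <= i)%N -> (i <= j)%N -> y j - y i < e.
  have ycv : cvgn y.
    apply: nondecreasing_is_cvgn; last by exists 1 => _ [k _ <-]; case/andP: (scalar_sqrt_iter_bnd k).
    by move=> i j /mono[]; rewrite subr_ge0.
  move=> e0; have [N _ hN] := (cvgrPdist_lt _ _).1 ycv _ (divr_gt0 e0 (ltr0Sn R 1)).
  exists N => i j Ni ij; have := hN i Ni; have := hN j (leq_trans Ni ij) => /=.
  rewrite !ltr_norml => /andP[a b] /andP[c d]; rewrite [ltRHS]splitr; lra.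
have key x e : 0 < e -> exists N : nat, forall i j, (N <= i)%N -> (i <= j)%N ->
    hnorm (Y j x - Y i x) < e.
  move=> e0; have x1 : 0 < hnorm x + 1 by rewrite ltr_wpDl.
  have [N hN] := yC _ (divr_gt0 e0 x1); exists N => i j Ni ij.
  have [_ /(_ x) h] := mono _ _ ij; apply: le_lt_trans h _.
  have := hN _ _ Ni ij; rewrite ltr_pdivlMr //; apply: le_lt_trans.
  by rewrite ler_wpM2l ?lerDl //; have [] := mono _ _ ij.
have [Z bZ cZ] : exists2 Z, bounded_by Z 1 & sot_cvg \oo Y Z.
  apply: sot_limit => // x e e0; have [N hN] := key x e e0; exists N => i j Ni Nj.
  by have [ij|/ltnW ji] := leqP i j; [rewrite -[dnorm _ _]/(hnorm (Y i x - Y j x)) hnormBC|]; exact: hN.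
exists Z; split=> // [u v|]; first exact: (hcvg_inner_eq (cZ u) (cZ v)).
apply: bopP => x; rewrite bopZE bopDE compE.
have h1 : hcvg \oo (fun k => 2 *: Y k.+1 x) (2 *: Z x).
  apply: hcvgZ; apply/hcvg_seqP => e e0; have [N hN] := (hcvg_seqP _ _).1 (cZ x) e e0.
  by exists N => k kN; apply: hN; exact: leqW.
apply: (hcvg_unique h1).
have -> : (fun k => 2 *: Y k.+1 x) = (fun k => B x + Y k (Y k x)).
  by apply/funext => k; rewrite YS bopZE scalerA divff ?pnatr_eq0 // scale1r.
apply: hcvgD; first exact: hcvg_cst.
have -> : Z (Z x) = Z (Z x) + 0 by rewrite addr0.
(* The second summand tends to [0] because the [Y k] are uniformly contractive. *)
have -> : (fun k => Y k (Y k x)) = (fun k => Y k (Z x) + Y k (Y k x - Z x)).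
  by apply/funext => k; rewrite bopB addrC subrK.
apply: hcvgD => //; apply: (hcvg_near_le (v := fun k => Y k x - Z x) (m := 0)).
  apply: nearW => k; rewrite !subr0; have [_ h] := hY1 k.
  by apply: le_trans (h _) _; rewrite mul1r.
by have := hcvgB (cZ x) (hcvg_cst (Z x)); rewrite subrr; apply.
Qed.

(** Dividing by [c = M + 1 > 0] reduces to a contraction [A1]. With [B = I - A1] the previous lemma
    gives [(I - Y)^2 = A1], and the factor [sqrt c] undoes the scaling. *)
Lemma sqrt_bopP H (A : bop H H) : pos_bop A ->
  pos_bop (sqrt_bop A) /\ sqrt_bop A \oB sqrt_bop A = A.
Proof.
move=> pA; rewrite -[_ /\ _]/([set D | pos_bop D /\ D \oB D = A] (sqrt_bop A)).
apply: xgetPex => /=.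
have [M [M0 hM]] := bounded_byP A.
pose c := M + 1; have c0 : 0 < c by rewrite ltr_wpDl.
pose A1 := (c^-1)%:C%C *: A.
have pA1 : pos_bop A1.
  move=> x; by rewrite bopZE innerZl mulr_ge0 // lecR invr_ge0 ltW.
have bA1 : bounded_by A1 1.
  split=> // x; rewrite bopZE hnormZ cabsR ?invr_ge0 ?(ltW c0) // mul1r ler_pdivrMl //.
  by apply: le_trans (hM x) _; rewrite ler_wpM2r // lerDl.
have [Y [bY sY EY]] : exists Y : bop H H, [/\ bounded_by Y 1, forall x y, '[Y x, y] = '[x, Y y] &
    2 *: Y = (id_bop H - A1) + Y \oB Y].
  apply: sqrt_contr; first exact: pos_sub_contr.
  by move=> x y; rewrite !bopBE innerBl innerBr (pos_bop_sa pA1).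
pose s : R[i] := (Num.sqrt c)%:C%C.
exists (s *: (id_bop H - Y)); split.
  move=> x; rewrite bopZE innerZl mulr_ge0 ?lecR ?sqrtr_ge0 //.
  rewrite bopBE innerBl lecE; apply/andP; split.
    have : '[Y x, x]^* = '[Y x, x] by rewrite -innerC sY.
    rewrite inner_hnorm /=; case: '[Y x, x] => u v /= [].
    move=> h; rewrite sub0r oppr_eq0; apply/eqP; move: h => /=; lra.
  rewrite ReB Re_innerxx /= subr_ge0; apply: le_trans (Re_inner_le _ _) _.
  by rewrite expr2 ler_wpM2r //; have [_ h] := bY; rewrite -[leRHS]mul1r.
have ss : s * s = c%:C%C by rewrite /s -rmorphM /= -expr2 sqr_sqrtr ?(ltW c0).
apply: bopP => x; rewrite compE !bopZE bopZ scalerA ss !bopBE !bopB !id_bopE.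
have : (2 *: Y) x = (id_bop H - A1 + Y \oB Y) x by rewrite EY.
rewrite bopZE bopDE bopBE compE id_bopE scaler_nat mulr2n => E.
have -> : x - Y x - (Y x - Y (Y x)) = A1 x.
  have : Y x + Y x - Y (Y x) = x - A1 x by rewrite E addrK.
  move/(congr1 (fun w => x - w)); rewrite subKr => <-.
  by rewrite -addrA -opprD addrA.
rewrite /A1 bopZE scalerA; have -> : c%:C%C * (c^-1)%:C%C = 1 :> R[i].
  by rewrite -rmorphM /= divff ?gt_eqF.
exact: scale1r.
Qed.

End SquareRoot.

(** * Tensor products *)

Section Defect.
Variable R : realType.
Implicit Types H K L G : hilbert R.

Lemma sqrt_inner H (A : bop H H) x y : pos_bop A ->
  '[sqrt_bop A x, sqrt_bop A y] = '[A x, y].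
Proof.
move=> pA; have [pD DD] := sqrt_bopP pA.
by rewrite -(pos_bop_sa pD) -{3}DD.
Qed.

(** [D] is the square root of [M^2 - A^* A]. The identity is stated for two vectors because it is
    applied inside double sums over elementary tensors. *)
Lemma defect_exists H K (A : bop H K) M : bounded_by A M ->
  exists D : bop H H, forall x y,
    '[D x, D y] + '[A x, A y] = (M ^+ 2)%:C%C * '[x, y].
Proof.
move=> [M0 hM]; pose E := (M ^+ 2)%:C%C *: id_bop H - adj A \oB A.
have EE x y : '[E x, y] = (M ^+ 2)%:C%C * '[x, y] - '[A x, A y].
  by rewrite bopBE bopZE compE innerBl innerZl adjP'.
have pE : pos_bop E.
  move=> x; rewrite EE !inner_hnorm -rmorphM -rmorphB lecR subr_ge0 -exprMn.
  by rewrite ler_pXn2r ?nnegrE ?mulr_ge0.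
by exists (sqrt_bop E) => x y; rewrite (sqrt_inner _ _ pE) EE subrK.
Qed.

Lemma bop_dense_eq H K (S : set H) (A B : bop H K) :
  hclosure (lspan S) = setT -> (forall s, S s -> A s = B s) -> A = B.
Proof.
move=> dS h; apply: bopP => x; apply: inner_ext => y.
apply/eqP; rewrite -subr_eq0 -innerBl -bopBE -[_ - _]/(A - B) adjP; apply/eqP.
apply: inner_conj0; apply: (orth_hspan (S := S)); last by rewrite dS.
by move=> s Ss; rewrite adjP' bopBE h // subrr inner0r.
Qed.
End Defect.

Section TensorOperators.
Variables (R : realType) (G H L : hilbert R) (tau : G -> H -> L).
Hypothesis tauP : hilbert_tensor tau.
Implicit Types (A B : bop G G).

Lemma tensorDl g g' h : tau (g + g') h = tau g h + tau g' h.
Proof. by have := tensor_linearl tauP h 1 g g'; rewrite !scale1r. Qed.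
Lemma tensor0l h : tau 0 h = 0.
Proof. by apply: (addIr (tau 0 h)); rewrite -tensorDl !add0r. Qed.
Lemma tensorZl a g h : tau (a *: g) h = a *: tau g h.
Proof. by have := tensor_linearl tauP h a g 0; rewrite tensor0l !addr0. Qed.
Lemma tensorDr g h h' : tau g (h + h') = tau g h + tau g h'.
Proof. by have := tensor_linearr tauP g 1 h h'; rewrite !scale1r. Qed.
Lemma tensor0r g : tau g 0 = 0.
Proof. by apply: (addIr (tau g 0)); rewrite -tensorDr !add0r. Qed.
Lemma tensorZr a g h : tau g (a *: h) = a *: tau g h.
Proof. by have := tensor_linearr tauP g a h 0; rewrite tensor0r !addr0. Qed.

Lemma tensor_eq K (X Y : bop L K) : (forall g h, X (tau g h) = Y (tau g h)) -> X = Y.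
Proof.
by move=> h; apply: (bop_dense_eq (tensor_total tauP)) => _ [g [k ->]].
Qed.

Lemma tensor_inner_eq (x y : L) :
  (forall g h, '[x, tau g h] = '[y, tau g h]) -> x = y.
Proof.
move=> h; apply: inner_ext => z; apply/eqP; rewrite -subr_eq0 -innerBl; apply/eqP.
apply: (orth_hspan (S := [set x | exists g h, x = tau g h])).
  by move=> _ [g [k ->]]; rewrite innerBl h subrr.
by rewrite (tensor_total tauP).
Qed.

(* If [D^* D = M^2 - A^* A] then the Pythagorean identity
   [|sum A g_i (x) h_i|^2 + |sum D g_i (x) h_i|^2 = M^2 |sum g_i (x) h_i|^2]
   bounds [A (x) I] without choosing a basis of [H]. *)
Lemma amplification_exists A M : bounded_by A M ->
  exists2 X : bop L L, bounded_by X M & forall g h, X (tau g h) = tau (A g) h.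
Proof.
move=> bA; have [D hD] := defect_exists bA; have [M0 _] := bA.
pose S B (s : seq (G * H)) : L := \sum_(p <- s) tau (B p.1) p.2.
pose Q (x y : L) := exists s, x = S (id_bop G) s /\ y = S A s.
have Q0 : Q 0 0 by exists [::]; rewrite /S !big_nil.
have QL a x y x' y' : Q x y -> Q x' y' -> Q (a *: x + x') (a *: y + y').
  move=> [s [-> ->]] [s' [-> ->]].
  exists ([seq (a *: p.1, p.2) | p <- s] ++ s').
  rewrite /S !big_cat /= !big_map !scaler_sumr.
  by split; congr (_ + _); apply: eq_bigr => p _; rewrite /= ?bopZ tensorZl.
have QM x y : Q x y -> hnorm y <= M * hnorm x.
  move=> [s [-> ->]].
  have SE B : '[S B s, S B s] = \sum_(p <- s) \sum_(q <- s) '[B p.1, B q.1] * '[p.2, q.2].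
    rewrite inner_suml; apply: eq_bigr => p _; rewrite inner_sumr.
    by apply: eq_bigr => q _; rewrite (tensor_inner tauP).
  have E : '[S D s, S D s] + '[S A s, S A s] = (M ^+ 2)%:C%C * '[S (id_bop G) s, S (id_bop G) s].
    rewrite !SE -big_split mulr_sumr; apply: eq_bigr => p _.
    rewrite -big_split mulr_sumr; apply: eq_bigr => q _ /=.
    by rewrite -mulrDl hD mulrA.
  rewrite -[leRHS]ger0_norm ?mulr_ge0 // -[leLHS]ger0_norm //.
  rewrite -!sqrtr_sqr ler_wsqrtr // exprMn.
  move: E; rewrite !inner_hnorm -rmorphM -rmorphD => /complexI <-.
  by rewrite lerDr sqr_ge0.
have [X bX hX] := bop_extension M0 Q0 QL QM; exists X => // g h.
by apply: hX; exists [:: (g, h)]; rewrite /S !big_seq1.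
Qed.

Definition ampl A : bop L L := tensor_bop tau A (id_bop H).

Lemma amplE A g h : ampl A (tau g h) = tau (A g) h.
Proof.
have [M bA] := bounded_byP A; have [X _ hX] := amplification_exists bA.
exact: (@xgetPex _ 0 [set X : bop L L | forall g h, X (tau g h) = tau (A g) (id_bop H h)]
  (ex_intro _ X hX) g h).
Qed.

Lemma ampl_bounded A M : bounded_by A M -> bounded_by (ampl A) M.
Proof.
move=> bA; have [X bX hX] := amplification_exists bA.
by have -> : ampl A = X by apply: tensor_eq => g h; rewrite amplE.
Qed.

Lemma ampl_linear : linear ampl.
Proof. by move=> a A B; apply: tensor_eq => g h; rewrite bopDE bopZE !amplE tensorDl tensorZl. Qed.

Lemma ampl_comp A B : ampl (A \oB B) = ampl A \oB ampl B.
Proof. by apply: tensor_eq => g h; rewrite compE !amplE. Qed.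

Lemma ampl_id : ampl (id_bop G) = id_bop L.
Proof. by apply: tensor_eq => g h; rewrite amplE. Qed.

Lemma adj_ampl A : adj (ampl A) = ampl (adj A).
Proof.
apply: tensor_eq => g h; apply: tensor_inner_eq => g' h'.
by rewrite adjP' !amplE !(tensor_inner tauP) adjP'.
Qed.
End TensorOperators.

Section RightTensor.
Variables (R : realType) (G H L : hilbert R) (tau : G -> H -> L).
Hypothesis tauP : hilbert_tensor tau.

(** Interchanging the factors reduces [I (x) B] to the case [B (x) I]. *)
Lemma tensor_flip : hilbert_tensor (fun h g => tau g h).
Proof.
split; [exact: tensor_linearr tauP|exact: tensor_linearl tauP| |].
  by move=> h h' g g'; rewrite (tensor_inner tauP) mulrC.
rewrite -(tensor_total tauP); congr (hclosure (lspan _)).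
by apply/seteqP; split=> _ [h [g ->]]; exists g, h.
Qed.

Lemma tensor_bop_flip (B : bop H H) :
  tensor_bop tau (id_bop G) B = ampl (fun h g => tau g h) B.
Proof. by congr (xget _ _); apply/seteqP; split=> X hX h g; rewrite hX. Qed.

Lemma tensor_id_bopE (B : bop H H) g h :
  tensor_bop tau (id_bop G) B (tau g h) = tau g (B h).
Proof. by rewrite tensor_bop_flip (amplE tensor_flip B h g). Qed.

Lemma tensor_id_bounded (B : bop H H) M :
  bounded_by B M -> bounded_by (tensor_bop tau (id_bop G) B) M.
Proof. by rewrite tensor_bop_flip; exact: (ampl_bounded tensor_flip). Qed.
End RightTensor.

(** * Hilbert sums *)

Section L2.
Variables (R : realType) (I : choiceType) (H : hilbert R).
Local Notation Re := complex.Re.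
Local Notation E := (l2_hilbert I H).
Local Notation K := (scalar_hilbert R).
Implicit Types (f g : E) (h : H).

Lemma l2_innerP f g : @has_sum R K I (fun i => '[f i, g i]) '[f, g].
Proof. exact: l2_dotP. Qed.

Lemma l2_inner_delta f i h : '[f, l2_delta i h] = '[f i, h].
Proof.
apply: l2_dotE; have := @has_sum_finite R I K (fun j => '[f j, l2_delta i h j]) [:: i] isT.
rewrite big_seq1 /= eqxx; apply => j; rewrite inE => /negPf /= ->.
exact: inner0r.
Qed.

Lemma l2_inner_deltal f i h : '[l2_delta i h, f] = '[h, f i].
Proof. by rewrite innerC l2_inner_delta -innerC. Qed.

Lemma l2_deltaE i h j : (l2_delta i h : E) j = if j == i then h else 0.
Proof. by []. Qed.

Lemma l2_delta_hnorm i h : hnorm (l2_delta i h : E) = hnorm h.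
Proof.
rewrite -[LHS]ger0_norm // -[RHS]ger0_norm // -!sqrtr_sqr -!Re_innerxx.
by rewrite l2_inner_delta /= eqxx.
Qed.

Lemma l2P f g : (forall i, f i = g i) -> f = g.
Proof. by move=> h; apply/val_inj/funext. Qed.

Lemma l2_sumE (J : Type) (s : seq J) (P : pred J) (u : J -> E) i :
  (\sum_(j <- s | P j) u j) i = \sum_(j <- s | P j) u j i.
Proof. by elim/big_ind2: _ => // x a y b <- <-. Qed.

Lemma l2_partial_le f (F : seq I) : uniq F ->
  \sum_(i <- F) hnorm (f i) ^+ 2 <= hnorm f ^+ 2.
Proof. exact: l2_dnorm_ge. Qed.

Lemma l2_hnorm_le f B : 0 <= B ->
  (forall F, uniq F -> \sum_(i <- F) hnorm (f i) ^+ 2 <= B ^+ 2) -> hnorm f <= B.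
Proof. exact: l2_dnorm_le. Qed.

Definition delta_bop_subproof i : (l2_delta i : H -> E) \in @bop_pred R H E.
Proof.
apply/asboolP; split.
  move=> a x y; apply: l2P => j; rewrite l2DE l2ZE !l2_deltaE.
  by case: eqP => // _; rewrite scaler0 addr0.
by exists 1 => x; rewrite l2_delta_hnorm mul1r.
Qed.
Definition delta_bop i : bop H E := Bop (delta_bop_subproof i).

Lemma delta_bopE i h : delta_bop i h = l2_delta i h. Proof. by []. Qed.

Lemma adj_deltaE i f : adj (delta_bop i) f = f i.
Proof. by apply: inner_ext => h; rewrite adjP' delta_bopE l2_inner_delta. Qed.

Lemma l2_inner_delta_eq f g :
  (forall i h, '[f, l2_delta i h] = '[g, l2_delta i h]) -> f = g.
Proof. by move=> e; apply: l2P => i; apply: inner_ext => h; rewrite -!l2_inner_delta. Qed.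

Lemma l2_delta_total : hclosure (lspan [set x : E | exists i h, x = l2_delta i h]) = setT.
Proof.
apply: dense_of_orth => x hx; apply: l2_inner_delta_eq => i h; rewrite inner0l.
by apply: hx; exists i, h.
Qed.

Lemma bop_delta_eq L (A B : bop E L) :
  (forall i h, A (l2_delta i h) = B (l2_delta i h)) -> A = B.
Proof. by move=> h; apply: (bop_dense_eq l2_delta_total) => _ [i [k ->]]. Qed.

(** A partial sum [y] satisfies [<y, y> = <y, f>], so [|y - f|^2] is the remainder of the series of
    [|f i|^2], which converges unconditionally to [|f|^2]. *)
Lemma l2_delta_sum f : has_sum (fun i => l2_delta i (f i) : E) f.
Proof.
move=> e e0; have e2 : 0 < e ^+ 2 by rewrite exprn_gt0.
have [F0 h0] := l2_innerP f f e2; exists F0 => F uF sF.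
have := h0 F uF sF; pose y : E := \sum_(i <- F) l2_delta i (f i); rewrite -/y.
have yf : '[y, f] = (\sum_(i <- F) hnorm (f i) ^+ 2)%:C%C.
  rewrite inner_suml rmorph_sum; apply: eq_bigr => i _.
  by rewrite l2_inner_deltal inner_hnorm.
have yy : '[y, y] = '[y, f].
  rewrite {1}/y !inner_suml !big_seq; apply: eq_bigr => i iF.
  rewrite !l2_inner_deltal l2_sumE; congr (inner _ _).
  rewrite (bigD1_seq i) //= eqxx big1 ?addr0 // => j.
  by rewrite eq_sym => /negPf ->.
have -> : \sum_(i <- F) ('[f i, f i] : K) = '[y, f].
  by rewrite yf rmorph_sum; apply: eq_bigr => i _; rewrite inner_hnorm.
have ff : hnorm (y - f) ^+ 2 = hnorm f ^+ 2 - \sum_(i <- F) hnorm (f i) ^+ 2.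
  rewrite hnormD_sqr hnormN innerNr -[hnorm y ^+ 2]Re_innerxx yy yf /=; ring.
rewrite inner_hnorm yf /hnorm scalar_dnorm -/(hnorm _) => h.
rewrite -(@ltr_pXn2r _ 2) ?nnegrE ?dnormr_ge0 ?(ltW e0) //.
rewrite -[dnorm _ _]/(hnorm (y - f)) ff.
apply: le_lt_trans h; rewrite -rmorphB -[complex.Re _]/(cabs _) -cabsN -rmorphN opprB.
by rewrite cabsR // subr_ge0 l2_partial_le.
Qed.

Lemma l2_tens_delta (w : I) h : l2_tens (@l2_delta R I K w 1) h = l2_delta w h.
Proof.
by apply: l2P => i; rewrite l2_deltaE /=; case: eqP => _; rewrite ?scale1r ?scale0r.
Qed.

Lemma l2_build (u : I -> H) (B : R) : 0 <= B ->
  (forall F, uniq F -> \sum_(i <- F) hnorm (u i) ^+ 2 <= B ^+ 2) ->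
  exists2 f : E, f =1 u & hnorm f <= B.
Proof.
move=> B0 hB; have uP : u \in @l2_pred R I H by apply/asboolP; exists (B ^+ 2).
by exists (L2 uP) => //; apply: l2_hnorm_le.
Qed.

End L2.

Section PullbackExists.
Variables (R : realType) (I : choiceType) (H : hilbert R).
Local Notation E := (l2_hilbert I H).
Implicit Types (f g : E) (h : H).
Variable phi : I -> I.
Hypothesis phiI : injective phi.

(** Composition with an injection is a coisometry whose adjoint moves [l2_delta i] to
    [l2_delta (phi i)]; shifts and right multiplications are defined below as such adjoints. *)
Lemma pullback_exists : exists A : bop E E, bounded_by A 1 /\ forall f i, A f i = f (phi i).
Proof.
have ex f : exists g : E, (forall i, g i = f (phi i)) /\ hnorm g <= hnorm f.
  have [|F uF|g gE gB] := @l2_build R I H (fun i => f (phi i)) (hnorm f); [by []| |by exists g].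
  rewrite -(big_map phi xpredT (fun i => hnorm (f i) ^+ 2)).
  by apply: l2_partial_le; rewrite map_inj_uniq.
have [T hT] := boolp.choice ex.
have lT : linear T.
  by move=> a x y; apply: l2P => i; rewrite l2E !(proj1 (hT _)) l2E.
have bT x : hnorm (T x) <= 1 * hnorm x by rewrite mul1r; case: (hT x).
have [A hA] := bop_build lT bT; exists A; split; first by split=> // x; rewrite hA.
by move=> f i; rewrite hA; case: (hT f).
Qed.

End PullbackExists.

(* Locked, as are several operators below, to keep unification from unfolding
   the underlying choices. *)
HB.lock Definition pullback (R : realType) (I : choiceType) (H : hilbert R)
    (phi : I -> I) (phiI : injective phi) : bop (l2_hilbert I H) (l2_hilbert I H) :=
  sval (cid (@pullback_exists R I H phi phiI)).
Arguments pullback {R I} H {phi} phiI.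

Section Pullback.
Variables (R : realType) (I : choiceType) (H : hilbert R).
Local Notation E := (l2_hilbert I H).
Implicit Types (f g : E) (h : H).
Variable phi : I -> I.
Hypothesis phiI : injective phi.

Local Notation pullback := (pullback H phiI).

Lemma pullbackE f i : pullback f i = f (phi i).
Proof. by rewrite unlock; case: cid => A []. Qed.
Lemma adj_pullback_delta i h : adj pullback (l2_delta i h) = l2_delta (phi i) h.
Proof.
by apply: inner_ext => f; rewrite adjP' !l2_inner_deltal pullbackE.
Qed.
Lemma pullbackK f : pullback (adj pullback f) = f.
Proof.
rewrite -[LHS]/((pullback \oB adj pullback) f) -[RHS]/(id_bop E f).
congr (bop_fun _ f); apply: bop_delta_eq => i h.
rewrite compE adj_pullback_delta; apply: l2P => j.
by rewrite pullbackE !l2_deltaE (inj_eq phiI).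
Qed.
End Pullback.

Section FiniteL2.
Variables (R : realType) (I : finType) (H : hilbert R).
Local Notation E := (l2_hilbert I H).

Lemma l2_fin_build (u : I -> H) : exists f : E, f =1 u.
Proof.
have [//|F uF|f fE _] := @l2_build R I H u (Num.sqrt (\sum_i hnorm (u i) ^+ 2)).
- exact: sqrtr_ge0.
- rewrite sqr_sqrtr; last by apply: sumr_ge0 => i _; exact: sqr_ge0.
  rewrite [leRHS](bigID (mem F)) /= big_uniq //= lerDl.
  by apply: sumr_ge0 => i _; exact: sqr_ge0.
- by exists f.
Qed.

Lemma l2_fin_delta (f : E) : f = \sum_i l2_delta i (f i).
Proof.
apply: l2P => j; rewrite l2_sumE (bigD1 j) //= eqxx big1 ?addr0 // => i.
by rewrite eq_sym => /negPf ->.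
Qed.

Lemma l2_fin_inner (f g : E) : '[f, g] = \sum_i '[f i, g i].
Proof.
rewrite {1}[f]l2_fin_delta inner_suml; apply: eq_bigr => i _.
by rewrite l2_inner_deltal.
Qed.

Lemma l2_fin_hnorm (f : E) : hnorm f ^+ 2 = \sum_i hnorm (f i) ^+ 2.
Proof.
rewrite -Re_innerxx l2_fin_inner raddf_sum; apply: eq_bigr => i _.
exact: Re_innerxx.
Qed.
End FiniteL2.

(** * Row contractions and the Poisson kernel *)

Section Words.
Variable n : nat.
Implicit Types (w : seq 'I_n) (F : seq (seq 'I_n)).

Lemma big_tuple_cons (V : nmodType) k (g : seq 'I_n -> V) :
  \sum_(w : k.+1.-tuple 'I_n) g w = \sum_i \sum_(v : k.-tuple 'I_n) g (i :: v).
Proof.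
rewrite pair_big /=.
rewrite (reindex (fun p : 'I_n * k.-tuple 'I_n => [tuple of p.1 :: p.2])) //=.
exists (fun t => (thead t, [tuple of behead t])) => [[i v] _|t _] /=.
  by congr (_, _); apply: val_inj.
by rewrite -tuple_eta.
Qed.

Lemma big_tuple0 (V : nmodType) (g : seq 'I_n -> V) :
  \sum_(w : 0.-tuple 'I_n) g w = g [::].
Proof.
rewrite (eq_bigr (fun=> g [::])) => [|w _]; last by rewrite tuple0.
by rewrite big_const card_tuple expn0 /= addr0.
Qed.

(** These sets are cofinal among the finite sets of words, which links unconditional sums over words
    to sums taken degree by degree. *)
Fixpoint words_lt m : seq (seq 'I_n) :=
  if m is k.+1 then words_lt k ++ [seq val t | t <- enum {:k.-tuple 'I_n}] else [::].

Lemma mem_words_lt m w : (w \in words_lt m) = (size w < m)%N.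
Proof.
elim: m => [|m IH] //=; rewrite mem_cat IH ltnS [RHS]leq_eqVlt orbC; congr (_ || _).
apply/mapP/eqP => [[t _ ->]|sw]; first exact: size_tuple.
by exists (Tuple (introT eqP sw)); rewrite ?mem_enum.
Qed.

Lemma words_lt_uniq m : uniq (words_lt m).
Proof.
elim: m => [|m IH] //=; rewrite cat_uniq IH map_inj_uniq ?enum_uniq ?andbT //=.
  by apply/hasPn => _ /mapP[t _ ->]; rewrite mem_words_lt size_tuple ltnn.
exact: val_inj.
Qed.

Lemma big_words_lt (V : nmodType) m (g : seq 'I_n -> V) :
  \sum_(w <- words_lt m) g w = \sum_(k < m) \sum_(w : k.-tuple 'I_n) g w.
Proof.
elim: m => [|m IH] /=; first by rewrite big_nil big_ord0.
by rewrite big_cat big_ord_recr IH big_map big_enum.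
Qed.

Lemma sub_words_lt F : exists m, {subset F <= words_lt m}.
Proof.
exists (\max_(w <- F) size w).+1 => w wF; rewrite mem_words_lt ltnS.
by rewrite (big_rem w) //= leq_maxl.
Qed.

Lemma ler_sum_subset (R : realType) (I : eqType) (F F' : seq I) (g : I -> R) :
  uniq F -> uniq F' -> {subset F <= F'} -> (forall i, 0 <= g i) ->
  \sum_(i <- F) g i <= \sum_(i <- F') g i.
Proof.
move=> uF uF' sF g0; rewrite [leRHS](bigID (mem F)) /= -[leLHS]addr0.
apply: lerD; last exact: sumr_ge0.
rewrite -[leRHS]big_filter le_eqVlt; apply/orP; left; apply/eqP/perm_big/uniq_perm => //.
  exact: filter_uniq.
by move=> i; rewrite mem_filter /=; case iF : (i \in F) => //=; rewrite sF.
Qed.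
End Words.

Section Rows.
Variables (R : realType) (n : nat) (H : hilbert R).
Implicit Types T : 'I_n -> bop H H.
Local Notation Re := complex.Re.
Local Notation F2H := (l2_hilbert (seq 'I_n) H).

Lemma tens_fock_basis (w : seq 'I_n) (h : H) : l2_tens (fock_basis R w) h = l2_delta w h.
Proof. exact: l2_tens_delta. Qed.

Lemma word_bop_cat T v w : word_bop T (v ++ w) = word_bop T v \oB word_bop T w.
Proof. by elim: v => [|i v IH] /=; rewrite ?id_comp // IH compA. Qed.

(** The quadratic form of [sum_(|w| = k) T_w T_w^*] at [h], in the recursive shape that suits
    inductions on [k]. *)
Fixpoint row_tail T k (h : H) : R :=
  if k is j.+1 then \sum_i row_tail T j (adj (T i) h) else hnorm h ^+ 2.

Lemma row_tailE T k h :
  row_tail T k h = \sum_(w : k.-tuple 'I_n) hnorm (adj (word_bop T w) h) ^+ 2.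
Proof.
elim: k h => [|k IH] h.
  by rewrite (big_tuple0 (fun w => hnorm (adj (word_bop T w) h) ^+ 2)) /= adj_id.
rewrite (big_tuple_cons _ (fun w => hnorm (adj (word_bop T w) h) ^+ 2)) /=.
apply: eq_bigr => i _; rewrite IH; apply: eq_bigr => w _.
by rewrite adj_comp.
Qed.

Lemma row_tail_ge0 T k h : 0 <= row_tail T k h.
Proof. by rewrite row_tailE; apply: sumr_ge0 => w _; exact: sqr_ge0. Qed.

Lemma defect_inner T x y :
  '[defect T x, y] = '[x, y] - \sum_i '[adj (T i) x, adj (T i) y].
Proof.
rewrite bopBE bop_sumE innerBl inner_suml; congr (_ - _).
by apply: eq_bigr => i _; rewrite compE adjP.
Qed.

Lemma row_contractionP T : row_contraction T <->
  forall h, \sum_i hnorm (adj (T i) h) ^+ 2 <= hnorm h ^+ 2.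
Proof.
have E h : '[defect T h, h] = (hnorm h ^+ 2 - \sum_i hnorm (adj (T i) h) ^+ 2)%:C%C.
  rewrite defect_inner inner_hnorm rmorphB rmorph_sum; congr (_ - _).
  by apply: eq_bigr => i _; rewrite inner_hnorm.
by split=> h x; have := h x; rewrite E lecR subr_ge0.
Qed.

Lemma row_tail_le T k h : row_contraction T -> row_tail T k h <= hnorm h ^+ 2.
Proof.
move=> /row_contractionP hT; elim: k h => [|k IH] h //=.
by apply: le_trans (hT h); apply: ler_sum => i _.
Qed.

(** Purity expressed by quadratic forms: [C0_row] implies it, and it is easy to check for [r T] and
    for the right shifts. *)
Definition row_pure T : Prop := forall h, row_tail T ^~ h @ \oo --> (0 : R).

Lemma C0_row_pure T : C0_row T -> row_pure T.
Proof.
move=> hC0 h; move: hC0 => /(_ h) /hcvg_seqP hC; apply/cvgrPdist_lt => e e0.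
have h1 : 0 < hnorm h + 1 by rewrite ltr_wpDl.
have [N hN] := hC _ (divr_gt0 e0 h1); exists N => // k /hN /=.
rewrite sub0r normrN ger0_norm ?row_tail_ge0 // subr0.
set x := bop_fun _ h; rewrite ltr_pdivlMr // => hx.
have -> : row_tail T k h = Re '[x, h].
  rewrite /x bop_sumE inner_suml raddf_sum row_tailE; apply: eq_bigr => w _ /=.
  by rewrite adjP Re_innerxx.
apply: le_lt_trans (Re_inner_le _ _) _; apply: le_lt_trans hx.
by rewrite ler_wpM2l // lerDl.
Qed.

Lemma sqrt_defect_hnorm T h : row_contraction T ->
  hnorm (sqrt_bop (defect T) h) ^+ 2 = row_tail T 0 h - row_tail T 1 h.
Proof.
move=> hT; rewrite -Re_innerxx sqrt_inner // defect_inner raddfB raddf_sum /=.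
by rewrite Re_innerxx; congr (_ - _); apply: eq_bigr => i _; exact: Re_innerxx.
Qed.

Definition poisson_coef T (h : H) (w : seq 'I_n) : H :=
  sqrt_bop (defect T) (adj (word_bop T w) h).

(** For [k = 0] this is the definition of the defect; each further letter replaces [h] by the
    vectors [T_i^* h]. Summed over [k] the right-hand sides telescope. *)
Lemma poisson_level T k h : row_contraction T ->
  \sum_(w : k.-tuple 'I_n) hnorm (poisson_coef T h w) ^+ 2 =
  row_tail T k h - row_tail T k.+1 h.
Proof.
move=> hT; elim: k h => [|k IH] h.
  rewrite (big_tuple0 (fun w => hnorm (poisson_coef T h w) ^+ 2)) /poisson_coef /=.
  by rewrite adj_id sqrt_defect_hnorm.
rewrite (big_tuple_cons _ (fun w => hnorm (poisson_coef T h w) ^+ 2)).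
rewrite [row_tail T k.+2 h]/= [row_tail T k.+1 h]/= -sumrB.
apply: eq_bigr => i _; rewrite -IH; apply: eq_bigr => w _.
by rewrite /poisson_coef /= adj_comp.
Qed.

Lemma poisson_partial T m h : row_contraction T ->
  \sum_(w <- words_lt n m) hnorm (poisson_coef T h w) ^+ 2 =
  hnorm h ^+ 2 - row_tail T m h.
Proof.
move=> hT; rewrite big_words_lt; elim: m => [|m IH]; first by rewrite big_ord0 subrr.
by rewrite big_ord_recr IH poisson_level //= addrA subrK.
Qed.

Lemma poisson_coef_le T h (F : seq (seq 'I_n)) : row_contraction T -> uniq F ->
  \sum_(w <- F) hnorm (poisson_coef T h w) ^+ 2 <= hnorm h ^+ 2.
Proof.
move=> hT uF; have [m sF] := sub_words_lt F.
apply: le_trans (ler_sum_subset uF (words_lt_uniq n m) sF _) _ => [w|].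
  exact: sqr_ge0.
by rewrite poisson_partial // gerBl row_tail_ge0.
Qed.

Lemma poissonE T h w : row_contraction T ->
  poisson T h w = sqrt_bop (defect T) (adj (word_bop T w) h).
Proof.
move=> hT.
have /choice[f hf] : forall h : H, exists f : F2H, f =1 poisson_coef T h /\ hnorm f <= hnorm h.
  move=> k; have [//||f fE fB] := @l2_build R _ H (poisson_coef T k) (hnorm k).
    by move=> F uF; exact: poisson_coef_le.
  by exists f.
have fL : linear f.
  move=> a x y; apply: l2P => v; rewrite l2E !(proj1 (hf _)) /poisson_coef.
  by rewrite !(bopD, bopZ).
have fB x : hnorm (f x) <= 1 * hnorm x by rewrite mul1r; case: (hf x).
have [X hX] := bop_build fL fB.
have XP : forall h : H, has_sum (fun w => l2_tens (fock_basis R w)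
    (sqrt_bop (defect T) (adj (word_bop T w) h))) (X h).
  move=> k.
  have -> : (fun w => l2_tens (fock_basis R w) (sqrt_bop (defect T) (adj (word_bop T w) k))) =
      (fun w => l2_delta w (X k w) : F2H).
    by apply/funext => v; rewrite tens_fock_basis hX (proj1 (hf k)).
  exact: l2_delta_sum.
have := (@xgetPex _ 0 [set X : bop H F2H | forall h : H, has_sum (fun w =>
  l2_tens (fock_basis R w) (sqrt_bop (defect T) (adj (word_bop T w) h))) (X h)]
  (ex_intro _ X XP)) h.
by move=> /(has_sum_unique (XP h)); rewrite -/(poisson T) => <-; rewrite hX (proj1 (hf _)).
Qed.

(** The coefficients of degree below [m] have total square norm [|h|^2 - row_tail T m h], and purity
    removes the tail. *)
Lemma poisson_isometry T h : row_contraction T -> row_pure T -> hnorm (poisson T h) = hnorm h.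
Proof.
move=> hT hC; apply/eqP; rewrite eq_le; apply/andP; split.
  apply: l2_hnorm_le => // F uF.
  by under eq_bigr do rewrite poissonE //; exact: poisson_coef_le.
apply: hnorm_sqr_le; apply/ler_addgt0Pr => e e0.
have [N _ /(_ N (leqnn _)) /=] := (cvgrPdist_lt _ _).1 (hC h) e e0.
rewrite sub0r normrN ger0_norm ?row_tail_ge0 // => hN.
apply: le_trans (lerD (l2_partial_le _ (words_lt_uniq n N)) (ltW hN)).
under eq_bigr do rewrite poissonE //.
by rewrite -/(poisson_coef T h _) (poisson_partial N h hT) subrK.
Qed.

Lemma adj_poisson_poisson T : row_contraction T -> row_pure T ->
  adj (poisson T) \oB poisson T = id_bop H.
Proof.
move=> hT hC; apply: bopP => x; apply: inner_ext => y; rewrite compE adjP' id_bopE.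
have iso z : '[poisson T z, poisson T z] = '[z, z].
  by rewrite !inner_hnorm poisson_isometry.
have Q a : a * '[poisson T x, poisson T y] + (a * '[poisson T x, poisson T y])^* =
   a * '[x, y] + (a * '[x, y])^*.
  have := iso (a *: x + y); rewrite bopD bopZ !innerDl !innerDr !innerZl !innerZr !iso.
  rewrite -!addrA => /addrI; rewrite !addrA => /addIr.
  by rewrite (innerC (poisson T y)) (innerC y) !conjM.
apply/eqP; rewrite -subr_eq0; apply/eqP.
have Q' a : complex.Re (a * ('[poisson T x, poisson T y] - '[x, y])) = 0.
  have := congr1 (@complex.Re R) (Q a); rewrite !ReD !ReJ mulrBr ReB; lra.
(* With this scalar the vanishing real part is the squared modulus of the difference. *)
have := Q' ('[poisson T x, poisson T y] - '[x, y])^*.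
by rewrite mulrC mul_conj_cabs /= => /eqP; rewrite sqrf_eq0 => /eqP /cabs_eq0.
Qed.

(** [K^*] sends [e_w (x) h] to [T_w Delta h]; prefixing letters to [w] thus becomes applying [T] on
    the left, which is the source of the intertwining relations. *)
Lemma adj_poisson_delta T w h : row_contraction T ->
  adj (poisson T) (l2_delta w h) = word_bop T w (sqrt_bop (defect T) h).
Proof.
move=> hT; apply: inner_ext => x; rewrite adjP' l2_inner_deltal poissonE //.
have [pD _] := sqrt_bopP hT.
by rewrite -(pos_bop_sa pD) [RHS]adjP.
Qed.
End Rows.

(** * Functional calculus *)

Section Limits.
Variable R : realType.
Implicit Types H K : hilbert R.

(** The uniform bound [M] extends convergence from a total set to all vectors; von Neumann's
    inequality supplies it in the applications to [f(r T)]. *)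
Lemma sot_dense H K (S : set H) (X : Type) (F : set_system X) {FF : Filter F}
    (A : X -> bop H K) (B : bop H K) (M : R) :
  hclosure (lspan S) = setT -> (\forall x \near F, bounded_by (A x) M) ->
  (forall s, S s -> hcvg F (fun x => A x s) (B s)) -> sot_cvg F A B.
Proof.
move=> dS bA hS; have [N [N0 hN]] := bounded_byP B.
have sS : lspan S `<=` [set h | hcvg F (fun x => A x h) (B h)].
  apply: lspan_ind => //; split=> [|a x y hx hy] /=.
    by rewrite bop0; under eq_fun do rewrite bop0; exact: hcvg_cst.
  rewrite bopD bopZ.
  have -> : (fun t => A t (a *: x + y)) = (fun t => a *: A t x + A t y).
    by apply/funext => t; rewrite bopD bopZ.
  by apply: hcvgD => //; exact: hcvgZ.
move=> h; apply/hcvgP => e e0.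
have MN : 0 < `|M| + N + 1 by rewrite ltr_wpDl ?addr_ge0.
have e2 := divr_gt0 e0 (ltr0Sn R 1).
have [s /sS /hcvgP /(_ _ e2) hs] : exists2 s, lspan S s & hnorm (h - s) < e / 2 / (`|M| + N + 1).
  have : hclosure (lspan S) h by rewrite dS.
  by apply; exact: divr_gt0.
rewrite ltr_pdivlMr // => hd; apply: filterS2 bA hs => x [M0 hM] hx.
have -> : A x h - B h = A x (h - s) + (A x s - B s) - B (h - s).
  by rewrite !bopB opprB !addrA !subrK.
rewrite addrAC; apply: le_lt_trans (hnormD _ _) _; rewrite [ltRHS]splitr ltrD //.
apply: le_lt_trans (hnormB _ _) _; apply: le_lt_trans hd.
apply: le_trans (lerD (hM _) (hN _)) _; rewrite -mulrDl mulrC ler_wpM2l //.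
by rewrite ger0_norm // lerDl.
Qed.

Lemma sot_unique H K (X : Type) (F : set_system X) {FF : ProperFilter F}
    (A : X -> bop H K) B C : sot_cvg F A B -> sot_cvg F A C -> B = C.
Proof. by move=> hB hC; apply: bopP => h; exact: hcvg_unique (hB h) (hC h). Qed.

Lemma sot_comp H K L L' (X : Type) (F : set_system X) {FF : Filter F}
    (A : X -> bop H K) B (C : bop K L) (D : bop L' H) :
  sot_cvg F A B -> sot_cvg F (fun x => C \oB A x \oB D) (C \oB B \oB D).
Proof. by move=> hA h; apply: (hcvg_bop C); exact: hA. Qed.

Lemma sot_compr H K L (X : Type) (F : set_system X) {FF : Filter F}
    (A : X -> bop H K) B (D : bop L H) :
  sot_cvg F A B -> sot_cvg F (fun x => A x \oB D) (B \oB D).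
Proof. by move=> hA h; exact: hA. Qed.

Lemma sot_near H K (X : Type) (F : set_system X) {FF : Filter F}
    (A A' : X -> bop H K) B :
  (\forall x \near F, A x = A' x) -> sot_cvg F A B -> sot_cvg F A' B.
Proof.
move=> e hA h; apply: (hcvg_near_le (v := fun x => A x h) (m := B h)) (hA h).
by apply: filterS e => x ->.
Qed.

Lemma sot_ext H K (X : Type) (F : set_system X) {FF : Filter F}
    (A A' : X -> bop H K) B :
  (forall x, A' x = A x) -> sot_cvg F A B -> sot_cvg F A' B.
Proof. by move=> e; apply: sot_near; apply: nearW. Qed.

(** A WOT-neighbourhood tests finitely many pairs, and each test is eventually met by
    Cauchy-Schwarz; the induction runs over the list of pairs. *)
Lemma sot_wot_closed H K (S : set (bop H K)) (X : Type) (F : set_system X)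
    {FF : ProperFilter F} (A : X -> bop H K) B :
  wot_closed S -> (\forall x \near F, S (A x)) -> sot_cvg F A B -> S B.
Proof.
move=> cS SA hA; apply: cS => s e e0.
suff [x [Sx hx]] : exists x, S (A x) /\ forall p, p \in s ->
    complex.Re `|'[B p.1, p.2] - '[A x p.1, p.2]| < e by exists (A x).
apply: (@filter_ex _ F); elim: s => [|p s IH].
  by apply: filterS SA => x Sx; split=> // p; rewrite in_nil.
have p1 : 0 < hnorm p.2 + 1 by rewrite ltr_wpDl.
have /hcvgP /(_ _ (divr_gt0 e0 p1)) := hA p.1.
apply: filterS2 IH => x [Sx hx] hp; split=> // q; rewrite inE => /orP[/eqP ->|/hx //].
rewrite -innerBl -[complex.Re _]/(cabs _); apply: le_lt_trans (cabs_inner_le _ _) _.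
rewrite hnormBC; move: hp; rewrite ltr_pdivlMr //; apply: le_lt_trans.
by rewrite ler_wpM2l // lerDl.
Qed.

Lemma commutant_wot_closed H (C : bop H H) : wot_closed [set A | A \oB C = C \oB A].
Proof.
move=> A hA /=; apply: bopP => x; apply: inner_ext => y; rewrite !compE [RHS]adjP.
apply/eqP; rewrite -subr_eq0; apply/eqP/cabs_eq0/eqP; rewrite eq_le cabs_ge0 andbT.
apply/ler_addgt0Pr => e e0; rewrite add0r; have e2 := divr_gt0 e0 (ltr0Sn R 1).
(* These two tests take equal values at any [B] commuting with [C], so the two values at [A] differ
   by at most [e]. *)
have [B BC hB] := hA [:: (C x, y); (x, adj C y)] _ e2.
have h1 := hB (C x, y) (mem_head _ _).
have h2 := hB (x, adj C y); rewrite !inE eqxx orbT in h2; have {}h2 := h2 isT.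
have -> : '[A (C x), y] - '[A x, adj C y] =
    ('[A (C x), y] - '[B (C x), y]) - ('[A x, adj C y] - '[B x, adj C y]).
  have -> : '[B x, adj C y] = '[B (C x), y].
    by rewrite -adjP -!compE; have -> : B \oB C = C \oB B.
  by rewrite opprB addrA subrK.
apply: le_trans (cabsD _ _) _; rewrite cabsN [leRHS]splitr.
by apply: lerD; apply: ltW.
Qed.

Lemma commutant_subalgebra H (C : bop H H) : subalgebra [set A | A \oB C = C \oB A].
Proof.
split=> [|A B /= hA hB]; last by rewrite -compA hB compA hA compA.
split=> [|a A B /= hA hB]; apply: bopP => x; rewrite !compE ?bop0E ?bop0 //.
rewrite !bopDE !bopZE bopD bopZ -!compE hA hB.
by [].
Qed.
End Limits.

(** * Left and right shifts on the Fock space *)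

HB.lock Definition shift (R : realType) (n : nat) (phi : 'I_n -> seq 'I_n -> seq 'I_n)
    (phiI : forall i, injective (phi i)) (i : 'I_n) : bop (fock R n) (fock R n) :=
  adj (pullback (scalar_hilbert R) (@phiI i)).
Arguments shift R {n phi} phiI i.

Section Fock.
Variables (R : realType) (n : nat).
Local Notation E := (fock R n).
Local Notation K := (scalar_hilbert R).
Local Notation W := (seq 'I_n).
Local Notation e_ := (@fock_basis R n).
Local Notation S_ := (@creation R n).
Implicit Types f g : E.

Lemma fock_deltaE (w : W) (h : K) : l2_delta w h = (h : R[i]) *: e_ w :> E.
Proof.
apply: l2P => v; rewrite l2ZE !l2_deltaE; case: eqP => _; last by rewrite scaler0.
by rewrite /GRing.scale /= mulr1.
Qed.

Lemma fock_eq (L : hilbert R) (A B : bop E L) : (forall w, A (e_ w) = B (e_ w)) -> A = B.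
Proof. by move=> h; apply: bop_delta_eq => w k; rewrite fock_deltaE !bopZ h. Qed.

Lemma fock_coord (f : E) w : '[f, e_ w] = f w.
Proof. by rewrite l2_inner_delta /inner /= /scalar_dot conjC1 mulr1. Qed.

Lemma fock_total : hclosure (lspan (range e_)) = setT.
Proof.
apply: dense_of_orth => x hx; apply: l2P => w; rewrite -fock_coord.
by apply: hx; exists w.
Qed.

(* [phi] splits the nonempty words into disjoint copies of all words:
   [w |-> i :: w] for the left shifts and [w |-> rcons w i] for the right ones. *)
Section Shift.
Variable phi : 'I_n -> W -> W.
Hypothesis phiI : forall i, injective (phi i).
Hypothesis phi_disj : forall i j v w, phi i v = phi j w -> i = j.
Hypothesis phi_cover : forall w, w = [::] \/ exists i v, w = phi i v.
Hypothesis phi_neq0 : forall i v, phi i v <> [::].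

Local Notation shift := (shift R phiI).

Lemma shift_basis i w : shift i (e_ w) = e_ (phi i w).
Proof. rewrite unlock; exact: adj_pullback_delta. Qed.
Lemma adj_shiftE i f w : adj (shift i) f w = f (phi i w).
Proof. by rewrite unlock adjK pullbackE. Qed.
Lemma adj_shiftK i f : adj (shift i) (shift i f) = f.
Proof. by rewrite unlock adjK pullbackK. Qed.
Lemma adj_shift_basis i j w :
  adj (shift i) (e_ (phi j w)) = if i == j then e_ w else 0.
Proof.
have [->|ij] := eqVneq i j; first by rewrite -shift_basis adj_shiftK.
apply: l2P => v; rewrite adj_shiftE l2_deltaE; case: eqP => // /phi_disj h.
by rewrite h eqxx in ij.
Qed.
Lemma adj_shift_basis0 i : adj (shift i) (e_ [::]) = 0.
Proof. by apply: l2P => v; rewrite adj_shiftE l2_deltaE; case: eqP => // /phi_neq0. Qed.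

Lemma shift_ortho i j f : i != j -> adj (shift i) (shift j f) = 0.
Proof.
move=> ij; rewrite -[LHS]/((adj (shift i) \oB shift j) f) -[0]/((0 : bop E E) f).
congr (bop_fun _ f); apply: fock_eq => w.
by rewrite compE shift_basis adj_shift_basis (negPf ij).
Qed.

(** This is [I = P_0 + sum_i S_i S_i^*], with [P_0] the projection on the vacuum, checked on basis
    vectors. *)
Lemma shift_decomp f : f = (f [::] : R[i]) *: e_ [::] + \sum_i shift i (adj (shift i) f).
Proof.
pose P : bop E E := delta_bop K [::] \oB adj (delta_bop K [::]) + \sum_i shift i \oB adj (shift i).
suff E1 : P = id_bop E.
  rewrite -[LHS](id_bopE f) -E1 bopDE bop_sumE compE adj_deltaE delta_bopE.
  by rewrite fock_deltaE.
apply: fock_eq => w; rewrite bopDE bop_sumE compE adj_deltaE delta_bopE l2_deltaE id_bopE.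
have [->|[j [v ->]]] := phi_cover w.
  by rewrite eqxx big1 ?addr0 // => i _; rewrite compE adj_shift_basis0 bop0.
case: eqP => [/esym /phi_neq0 //|_].
rewrite -[l2_delta _ 0]/(delta_bop _ _ _) bop0 add0r (bigD1 j) //= big1 => [|i ij].
  by rewrite addr0 adj_shift_basis eqxx shift_basis.
by rewrite adj_shift_basis (negPf ij) bop0.
Qed.

Lemma shift_inner f g :
  '[f, g] = (f [::] : R[i]) * (g [::] : R[i])^* + \sum_i '[adj (shift i) f, adj (shift i) g].
Proof.
rewrite {1}[f]shift_decomp innerDl innerZl inner_suml; congr (_ * _ + _).
  by rewrite innerC fock_coord.
by apply: eq_bigr => i _; rewrite adjP.
Qed.

Lemma shift_hnorm f :
  hnorm f ^+ 2 = cabs (f [::]) ^+ 2 + \sum_i hnorm (adj (shift i) f) ^+ 2.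
Proof.
rewrite -Re_innerxx shift_inner mul_conj_cabs ReD raddf_sum /=; congr (_ + _).
by apply: eq_bigr => i _; exact: Re_innerxx.
Qed.

Lemma shift_row_contraction : row_contraction shift.
Proof. by apply/row_contractionP => f; rewrite [leRHS]shift_hnorm lerDr sqr_ge0. Qed.
End Shift.

Lemma consI i : injective (cons i : W -> W). Proof. by move=> v w []. Qed.
Lemma cons_disj (i j : 'I_n) (v w : W) : i :: v = j :: w -> i = j. Proof. by case. Qed.
Lemma cons_cover (w : W) : w = [::] \/ exists i v, w = i :: v.
Proof. by case: w => [|i v]; [left|right; exists i, v]. Qed.
Lemma cons_neq0 (i : 'I_n) (v : W) : i :: v <> [::]. Proof. by []. Qed.

Definition snoc (i : 'I_n) (w : W) : W := rcons w i.
Lemma snocI i : injective (snoc i). Proof. exact: rcons_injl. Qed.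
Lemma snoc_disj (i j : 'I_n) (v w : W) : snoc i v = snoc j w -> i = j.
Proof. by move=> /rcons_inj[]. Qed.
Lemma snoc_cover (w : W) : w = [::] \/ exists i v, w = snoc i v.
Proof. by case/lastP: w => [|v i]; [left|right; exists i, v]. Qed.
Lemma snoc_neq0 (i : 'I_n) (v : W) : snoc i v <> [::]. Proof. by case: v. Qed.

Lemma creationE i : S_ i = shift R consI i.
Proof. by apply: fock_eq => w; rewrite creation_basis shift_basis. Qed.

Lemma creation_row_contraction : row_contraction S_.
Proof.
have -> : S_ = shift R consI by apply/funext => i; exact: creationE.
apply: shift_row_contraction; [exact: cons_disj|exact: cons_cover|exact: cons_neq0].
Qed.

Definition rcreation : 'I_n -> bop E E := shift R snocI.

Lemma rcreation_basis i w : rcreation i (e_ w) = e_ (rcons w i).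
Proof. exact: shift_basis. Qed.

Lemma creation_rcreation i j : S_ i \oB rcreation j = rcreation j \oB S_ i.
Proof.
by apply: fock_eq => w; rewrite !compE rcreation_basis !creation_basis rcreation_basis.
Qed.

(** It coincides with [Finf], by [Finf_rcommutant] and [rcommutant_Finf]; as a commutation condition
    it is what the lifting theorem delivers. *)
Definition rcommutant : set (bop E E) :=
  [set f | forall i, f \oB rcreation i = rcreation i \oB f].

Lemma Finf_rcommutant : Finf (R := R) (n := n) `<=` rcommutant.
Proof.
move=> f hf i; apply: (hf [set f | f \oB rcreation i = rcreation i \oB f]); [|exact: commutant_subalgebra|exact: commutant_wot_closed].
by move=> _ [[j _ <-]|->] /=; [exact: creation_rcreation|rewrite comp_id id_comp].
Qed.

Lemma Finf_id : Finf (id_bop E).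
Proof. by move=> S hS _ _; apply: hS; right. Qed.
Lemma Finf_creation i : Finf (S_ i).
Proof. by move=> S hS _ _; apply: hS; left; exists i. Qed.

End Fock.

Lemma cat_inj (n : nat) (a : seq 'I_n) : injective (cat^~ a).
Proof.
move=> v w /(congr1 rev); rewrite !rev_cat => /eqP; rewrite eqseq_cat //.
by move=> /andP[_ /eqP /(can_inj revK)].
Qed.

(* Right multiplication [x |-> x (x) e_a]. *)
HB.lock Definition rmul (R : realType) (n : nat) (a : seq 'I_n) :
    bop (fock R n) (fock R n) :=
  adj (pullback (scalar_hilbert R) (@cat_inj n a)).
Arguments rmul {R n} a.

(** * Taylor sums at a row contraction *)

Section Taylor.
Variables (R : realType) (n : nat).
Local Notation E := (fock R n).
Local Notation K := (scalar_hilbert R).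
Local Notation W := (seq 'I_n).
Local Notation e_ := (@fock_basis R n).
Local Notation S_ := (@creation R n).
Local Notation Re := complex.Re.
Implicit Types (f g : bop E E) (x : E).

Definition taylor (H : hilbert R) (T : 'I_n -> bop H H) f (r : R) (m : nat) : bop H H :=
  \sum_(k < m) \sum_(w : k.-tuple 'I_n) ((r ^+ k)%:C%C * fcoef f w) *: word_bop T w.

Lemma scalar_hnorm (a : K) : hnorm a = cabs (a : R[i]).
Proof. exact: scalar_dnorm. Qed.

Lemma level_sqr_le k x :
  \sum_(w : k.-tuple 'I_n) cabs (x w : R[i]) ^+ 2 <= hnorm x ^+ 2.
Proof.
have uF : uniq [seq val t | t <- enum {:k.-tuple 'I_n}].
  by rewrite map_inj_uniq ?enum_uniq //; exact: val_inj.
apply: le_trans (l2_partial_le x uF); rewrite big_map big_enum /=.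
by apply: ler_sum => w _; rewrite scalar_hnorm.
Qed.

(** The operators [T_w] with [|w| = k] again form a row contraction. With [y] the value at [h],
    [|y|^2] is a sum of pairings of [a_w h] with [T_w^* y]; the inequality
    [2 Re <u, v> <= |u|^2 + |v|^2] and [row_tail_le] then absorb one copy of [|y|^2]. *)
Lemma level_bounded (H : hilbert R) (T : 'I_n -> bop H H) k (a : W -> R[i]) c :
  row_contraction T -> 0 <= c -> \sum_(w : k.-tuple 'I_n) cabs (a w) ^+ 2 <= c ^+ 2 ->
  bounded_by (\sum_(w : k.-tuple 'I_n) a w *: word_bop T w) c.
Proof.
move=> hT c0 ac; split=> // h; set y := bop_fun _ h.
rewrite -(@ler_pXn2r _ 2) ?nnegrE ?mulr_ge0 //.
have yE : y = \sum_(w : k.-tuple 'I_n) a w *: word_bop T w h.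
  by rewrite /y bop_sumE; apply: eq_bigr => w _; rewrite bopZE.
have h1 : hnorm y ^+ 2 = \sum_(w : k.-tuple 'I_n) Re '[a w *: h, adj (word_bop T w) y].
  rewrite -Re_innerxx {1}yE inner_suml raddf_sum; apply: eq_bigr => w _ /=.
  by rewrite -bopZ adjP.
have h2 : 2 * hnorm y ^+ 2 <= c ^+ 2 * hnorm h ^+ 2 + hnorm y ^+ 2.
  apply: le_trans (_ : \sum_(w : k.-tuple 'I_n) (cabs (a w) ^+ 2 * hnorm h ^+ 2 +
     hnorm (adj (word_bop T w) y) ^+ 2) <= _).
    rewrite {1}h1 mulr_sumr; apply: ler_sum => w _.
    have := sqr_ge0 (hnorm (a w *: h - adj (word_bop T w) y)).
    by rewrite hnormD_sqr hnormN innerNr raddfN /= hnormZ exprMn; lra.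
  rewrite big_split /= -mulr_suml; apply: lerD.
    by apply: ler_wpM2r => //; exact: sqr_ge0.
  by rewrite -row_tailE row_tail_le.
by rewrite exprMn; lra.
Qed.

Lemma taylorS (H : hilbert R) (T : 'I_n -> bop H H) f r m :
  taylor T f r m.+1 = taylor T f r m +
    \sum_(w : m.-tuple 'I_n) ((r ^+ m)%:C%C * fcoef f w) *: word_bop T w.
Proof. by rewrite /taylor big_ord_recr. Qed.

(** Degree [k] contributes at most [r^k |f 1|], and the second factor is the geometric sum over
    [i <= k < j]. *)
Lemma taylor_sub_bounded (H : hilbert R) (T : 'I_n -> bop H H) f r i j :
  row_contraction T -> 0 < r < 1 -> (i <= j)%N ->
  bounded_by (taylor T f r j - taylor T f r i)
    (hnorm (f (e_ [::])) * ((r ^+ i - r ^+ j) / (1 - r))).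
Proof.
move=> hT /andP[r0 r1]; set c := hnorm _.
have z0 : bounded_by (0 : bop H H) 0 by split=> // x; rewrite bop0E hnorm0 mul0r.
elim: j => [|j IH]; first by rewrite leqn0 => /eqP ->; rewrite !subrr mul0r mulr0.
rewrite leq_eqVlt ltnS => /orP[/eqP ->|/IH h]; first by rewrite !subrr mul0r mulr0.
have hl : bounded_by (\sum_(w : j.-tuple 'I_n) ((r ^+ j)%:C%C * fcoef f w) *: word_bop T w) (c * r ^+ j).
  apply: (level_bounded (a := fun w => (r ^+ j)%:C%C * fcoef f w)) => //.
    by rewrite mulr_ge0 ?exprn_ge0 // ?(ltW r0) // hnorm_ge0.
  under eq_bigr do rewrite cabsM exprMn cabsR ?exprn_ge0 ?(ltW r0) //.
  by rewrite -mulr_sumr exprMn mulrC ler_wpM2r ?sqr_ge0 // level_sqr_le.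
have := add_bounded h hl; rewrite taylorS [X in bounded_by X]addrAC.
congr (bounded_by _ _); rewrite exprS.
have : 1 - r != 0 by rewrite subr_eq0 eq_sym lt_eqF.
by move=> ?; field.
Qed.

Lemma taylor_cvg (H : hilbert R) (T : 'I_n -> bop H H) f r :
  row_contraction T -> 0 < r < 1 -> exists A, sot_cvg \oo (taylor T f r) A.
Proof.
move=> hT hr; have /andP[r0 r1] := hr; set c := hnorm (f (e_ [::])).
have q0 : 0 < 1 - r by rewrite subr_gt0.
have hb i j : (i <= j)%N -> bounded_by (taylor T f r j - taylor T f r i) (c / (1 - r) * r ^+ i).
  move=> ij; apply: bounded_widen (taylor_sub_bounded f hT hr ij) _.
  rewrite -/c -mulrA ler_wpM2l // ?hnorm_ge0 // mulrC ler_wpM2l ?invr_ge0 ?(ltW q0) //.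
  by rewrite gerBl exprn_ge0 // ltW.
have [A _ hA] : exists2 A, bounded_by A (c / (1 - r) * r ^+ 0) & sot_cvg \oo (taylor T f r) A.
  apply: sot_limit => [k|x e e0].
    by have := hb 0%N k (leq0n k); rewrite {2}/taylor big_ord0 subr0.
  pose b := c / (1 - r) * hnorm x.
  have b0 : 0 <= b by rewrite mulr_ge0 ?divr_ge0 ?(ltW q0) // hnorm_ge0.
  have b1 : 0 < b + 1 by rewrite ltr_wpDl.
  have rn : `|r| < 1 by rewrite ger0_norm // ltW.
  have [N _ /(_ N (leqnn _)) /=] := (cvgrPdist_lt _ _).1 (cvg_expr rn) _ (divr_gt0 e0 b1).
  rewrite sub0r normrN ger0_norm ?exprn_ge0 ?(ltW r0) // ltr_pdivlMr // => hN.
  have key i j : (N <= i)%N -> (i <= j)%N -> hnorm (taylor T f r j x - taylor T f r i x) < e.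
    move=> Ni ij; have [_ /(_ x) h] := hb _ _ ij; apply: le_lt_trans h _.
    apply: le_lt_trans hN; rewrite mulrAC -/b mulrC ler_pM ?exprn_ge0 ?(ltW r0) ?lerDl //.
    by rewrite ler_wiXn2l ?(ltW r0) ?(ltW r1).
  exists N => i j Ni Nj; have [ij|/ltnW ji] := leqP i j; last exact: key.
  by rewrite -[dnorm _ _]/(hnorm (taylor T f r i x - taylor T f r j x)) hnormBC; exact: key.
by exists A.
Qed.

Lemma rmul_basis a w : rmul a (e_ w) = e_ (w ++ a).
Proof. rewrite unlock; exact: adj_pullback_delta. Qed.

Lemma rcommutant_rmul f a : rcommutant f -> f \oB rmul a = rmul a \oB f.
Proof.
move=> hf; elim/last_ind: a => [|a i IH].
  have -> : rmul [::] = id_bop E by apply: fock_eq => w; rewrite rmul_basis cats0.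
  by rewrite comp_id id_comp.
have -> : rmul (rcons a i) = rcreation R i \oB rmul a.
  by apply: fock_eq => w; rewrite compE !rmul_basis rcreation_basis rcons_cat.
by rewrite compA hf -compA IH compA.
Qed.

(** [e_a] is the vacuum multiplied on the right by [e_a]; hence [f] is determined by the vector
    [f 1], that is by its coefficients. *)
Lemma rcommutant_basis f a : rcommutant f -> f (e_ a) = rmul a (f (e_ [::])).
Proof.
move=> hf; rewrite -[in LHS](cat0s a) -rmul_basis.
by rewrite -!compE rcommutant_rmul.
Qed.

(** Degree [k] is multiplied by [r^k], which turns [f 1] into the value of [f(r S)] at the vacuum.
    The condition on [r] sits under the existential so that one function of [r] can be chosen and
    its limit taken. *)
Lemma dilation_exists (r : R) : exists D : bop E E,
  0 <= r <= 1 -> bounded_by D 1 /\ forall x w, D x w = (r ^+ size w)%:C%C *: x w.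
Proof.
have [hr|nr] := pselect (0 <= r <= 1); last by exists 0.
have /andP[r0 r1] := hr.
have ex x : exists y : E, (forall w, y w = (r ^+ size w)%:C%C *: x w) /\ hnorm y <= hnorm x.
  have [//||y yE yB] := @l2_build R _ K (fun w => (r ^+ size w)%:C%C *: x w) (hnorm x).
    move=> F uF; apply: le_trans (l2_partial_le x uF); apply: ler_sum => w _.
    rewrite hnormZ cabsR ?exprn_ge0 // exprMn ler_piMl ?sqr_ge0 //.
    by rewrite -exprM exprn_ile1.
  by exists y.
have [D hD] := boolp.choice ex.
have lD : linear D.
  move=> a x y; apply: l2P => w; rewrite l2E !(proj1 (hD _)) l2E scalerDr !scalerA.
  by rewrite mulrC.
have bD x : hnorm (D x) <= 1 * hnorm x by rewrite mul1r; case: (hD x).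
have [B hB] := bop_build lD bD; exists B => _; split; first by split=> // x; rewrite hB.
by move=> x w; rewrite hB (proj1 (hD _)).
Qed.
Lemma dilation_sig (r : R) : {D : bop E E |
  0 <= r <= 1 -> bounded_by D 1 /\ forall x w, D x w = (r ^+ size w)%:C%C *: x w}.
Proof. exact: cid (dilation_exists r). Qed.
Definition dilation r : bop E E := sval (dilation_sig r).
Lemma dilationE r x w : 0 <= r <= 1 -> dilation r x w = (r ^+ size w)%:C%C *: x w.
Proof. by rewrite /dilation; case: dilation_sig => D hD /= /hD[]. Qed.
Lemma dilation_bounded r : 0 <= r <= 1 -> bounded_by (dilation r) 1.
Proof. by rewrite /dilation; case: dilation_sig => D hD /= /hD[]. Qed.

Lemma dilation1 : dilation 1 = id_bop E.
Proof.
apply: bopP => x; apply: l2P => w; rewrite dilationE ?lexx ?ler01 // expr1n.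
exact: scale1r.
Qed.

Lemma near_left1 : \forall r \near (1 : R)^'-, 0 < r < 1.
Proof.
by near=> r; apply/andP; split; near: r; [exact: nbhs_left_gt|exact: nbhs_left_lt].
Unshelve. all: by end_near. Qed.

Lemma dilation_cvg : sot_cvg (1 : R)^'- dilation (id_bop E).
Proof.
apply: (sot_dense (M := 1) (@fock_total R n)).
  by apply: filterS near_left1 => r /andP[r0 r1]; apply: dilation_bounded; rewrite !ltW.
move=> _ [w _ <-]; rewrite id_bopE; apply/hcvgP => e e0.
have h : r ^+ size w @[r --> (1 : R)^'-] --> (1 : R).
  have := @exprn_continuous R (size w) 1; rewrite /continuous_at expr1n.
  exact: cvg_at_left_filter.
apply: filterS2 near_left1 ((cvgrPdist_lt _ _).1 h _ e0) => r /andP[r0 r1] hr.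
have -> : dilation r (e_ w) - e_ w = ((r ^+ size w - 1)%:C%C : R[i]) *: e_ w.
  apply: l2P => v; rewrite l2BE l2ZE dilationE ?ltW //.
  rewrite l2_deltaE; case: eqP => [->|_]; last by rewrite !scaler0 subr0.
  by rewrite rmorphB scalerBl scale1r.
have c1 : cabs (1 : R[i]) = 1 by rewrite /cabs normr1.
rewrite hnormZ l2_delta_hnorm scalar_hnorm c1 mulr1.
rewrite -cabsN -rmorphN opprB cabsR; last by rewrite subr_ge0 exprn_ile1 // ltW.
by apply: le_lt_trans hr; rewrite ler_norm.
Qed.

Lemma word_creation_basis w v : word_bop S_ w (e_ v) = e_ (w ++ v).
Proof.
elim: w => // i w IH; rewrite -[word_bop _ _]/(S_ i \oB word_bop S_ w).
by rewrite compE IH creation_basis.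
Qed.

Lemma taylor_creation_basis f r m a :
  taylor S_ f r m (e_ a) =
  rmul a (\sum_(w <- words_lt n m) ((r ^+ size w)%:C%C * fcoef f w) *: e_ w).
Proof.
rewrite big_words_lt !bop_sum bop_sumE; apply: eq_bigr => k _.
rewrite bop_sumE bop_sum; apply: eq_bigr => w _.
by rewrite bopZE bopZ rmul_basis word_creation_basis size_tuple.
Qed.

(** At [e_a] the Taylor sums are right translates of the partial sums of the dilated vector, so they
    converge as its basis expansion does. *)
Lemma taylor_creation_cvg f r a : 0 <= r <= 1 ->
  hcvg \oo (fun m => taylor S_ f r m (e_ a)) (rmul a (dilation r (f (e_ [::])))).
Proof.
move=> hr; set y := dilation r _.
have -> : (fun m => taylor S_ f r m (e_ a)) =
    (fun m => rmul a (\sum_(w <- words_lt n m) l2_delta w (y w))).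
  apply/funext => m; rewrite taylor_creation_basis; congr (rmul a _).
  apply: eq_bigr => w _; rewrite fock_deltaE; congr (_ *: _).
  by rewrite /y dilationE.
apply: hcvg_bop; apply/hcvg_seqP => e /(l2_delta_sum y)[F hF].
have [N sN] := sub_words_lt F; exists N => m Nm.
apply: hF; first exact: words_lt_uniq.
move=> w /sN; rewrite !mem_words_lt => h; exact: leq_trans h Nm.
Qed.

Lemma word_bop_adj_poisson (H : hilbert R) (T : 'I_n -> bop H H) w x h :
  row_contraction T ->
  adj (poisson T) (l2_tens (word_bop S_ w x) h) = word_bop T w (adj (poisson T) (l2_tens x h)).
Proof.
move=> hT; set V := adj (poisson T); pose tP := l2_tensP (seq 'I_n) H.
rewrite -(amplE tP) -!compE.
congr (bop_fun _ _); apply: bop_delta_eq => v k; rewrite !compE -tens_fock_basis.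
rewrite (amplE tP).
by rewrite word_creation_basis !tens_fock_basis !adj_poisson_delta // word_bop_cat.
Qed.

Lemma taylor_adj_poisson (H : hilbert R) (T : 'I_n -> bop H H) f r m x h :
  row_contraction T ->
  adj (poisson T) (l2_tens (taylor S_ f r m x) h) =
  taylor T f r m (adj (poisson T) (l2_tens x h)).
Proof.
move=> hT; pose tP := l2_tensP (seq 'I_n) H.
have tens_sum (I : Type) (s : seq I) (P : pred I) (u : I -> E) :
    l2_tens (\sum_(i <- s | P i) u i) h = \sum_(i <- s | P i) l2_tens (u i) h.
  elim/big_ind2: _ => [|a b c d <- <-|//]; [exact: (tensor0l tP)|exact: (tensorDl tP)].
rewrite bop_sumE tens_sum bop_sum [RHS]bop_sumE; apply: eq_bigr => k _.
rewrite bop_sumE tens_sum bop_sum [RHS]bop_sumE; apply: eq_bigr => w _.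
by rewrite !bopZE (tensorZl tP) bopZ word_bop_adj_poisson.
Qed.

Lemma word_bop_scale (H : hilbert R) (T : 'I_n -> bop H H) (a : R[i]) w :
  word_bop (fun i => a *: T i) w = a ^+ size w *: word_bop T w.
Proof.
elim: w => [|i w IH] /=; first by rewrite expr0 scale1r.
by rewrite IH; apply: bopP => x; rewrite !(compE, bopZE, bopZ) scalerA exprS.
Qed.

Lemma taylor_scale (H : hilbert R) (T : 'I_n -> bop H H) f r m :
  taylor T f r m = taylor (fun i => r%:C%C *: T i) f 1 m.
Proof.
apply: eq_bigr => k _; apply: eq_bigr => w _.
by rewrite word_bop_scale size_tuple scalerA expr1n mul1r rmorphXn mulrC.
Qed.

(** The tail of order [k] acquires the factor [r^(2 k)], so [r T] is pure for every row contraction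
    [T] and its Poisson kernel is an isometry. *)
Lemma scale_row (H : hilbert R) (T : 'I_n -> bop H H) r : 0 < r < 1 -> row_contraction T ->
  row_contraction (fun i => r%:C%C *: T i) /\ row_pure (fun i => r%:C%C *: T i).
Proof.
move=> hr hT; have /andP[r0 r1] := hr.
have tl k h : row_tail (fun i => r%:C%C *: T i) k h = r ^+ k ^+ 2 * row_tail T k h.
  rewrite !row_tailE mulr_sumr; apply: eq_bigr => w _.
  rewrite word_bop_scale adjZ bopZE hnormZ cabsJ -rmorphXn cabsR ?exprn_ge0 ?(ltW r0) //.
  by rewrite exprMn size_tuple.
have hT' : row_contraction (fun i => r%:C%C *: T i).
  apply/row_contractionP => h; have := tl 1%N h; rewrite /= => ->.
  apply: le_trans (row_tail_le 1 h hT); rewrite ler_piMl //; first exact: (row_tail_ge0 T 1 h).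
  by rewrite -exprM exprn_ile1 // ltW.
split=> // h; apply/cvgrPdist_lt => e e0.
have h1 : 0 < hnorm h ^+ 2 + 1 by rewrite ltr_wpDl // sqr_ge0.
have rn : `|r| < 1 by rewrite ger0_norm // ltW.
have [N _ hN] := (cvgrPdist_lt _ _).1 (cvg_expr rn) _ (divr_gt0 e0 h1).
exists N => // k /hN /=; rewrite !sub0r !normrN !ger0_norm ?row_tail_ge0 ?exprn_ge0 ?(ltW r0) //.
rewrite ltr_pdivlMr // => hk; apply: le_lt_trans hk; rewrite tl.
apply: ler_pM; rewrite ?exprn_ge0 ?(ltW r0) ?row_tail_ge0 //.
  by rewrite expr2 ler_piMl ?exprn_ge0 ?(ltW r0) ?exprn_ile1 ?(ltW r0) ?(ltW r1).
by apply: le_trans (row_tail_le k h hT) _; rewrite lerDl.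
Qed.
End Taylor.

Section FunctionalCalculus.
Variables (R : realType) (n : nat).
Local Notation E := (fock R n).
Local Notation e_ := (@fock_basis R n).
Local Notation S_ := (@creation R n).
Implicit Types (f g : bop E E) (x : E).

Lemma hcvg_near_eq (H : hilbert R) (X : Type) (F : set_system X) {FF : Filter F}
  (u v : X -> H) l : (\forall t \near F, u t = v t) -> hcvg F v l -> hcvg F u l.
Proof. by move=> e; apply: hcvg_near_le; apply: filterS e => t ->. Qed.

Lemma tensl_exists (G H L : hilbert R) (tau : G -> H -> L) h :
  hilbert_tensor tau -> exists B : bop G L, forall x : G, B x = tau x h.
Proof.
move=> tP.
have tL : linear (tau^~ h) by exact: (tensor_linearl tP).
have tB (x : G) : hnorm (tau x h) <= hnorm h * hnorm x.
  rewrite -(@ler_pXn2r _ 2) ?nnegrE ?mulr_ge0 // exprMn mulrC.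
  by rewrite -Re_innerxx (tensor_inner tP) !inner_hnorm -rmorphM.
by have [B hB] := bop_build tL tB; exists B.
Qed.

Lemma hcvg_tensl (G H L : hilbert R) (tau : G -> H -> L) (X : Type) (F : set_system X)
    {FF : Filter F} (u : X -> G) l h :
  hilbert_tensor tau -> hcvg F u l -> hcvg F (fun t => tau (u t) h) (tau l h).
Proof.
move=> tP ul; have [B hB] := tensl_exists h tP.
have -> : (fun t => tau (u t) h) = (fun t => B (u t)) by apply/funext => t; rewrite hB.
by rewrite -hB; exact: hcvg_bop.
Qed.

Section Rows.
Variables (H : hilbert R) (T : 'I_n -> bop H H).
Hypothesis hT : row_contraction T.
Let tP := l2_tensP (seq 'I_n) H.

(** [K^*] carries the Taylor sums of the shifts to those of [T], where the limit is known on basis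
    vectors. The value [r = 1] serves for von Neumann's inequality, [r < 1] for the radial limit. *)
Lemma taylor_poisson_cvg f r a h A : 0 <= r <= 1 -> sot_cvg \oo (taylor T f r) A ->
  A (adj (poisson T) (l2_delta a h)) =
  adj (poisson T) (l2_tens (rmul a (dilation n r (f (e_ [::])))) h).
Proof.
move=> hr hA; apply: (hcvg_unique (hA _)).
have -> : (fun m => taylor T f r m (adj (poisson T) (l2_delta a h))) =
    (fun m => adj (poisson T) (l2_tens (taylor S_ f r m (e_ a)) h)).
  by apply/funext => m; rewrite taylor_adj_poisson // tens_fock_basis.
by apply: hcvg_bop; apply: (hcvg_tensl _ tP); exact: taylor_creation_cvg.
Qed.

Lemma poisson_bounded : row_pure T -> bounded_by (poisson T) 1.
Proof. by move=> hP; split=> // h; rewrite mul1r poisson_isometry. Qed.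
End Rows.

(** The Taylor series at [T] with radius [r] is the one at [r T] with radius [1]. The Poisson kernel
    [V] of [r T] is an isometry, so [f(r T) = V^* (f (x) I) V] inherits the bound of [f]. *)
Lemma von_neumann (H : hilbert R) (T : 'I_n -> bop H H) f r A M :
  row_contraction T -> 0 < r < 1 -> rcommutant f -> bounded_by f M ->
  sot_cvg \oo (taylor T f r) A -> bounded_by A M.
Proof.
move=> hT hr hf bf hA; have [hT' hP'] := scale_row hr hT.
set T' := fun i => _ in hT' hP'; set V := poisson T'.
have hA' : sot_cvg \oo (taylor T' f 1) A.
  by apply: sot_ext hA => m; rewrite [RHS]taylor_scale.
have AV : A \oB adj V = adj V \oB ampl (@l2_tens R (seq 'I_n) H) f.
  apply: bop_delta_eq => a h; rewrite !compE -[in RHS]tens_fock_basis.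
  rewrite (amplE (l2_tensP _ H)) (rcommutant_basis _ hf).
  rewrite (taylor_poisson_cvg hT' a h _ hA') ?ler01 ?lexx //.
  by rewrite dilation1 id_bopE.
have bV := poisson_bounded hT' hP'.
have -> : A = adj V \oB ampl (@l2_tens R (seq 'I_n) H) f \oB V.
  by rewrite -AV -compA adj_poisson_poisson // comp_id.
rewrite -[M]mul1r -[1 * M]mulr1; exact: (comp_bounded (comp_bounded (adj_bounded bV)
  (ampl_bounded (l2_tensP _ H) bf)) bV).
Qed.

Lemma is_fcalc_unique (H : hilbert R) (T : 'I_n -> bop H H) f A B :
  is_fcalc T f A -> is_fcalc T f B -> A = B.
Proof.
move=> [fr [h1 h2]] [gr [k1 k2]]; apply: (sot_unique h2).
apply: sot_near k2; apply: filterS (near_left1 R) => r hr.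
exact: (sot_unique (k1 r hr) (h1 r hr)).
Qed.

Lemma fcalcE (H : hilbert R) (T : 'I_n -> bop H H) f A : is_fcalc T f A -> fcalc T f = A.
Proof.
move=> hA; apply: (is_fcalc_unique _ (hA)).
exact: (@xgetPex _ 0 (is_fcalc T f) (ex_intro _ A hA)).
Qed.

Lemma taylor_limits (H : hilbert R) (T : 'I_n -> bop H H) f : row_contraction T ->
  exists fr : R -> bop H H, forall r, 0 < r < 1 -> sot_cvg \oo (taylor T f r) (fr r).
Proof.
move=> hT; suff /boolp.choice[fr hfr] : forall r : R, exists A : bop H H, 0 < r < 1 ->
    sot_cvg \oo (taylor T f r) A by exists fr.
move=> r; have [hr|nr] := pselect (0 < r < 1); last by exists 0.
by have [A hA] := taylor_cvg f hT hr; exists A.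
Qed.

(** On [e_a (x) h] the operators [f(r T) K^*] converge to [K^* (f (x) I)], and von Neumann's
    inequality extends this to all vectors. Composing with [K] gives [f(T)]; composing once more
    with [K^*] and comparing limits gives the intertwining. *)
Lemma is_fcalc_poisson (H : hilbert R) (T : 'I_n -> bop H H) f :
  row_contraction T -> row_pure T -> rcommutant f ->
  let V := poisson T in let F := ampl (@l2_tens R (seq 'I_n) H) f in
  is_fcalc T f (adj V \oB F \oB V) /\ adj V \oB F \oB V \oB adj V = adj V \oB F.
Proof.
move=> hT hP hf V F; have [M bf] := bounded_byP f; have tP := l2_tensP (seq 'I_n) H.
have [fr hfr] := taylor_limits f hT.
have c1 : sot_cvg (1 : R)^'- (fun r => fr r \oB adj V) (adj V \oB F).
  apply: (sot_dense (M := M * 1) (@l2_delta_total R _ H)).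
    apply: filterS (near_left1 R) => r hr; apply: comp_bounded.
      exact: von_neumann (hfr r hr).
    by apply: adj_bounded; exact: poisson_bounded.
  move=> _ [a [h ->]]; rewrite compE -[in X in hcvg _ _ (_ X)]tens_fock_basis (amplE tP).
  rewrite (rcommutant_basis _ hf).
  apply: (hcvg_near_eq (v := fun r => adj V (l2_tens (rmul a (dilation n r (f (e_ [::])))) h))).
    apply: filterS (near_left1 R) => r hr; rewrite compE.
    by apply: taylor_poisson_cvg (hfr r hr) => //; case/andP: hr => ? ?; rewrite !ltW.
  apply: hcvg_bop; apply: (hcvg_tensl _ tP); apply: hcvg_bop.
  exact: (dilation_cvg (f (e_ [::]))).
have c2 : sot_cvg (1 : R)^'- fr (adj V \oB F \oB V).
  apply: (sot_ext _ (sot_compr V c1)) => r.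
  by rewrite -compA adj_poisson_poisson // comp_id.
split; first by exists fr.
exact: (sot_unique (sot_compr (adj V) c2) c1).
Qed.

Lemma is_fcalc_creation f : rcommutant f -> is_fcalc S_ f f.
Proof.
move=> hf; have hS := @creation_row_contraction R n; have [M bf] := bounded_byP f.
have [fr hfr] := taylor_limits f hS; exists fr; split=> //.
apply: (sot_dense (M := M) (@fock_total R n)).
  by apply: filterS (near_left1 R) => r hr; exact: von_neumann (hfr r hr).
move=> _ [a _ <-]; rewrite (rcommutant_basis _ hf).
apply: (hcvg_near_eq (v := fun r => rmul a (dilation n r (f (e_ [::]))))).
  apply: filterS (near_left1 R) => r hr; apply: hcvg_unique (hfr r hr _) _.
  by apply: taylor_creation_cvg; case/andP: hr => ? ?; rewrite !ltW.
by apply: hcvg_bop; exact: (dilation_cvg (f (e_ [::]))).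
Qed.

(** [f] is an iterated strong limit of polynomials in the shifts, which belong to every algebra
    containing the generators. *)
Lemma rcommutant_Finf f : rcommutant f -> Finf f.
Proof.
move=> hf S hS [[S0 SL] SM] cS; have [fr [h1 h2]] := is_fcalc_creation hf.
have Sid : S (id_bop E) by apply: hS; right.
have SW w : S (word_bop S_ w).
  by elim: w => [|i w IH] //=; apply: SM => //; apply: hS; left; exists i.
have Ssum (I : Type) (s : seq I) (u : I -> bop E E) :
    (forall i, S (u i)) -> S (\sum_(i <- s) u i).
  move=> Su; apply: (big_ind S) => // A B SA SB.
  by rewrite -[A]scale1r; exact: SL.
apply: (sot_wot_closed cS _ h2); apply: filterS (near_left1 R) => r hr.
apply: (sot_wot_closed cS _ (h1 r hr)); apply: nearW => m.
apply: (Ssum) => k; apply: (Ssum) => w.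
by rewrite -[_ *: _]addr0; exact: SL.
Qed.

(** After taking adjoints this says that [A^*] maps [N] into itself. *)
Lemma coinvariant_proj (H : hilbert R) (N : hsubspace H) (A : bop H H) :
  (forall x : H, subspace_set N x -> subspace_set N (adj A x)) ->
  proj_bop N \oB A \oB incl_bop N \oB proj_bop N = proj_bop N \oB A.
Proof.
move=> hA; rewrite -[LHS]adjK -[RHS]adjK; congr (adj _).
rewrite !adj_comp adj_proj adj_incl; apply: bopP => x; rewrite !compE incl_projK //.
by apply: hA; exact: incl_in.
Qed.

Lemma compression_comp (H : hilbert R) (N : hsubspace H) (A B : bop H H) :
  (forall x : H, subspace_set N x -> subspace_set N (adj A x)) ->
  compression N A \oB compression N B = compression N (A \oB B).
Proof. by move=> hA; rewrite /compression !compA coinvariant_proj. Qed.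

(** Coinvariance makes compression multiplicative on words, so the Taylor sums at the compressed
    shifts are the compressed Taylor sums. No purity of the compressed tuple is involved. *)
Lemma is_fcalc_compression (N : hsubspace E) f :
  (forall i x, subspace_set N x -> subspace_set N (adj (S_ i) x)) -> rcommutant f ->
  is_fcalc (fun i => compression N (S_ i)) f (compression N f).
Proof.
move=> hN hf; have [fr [h1 h2]] := is_fcalc_creation hf.
have cw w : word_bop (fun i => compression N (S_ i)) w = compression N (word_bop S_ w).
  elim: w => [|i w IH] /=; first by rewrite /compression comp_id proj_incl_comp.
  by rewrite IH compression_comp // => x; exact: hN.
exists (fun r => compression N (fr r)); split=> [r hr|]; last exact: sot_comp.
apply: (sot_ext _ (sot_comp (proj_bop N) (incl_bop N) (h1 r hr))) => m.
apply: bopP => x; rewrite !compE !bop_sumE bop_sum.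
apply: eq_bigr => k _; rewrite !bop_sumE bop_sum; apply: eq_bigr => w _.
by rewrite !bopZE bopZ cw.
Qed.
End FunctionalCalculus.

(** * Commutant lifting *)

Section AbstractLifting.
Variables (R : realType) (n : nat) (E N : hilbert R).
Variables (r_ : 'I_n -> bop E E) (vac : bop E E) (V0 : bop N E) (C : 'I_n -> bop N N).
Variable X : bop N N.
Local Notation Ein := (l2_hilbert 'I_n.+1 E).
Local Notation Eout := (l2_hilbert bool E).
Hypothesis decomp : forall x, x = vac x + \sum_i r_ i (adj (r_ i) x).
Hypothesis decomp_hnorm : forall x,
  hnorm x ^+ 2 = hnorm (vac x) ^+ 2 + \sum_i hnorm (adj (r_ i) x) ^+ 2.
Hypothesis adj_sum : forall i x (y : 'I_n -> E),
  adj (r_ i) (vac x + \sum_j r_ j (y j)) = y i.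
Hypothesis vacK : forall x, vac (vac x) = vac x.
Hypothesis sum_hnorm : forall x (y : 'I_n -> E),
  hnorm (vac x + \sum_j r_ j (y j)) ^+ 2 = hnorm (vac x) ^+ 2 + \sum_j hnorm (y j) ^+ 2.
Hypothesis pure : row_pure r_.
Hypothesis hV : forall h, hnorm (V0 h) = hnorm h.
Hypothesis hVK : forall h, adj V0 (V0 h) = h.
Hypothesis aci : forall i h, V0 (adj (C i) h) = adj (r_ i) (V0 h).
Hypothesis hX : forall i, X \oB C i = C i \oB X.

(* A lurking isometry argument: with [Z = X^*] and [D^* D = M^2 - Z^* Z], the map
   [(D C_i^* h)_i (+) M vac h |-> D h (+) vac (Z h)] extends to a contraction [W],
   and the transfer function of the colligation [W] is the adjoint of the lifting.
   It is computed as the limit of [step^k (0, 0)], whose error on [N] is at most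
   [M^2 sum_(|w| = k) |r_w^* h|^2]. *)
Lemma abstract_commutant_lifting :
  exists2 f : bop E E, forall i, f \oB r_ i = r_ i \oB f & adj f \oB V0 = V0 \oB adj X.
Proof.
have [Z ZE] : exists Z, Z = adj X by exists (adj X).
have [M bZ] := bounded_byP Z; have [M0 _] := bZ.
have [D hD] := defect_exists bZ.
have RZ i h : adj (r_ i) (V0 (Z h)) = V0 (Z (adj (C i) h)).
  rewrite -(aci i (Z h)); congr (V0 _).
  by rewrite ZE -[LHS]compE -[RHS]compE -!adj_comp hX.
have Dn h : hnorm (D h) ^+ 2 + hnorm (Z h) ^+ 2 = M ^+ 2 * hnorm h ^+ 2.
  by have := hD h h; rewrite !inner_hnorm -rmorphM -rmorphD => /complexI.
(* Input of the colligation at [g] when the state is given by [s]: slot [0] holds [M vac g], slot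
   [i + 1] holds [s (r_i^* g)]. *)
pose pack (s : bop E E) : bop E Ein := delta_bop E ord0 \oB (M%:C%C *: vac) +
  \sum_i delta_bop E (lift ord0 i) \oB s \oB adj (r_ i).
have pack0 s g : pack s g ord0 = M%:C%C *: vac g.
  rewrite bopDE bop_sumE l2DE l2_sumE big1 ?addr0 => [|i _].
    by rewrite compE delta_bopE l2_deltaE eqxx bopZE.
  by rewrite !compE delta_bopE l2_deltaE.
have packS s g i : pack s g (lift ord0 i) = s (adj (r_ i) g).
  rewrite bopDE bop_sumE l2DE l2_sumE compE delta_bopE l2_deltaE eq_sym (negPf (neq_lift _ _)) add0r.
  rewrite (bigD1 i) // big1 => [|j ji]; rewrite !compE delta_bopE l2_deltaE.
    by rewrite eqxx /= addr0.
  by rewrite (inj_eq (@lift_inj _ _)) eq_sym (negPf ji).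
have packn s g : hnorm (pack s g) ^+ 2 =
    M ^+ 2 * hnorm (vac g) ^+ 2 + \sum_i hnorm (s (adj (r_ i) g)) ^+ 2.
  rewrite l2_fin_hnorm big_ord_recl pack0 hnormZ cabsR // exprMn; congr (_ + _).
  by apply: eq_bigr => i _; rewrite packS.
have packB s t g : pack s g - pack t g = pack (s - t) g - pack 0 g.
  apply: l2P => i; rewrite !l2BE; case: (unliftP ord0 i) => [j|] ->.
    by rewrite !packS bopBE bop0E subr0.
  by rewrite !pack0 !subrr.
have packBn s t g : hnorm (pack s g - pack t g) ^+ 2 =
    \sum_i hnorm ((s - t) (adj (r_ i) g)) ^+ 2.
  rewrite packB l2_fin_hnorm big_ord_recl l2BE !pack0 subrr hnorm0 expr0n add0r.
  by apply: eq_bigr => i _; rewrite l2BE !packS bop0E subr0.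
pose s0 := V0 \oB D \oB adj V0; pose Y0 := V0 \oB Z \oB adj V0.
pose pin h := pack s0 (V0 h).
pose pout : bop N Eout :=
  delta_bop E true \oB V0 \oB D + delta_bop E false \oB vac \oB V0 \oB Z.
have poutT h : pout h true = V0 (D h).
  by rewrite bopDE l2DE !compE !delta_bopE !l2_deltaE addr0.
have poutF h : pout h false = vac (V0 (Z h)).
  by rewrite bopDE l2DE !compE !delta_bopE !l2_deltaE add0r.
have s0E i h : s0 (adj (r_ i) (V0 h)) = V0 (D (adj (C i) h)).
  by rewrite -(aci i h) !compE hVK.
(* Both sides have the same norm: split [V0 h] and [V0 (Z h)] into vacuum and shift parts in the
   defect identity at [h], then use that identity again at each [C_i^* h]. *)
have iso h : hnorm (pout h) <= 1 * hnorm (pin h).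
  rewrite mul1r; apply: hnorm_sqr_le; rewrite packn.
  rewrite l2_fin_hnorm big_bool poutT poutF hV.
  have := decomp_hnorm (V0 h); have := decomp_hnorm (V0 (Z h)); rewrite !hV.
  have -> : \sum_i hnorm (adj (r_ i) (V0 (Z h))) ^+ 2 =
      \sum_i hnorm (Z (adj (C i) h)) ^+ 2.
    by apply: eq_bigr => i _; rewrite RZ hV.
  have -> : \sum_i hnorm (s0 (adj (r_ i) (V0 h))) ^+ 2 =
      M ^+ 2 * (\sum_i hnorm (adj (r_ i) (V0 h)) ^+ 2) -
      \sum_i hnorm (Z (adj (C i) h)) ^+ 2.
    rewrite mulr_sumr -sumrB; apply: eq_bigr => i _.
    by rewrite s0E -(aci i h) !hV -Dn addrK.
  move=> hz hh; have := Dn h; rewrite hz hh mulrDr.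
  move: (M ^+ 2 * hnorm (vac _) ^+ 2) (M ^+ 2 * (\sum_i _)) (\sum_i hnorm (Z _) ^+ 2).
  by move=> u v w E1 /=; lra.
have [W [_ bW] hW] : exists2 W : bop Ein Eout, bounded_by W 1 & forall h, W (pin h) = pout h.
  have [|||W bW hW] := @bop_extension R Ein Eout
      (fun x y => exists h, x = pin h /\ y = pout h) 1 ler01.
  - by exists 0; rewrite /pin !bop0.
  - move=> a x y x' y' [h [-> ->]] [h' [-> ->]]; exists (a *: h + h').
    by rewrite /pin !(bopD, bopZ).
  - by move=> x y [h [-> ->]].
  - by exists W => // h; apply: hW; exists h.
pose ev b : bop Eout E := adj (delta_bop E b).
(* A pair holds a state map and an output map. The recursion for the second component is chosen so
   that [r_i^*] applied to the new output is the old output after [r_i^*]. *)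
pose step (p : bop E E * bop E E) : bop E E * bop E E :=
  (ev true \oB W \oB pack p.1,
   vac \oB ev false \oB W \oB pack p.1 + \sum_i r_ i \oB p.2 \oB adj (r_ i)).
pose err (p q : bop E E * bop E E) (g : E) : R :=
  hnorm (p.1 g - q.1 g) ^+ 2 + hnorm (p.2 g - q.2 g) ^+ 2.
have step2 p g : (step p).2 g =
    vac (W (pack p.1 g) false) + \sum_i r_ i (p.2 (adj (r_ i) g)).
  rewrite bopDE bop_sumE !compE adj_deltaE; congr (_ + _).
have step1 p g : (step p).1 g = W (pack p.1 g) true by rewrite !compE adj_deltaE.
have evn (v : Eout) : hnorm (v true) ^+ 2 + hnorm (vac (v false)) ^+ 2 <= hnorm v ^+ 2.
  rewrite l2_fin_hnorm big_bool lerD2l; rewrite [leRHS]decomp_hnorm lerDl.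
  by apply: sumr_ge0 => i _; exact: sqr_ge0.
have bW2 x : hnorm (W x) ^+ 2 <= hnorm x ^+ 2.
  by rewrite ler_pXn2r ?nnegrE // -[leRHS]mul1r.
(* As [W] is a contraction, one step moves the error at [g] to the vectors [r_i^* g]; after [k]
   steps it is a tail of order [k], which purity sends to [0]. *)
have step_err p q g : err (step p) (step q) g <= \sum_i err p q (adj (r_ i) g).
  have e1 : (step p).1 g - (step q).1 g = W (pack p.1 g - pack q.1 g) true.
    by rewrite bopB l2BE !step1.
  have e2 : (step p).2 g - (step q).2 g = vac (W (pack p.1 g - pack q.1 g) false) +
      \sum_i r_ i (p.2 (adj (r_ i) g) - q.2 (adj (r_ i) g)).
    rewrite !step2 opprD addrACA bopB l2BE bopB -sumrB; congr (_ + _).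
    by apply: eq_bigr => i _; rewrite bopB.
  rewrite /err e1 e2 sum_hnorm addrA big_split /= lerD2r.
  by apply: le_trans (evn _) _; apply: le_trans (bW2 _) _; rewrite packBn.
(* Slot [0] accounts for [M^2 |vac g|^2] and the assumed bound at [r_i^* g] for the rest of
   [M^2 |g|^2]; hence the constant does not grow. *)
have step_bnd p g : (forall g, err p (0, 0) g <= M ^+ 2 * hnorm g ^+ 2) ->
    err (step p) (0, 0) g <= M ^+ 2 * hnorm g ^+ 2.
  move=> hp; rewrite /err step1 step2 /= !subr0 sum_hnorm addrA.
  apply: le_trans (lerD (evn _) (lexx _)) _.
  apply: le_trans (lerD (bW2 _) (lexx _)) _.
  rewrite packn [in leRHS]decomp_hnorm mulrDr -addrA lerD2l -big_split mulr_sumr.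
  by apply: ler_sum => i _; have := hp (adj (r_ i) g); rewrite /err /= !subr0.
have iter_err k p q c : 0 <= c -> (forall g, err p q g <= c * hnorm g ^+ 2) ->
    forall g, err (iter k step p) (iter k step q) g <= c * row_tail r_ k g.
  move=> c0 hpq; elim: k => [|k IH] g //=.
  apply: le_trans (step_err _ _ _) _; rewrite mulr_sumr.
  by apply: ler_sum => i _; exact: IH.
pose p0 : bop E E * bop E E := (0, 0); pose p k := iter k step p0.
have p_bnd k : forall g, err (p k) p0 g <= M ^+ 2 * hnorm g ^+ 2.
  elim: k => [|k IH] g; last exact: step_bnd.
  by rewrite /err /= subrr hnorm0 expr0n addr0 mulr_ge0 ?sqr_ge0.
have s0V k : (s0, Y0).1 (V0 k) = V0 (D k) by rewrite !compE hVK.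
have Y0V k : (s0, Y0).2 (V0 k) = V0 (Z k) by rewrite !compE hVK.
(* On the range of [V0] the pair [(s0, Y0)] is fixed, because [W] was built from exactly these
   inputs; the iterates therefore approach [Y0] there. *)
have fixN h : (step (s0, Y0)).1 (V0 h) = s0 (V0 h) /\ (step (s0, Y0)).2 (V0 h) = Y0 (V0 h).
  split.
    by rewrite step1 -/(pin h) hW poutT -s0V.
  rewrite step2 -/(pin h) hW poutF Y0V [RHS]decomp.
  by congr (_ + _); [exact: vacK|apply: eq_bigr => i _; rewrite RZ -(aci i h) Y0V].
have limN k h : err (p k) (s0, Y0) (V0 h) <= M ^+ 2 * row_tail r_ k (V0 h).
  elim: k h => [|k IH] h.
    by rewrite /err s0V Y0V !sub0r !hnormN !hV Dn /= hV.
  have -> : err (p k.+1) (s0, Y0) (V0 h) = err (step (p k)) (step (s0, Y0)) (V0 h).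
    by rewrite /err; have [-> ->] := fixN h.
  apply: le_trans (step_err _ _ _) _; rewrite mulr_sumr; apply: ler_sum => i _.
  by rewrite -(aci i h).
have tails g e : 0 < e -> exists K, forall k, (K <= k)%N -> M ^+ 2 * row_tail r_ k g < e ^+ 2.
  move=> e0; have M1 : 0 < M ^+ 2 + 1 by rewrite ltr_wpDl ?sqr_ge0.
  have e2 : 0 < e ^+ 2 by rewrite exprn_gt0.
  have [K _ hK] := (cvgrPdist_lt _ _).1 (pure g) _ (divr_gt0 e2 M1).
  exists K => k /hK /=; rewrite sub0r normrN ger0_norm ?row_tail_ge0 //.
  rewrite ltr_pdivlMr //; apply: le_lt_trans; rewrite mulrC ler_wpM2l ?row_tail_ge0 //.
  by rewrite lerDl.
have [Y _ hY] : exists2 Y, bounded_by Y M & sot_cvg \oo (fun k => (p k).2) Y.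
  apply: sot_limit => [k|g e e0].
    split=> // g; rewrite -(@ler_pXn2r _ 2) ?nnegrE ?mulr_ge0 // exprMn.
    apply: le_trans (p_bnd k g); rewrite /err /= !subr0 lerDr; exact: sqr_ge0.
  have [K hK] := tails g e e0.
  have key i j : (K <= i)%N -> (i <= j)%N -> hnorm ((p j).2 g - (p i).2 g) < e.
    move=> Ki ij; rewrite -(@ltr_pXn2r _ 2) ?nnegrE ?(ltW e0) //.
    apply: le_lt_trans (hK i Ki).
    have := iter_err i (p (j - i)%N) p0 (M ^+ 2) (sqr_ge0 _) (p_bnd _) g.
    rewrite -iterD subnKC // -/(p i) -/(p j); apply: le_trans.
    by rewrite /err lerDr sqr_ge0.
  exists K => i j Ki Kj; have [ij|/ltnW ji] := leqP i j; last exact: key.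
  by rewrite -[dnorm _ _]/(hnorm ((p i).2 g - (p j).2 g)) hnormBC; exact: key.
(* The limit of the exact relation between consecutive iterates; its adjoint is the commutation
   required of [f]. *)
have YR i : adj (r_ i) \oB Y = Y \oB adj (r_ i).
  apply: bopP => g; apply: (hcvg_unique (u := fun k => adj (r_ i) ((p k.+1).2 g)) (F := \oo)).
    apply: hcvg_bop; apply/hcvg_seqP => e e0; have [K hK] := (hcvg_seqP _ _).1 (hY g) e e0.
    by exists K => k kK; apply: hK; exact: leqW.
  have -> : (fun k => adj (r_ i) ((p k.+1).2 g)) = (fun k => (p k).2 (adj (r_ i) g)).
    by apply/funext => k; rewrite step2 adj_sum.
  exact: hY.
have YV h : Y (V0 h) = V0 (Z h).
  apply: (hcvg_unique (hY (V0 h))); apply/hcvg_seqP => e e0.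
  have [K hK] := tails (V0 h) e e0; exists K => k /hK hk.
  rewrite -(@ltr_pXn2r _ 2) ?nnegrE ?(ltW e0) //; apply: le_lt_trans hk.
  apply: le_trans (limN k h); rewrite /err Y0V.
  by rewrite lerDr sqr_ge0.
exists (adj Y) => [i|].
  by rewrite -[LHS]adjK -[RHS]adjK; congr (adj _); rewrite !adj_comp !adjK YR.
by apply: bopP => h; rewrite !compE adjK YV ZE.
Qed.
End AbstractLifting.

Section CommutantLifting.
Variables (R : realType) (n : nat).
Local Notation E := (fock R n).
Local Notation e_ := (@fock_basis R n).
Local Notation r_ := (@rcreation R n).

Definition vac : bop E E := delta_bop (scalar_hilbert R) [::] \oB adj (delta_bop (scalar_hilbert R) [::]).

Lemma vacE (x : E) : vac x = (x [::] : R[i]) *: e_ [::].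
Proof. by rewrite compE adj_deltaE delta_bopE fock_deltaE. Qed.

Lemma vac_hnorm (x : E) : hnorm (vac x) = cabs (x [::] : R[i]).
Proof.
by rewrite compE adj_deltaE delta_bopE l2_delta_hnorm scalar_hnorm.
Qed.

Lemma rcreation_hnorm (x : E) :
  hnorm x ^+ 2 = hnorm (vac x) ^+ 2 + \sum_i hnorm (adj (r_ i) x) ^+ 2.
Proof.
rewrite vac_hnorm.
exact: (shift_hnorm (@snocI n) (@snoc_disj n) (@snoc_cover n) (@snoc_neq0 n)).
Qed.

Lemma rcreation_decomp (x : E) : x = vac x + \sum_i r_ i (adj (r_ i) x).
Proof.
rewrite vacE.
exact: (shift_decomp (@snocI n) (@snoc_disj n) (@snoc_cover n) (@snoc_neq0 n)).
Qed.

Lemma adj_rcreation_vac i x : adj (r_ i) (vac x) = 0.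
Proof.
by rewrite vacE bopZ (adj_shift_basis0 R (@snocI n) (@snoc_neq0 n)) scaler0.
Qed.

Lemma adj_rcreation i j x : adj (r_ i) (r_ j x) = if i == j then x else 0.
Proof.
case: eqP => [->|/eqP ij]; first exact: (adj_shiftK (@snocI n)).
exact: (shift_ortho (@snocI n) (@snoc_disj n)).
Qed.

Lemma adj_rcreation_sum i x (y : 'I_n -> E) :
  adj (r_ i) (vac x + \sum_j r_ j (y j)) = y i.
Proof.
rewrite bopD adj_rcreation_vac add0r bop_sum (bigD1 i) //= adj_rcreation eqxx.
by rewrite big1 ?addr0 // => j ji; rewrite adj_rcreation eq_sym (negPf ji).
Qed.

Lemma vac_rcreation_sum x (y : 'I_n -> E) : vac (vac x + \sum_j r_ j (y j)) = vac x.
Proof.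
have h := rcreation_decomp (vac x + \sum_j r_ j (y j)).
apply: (addIr (\sum_j r_ j (y j))); rewrite [RHS]h; congr (_ + _).
by apply: eq_bigr => i _; rewrite adj_rcreation_sum.
Qed.

Lemma vacK x : vac (vac x) = vac x.
Proof.
rewrite !vacE l2ZE l2_deltaE eqxx.
by congr (_ *: _); rewrite /GRing.scale /= mulr1.
Qed.

Lemma rcreation_sum_hnorm x (y : 'I_n -> E) :
  hnorm (vac x + \sum_j r_ j (y j)) ^+ 2 = hnorm (vac x) ^+ 2 + \sum_j hnorm (y j) ^+ 2.
Proof.
rewrite rcreation_hnorm vac_rcreation_sum; congr (_ + _).
by apply: eq_bigr => i _; rewrite adj_rcreation_sum.
Qed.

(** [r_w^*] strips a suffix of length [|w|], so a finitely supported vector has tail exactly [0]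
    from some degree on; such vectors are dense and tails are bounded by the squared norm. *)
Lemma rcreation_row_pure : row_pure r_.
Proof.
have hr : row_contraction r_.
  by apply: shift_row_contraction; [exact: snoc_disj|exact: snoc_cover|exact: snoc_neq0].
have wE w x v : adj (word_bop r_ w) x v = x (v ++ rev w) :> R[i].
  elim: w x v => [|i w IH] x v; first by rewrite /= adj_id cats0.
  rewrite -[word_bop _ _]/(r_ i \oB word_bop r_ w) adj_comp compE IH.
  by rewrite (adj_shiftE (@snocI n)) /snoc rev_cons -rcons_cat.
move=> x; apply/cvgrPdist_lt => e e0.
have e2 : 0 < e / 2 by rewrite divr_gt0.
have d0 : 0 < Num.sqrt (e / 2) / 2 by rewrite divr_gt0 // sqrtr_gt0.
have [F hF] := l2_delta_sum x d0.
have := hF (undup F) (undup_uniq F) (fun w => etrans (mem_undup F w)).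
set p := \sum_(w <- undup F) _ => hp.
have [N sN] := sub_words_lt (undup F); exists N => // k Nk /=.
rewrite sub0r normrN ger0_norm ?row_tail_ge0 //.
have tp : row_tail r_ k p = 0.
  rewrite row_tailE big1 // => w _; suff -> : adj (word_bop r_ w) p = 0.
    by rewrite hnorm0 expr0n.
  apply: l2P => v; rewrite wE /p l2_sumE big_seq big1 // => u /sN.
  rewrite mem_words_lt => su; rewrite l2_deltaE; case: eqP => // uE; move: su.
  by rewrite -uE size_cat size_rev size_tuple ltnNge (leq_trans Nk) ?leq_addl.
have tD : row_tail r_ k x <= 2 * row_tail r_ k (x - p) + 2 * row_tail r_ k p.
  rewrite !row_tailE !mulr_sumr -big_split; apply: ler_sum => w _ /=.
  by rewrite -{1}(subrK p x) bopD; exact: hnormD_sqr_le.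
apply: le_lt_trans tD _; rewrite tp mulr0 addr0.
have h1 : row_tail r_ k (x - p) <= hnorm (x - p) ^+ 2 by exact: row_tail_le.
have h2 : hnorm (x - p) ^+ 2 < (Num.sqrt (e / 2)) ^+ 2.
  rewrite ltr_pXn2r ?nnegrE ?sqrtr_ge0 // hnormBC; apply: lt_le_trans hp _.
  by rewrite ler_pdivrMr // ler_peMr ?sqrtr_ge0 // ler1n.
rewrite sqr_sqrtr ?(ltW e2) // in h2; lra.
Qed.

Lemma commutant_lifting (N : hsubspace E) (X : bop (sub_hilbert N) (sub_hilbert N)) :
  (forall i x, subspace_set N x -> subspace_set N (adj (r_ i) x)) ->
  (forall i, X \oB compression N (r_ i) = compression N (r_ i) \oB X) ->
  exists2 f : bop E E, rcommutant f & X = compression N f.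
Proof.
move=> hN hX.
have aci i h : incl_bop N (adj (compression N (r_ i)) h) = adj (r_ i) (incl_bop N h).
  rewrite /compression !adj_comp adj_incl adj_proj !compE incl_projK //.
  by apply: hN; exact: incl_in.
have [f hf fX] := @abstract_commutant_lifting R n E (sub_hilbert N) r_ vac (incl_bop N)
  (fun i => compression N (r_ i)) X rcreation_decomp rcreation_hnorm adj_rcreation_sum vacK
  rcreation_sum_hnorm rcreation_row_pure (fun h => erefl)
  (fun h => etrans (congr1 (fun A => bop_fun A _) (adj_incl N)) (proj_inclK h)) aci hX.
exists f => //; rewrite -[LHS]adjK -[RHS]adjK; congr (adj _).
rewrite /compression !adj_comp adj_incl adj_proj fX compA proj_incl_comp.
by rewrite id_comp.
Qed.
End CommutantLifting.

(** * Separability and joint operator radii *)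

Section Separability.
Variable R : realType.
Implicit Types H K L : hilbert R.

Lemma separable_countable (C : countType) H (u : C -> H) :
  (forall x e, 0 < e -> exists c, hnorm (x - u c) < e) -> hseparable H.
Proof.
move=> hu; exists (fun k => odflt 0 (omap u (unpickle k))).
apply/seteqP; split=> // x _ e /(hu x e)[c hc].
by exists (u c) => //; exists (pickle c) => //=; rewrite pickleK.
Qed.

Lemma separableP H : hseparable H ->
  exists u : nat -> H, forall x e, 0 < e -> exists k, hnorm (x - u k) < e.
Proof.
move=> [u hu]; exists u => x e e0.
have : hclosure (range u) x by rewrite hu.
by move=> /(_ e e0)[_ [k _ <-] hk]; exists k.
Qed.

Lemma scalar_separable : hseparable (scalar_hilbert R).
Proof.
apply: (@separable_countable (rat * rat)%type _
  (fun c => (Complex (ratr c.1 : R) (ratr c.2 : R) : scalar_hilbert R))).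
move=> z e e0; have e2 := divr_gt0 e0 (ltr0Sn R 1).
have approx (x : R) : exists q : rat, `|x - ratr q| < e / 2.
  have [q] := rat_in_itvoo (ltr_pwDr e2 (lexx x)).
  rewrite in_itv /= => /andP[h1 h2]; exists q.
  by rewrite distrC ger0_norm ?subr_ge0 ?ltW // ltrBlDl.
case: z => x y; have [a ha] := approx x; have [b hb] := approx y.
exists (a, b); rewrite scalar_hnorm /=.
have -> : (Complex x y : scalar_hilbert R) - Complex (ratr a) (ratr b) =
    ((x - ratr a)%:C%C + 'i%C * (y - ratr b)%:C%C : R[i]).
  by simpc.
apply: le_lt_trans (cabsD _ _) _; rewrite cabsM [ltRHS]splitr.
have ci : cabs ('i%C : R[i]) = 1.
  by rewrite /cabs normc_def /= expr0n expr1n add0r sqrtr1.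
have cr (t : R) : cabs (t%:C%C : R[i]) = `|t|.
  by rewrite /cabs normc_def /= expr0n addr0 sqrtr_sqr.
by rewrite ci mul1r !cr ltrD.
Qed.

(** Finite families with values in a dense sequence are dense; the error [e / 2] is shared among the
    finitely many coordinates kept. *)
Lemma l2_separable (I : countType) H : hseparable H -> hseparable (l2_hilbert I H).
Proof.
move=> /separableP[v hv].
apply: (@separable_countable (seq (I * nat)) _
  (fun s => \sum_(p <- s) l2_delta p.1 (v p.2) : l2_hilbert I H)) => x e e0.
have e2 := divr_gt0 e0 (ltr0Sn R 1).
have [F hF] := l2_delta_sum x e2.
have {hF} := hF (undup F) (undup_uniq F) (fun w => etrans (mem_undup F w)).
set s := undup F => hs; set d := e / 2 / (size s).+1%:R.
have d0 : 0 < d by rewrite divr_gt0.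
have /boolp.choice[k hk] : forall i, exists k, hnorm (x i - v k) < d by move=> i; exact: hv.
exists [seq (i, k i) | i <- s]; rewrite big_map.
apply: le_lt_trans (hnorm_triangle (\sum_(i <- s) l2_delta i (x i)) _ _) _.
rewrite [ltRHS]splitr hnormBC; apply: ltr_leD hs _.
rewrite -sumrB; apply: le_trans (hnorm_sum _ _ _) _.
apply: le_trans (_ : \sum_(i <- s) d <= _).
  by apply: ler_sum => i _; rewrite -!delta_bopE -bopB delta_bopE l2_delta_hnorm ltW.
rewrite big_const_seq count_predT iter_addr_0 -[_ *+ _]mulr_natr /d.
by rewrite mulrAC ler_pdivrMr // ler_wpM2l ?(ltW e2) // ler_nat.
Qed.

Lemma sub_separable H (M : hsubspace H) : hseparable H -> hseparable (sub_hilbert M).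
Proof.
move=> /separableP[u hu].
apply: (@separable_countable nat _ (fun k => proj_bop M (u k))) => x e e0.
have [k hk] := hu (incl_bop M x) e e0; exists k; apply: le_lt_trans hk.
rewrite -{1}(proj_inclK x) -bopB; have [_ h] := proj_bounded M.
by apply: le_trans (h _) _; rewrite mul1r.
Qed.

Lemma fock_separable n : hseparable (fock R n).
Proof. by apply: l2_separable; exact: scalar_separable. Qed.

Lemma l2_ord_proper p H : (0 < p)%N -> hproper H -> hproper (l2_hilbert 'I_p H).
Proof.
move=> p0 [sH [h h0]]; split; first exact: l2_separable.
exists (l2_delta (Ordinal p0) h); apply: contra_neq h0 => e.
by apply: hnorm_eq0; rewrite -(l2_delta_hnorm (Ordinal p0)) e hnorm0.
Qed.
End Separability.

(** * Joint radii under isometries *)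

Section Radius.
Variables (R : realType) (omega : radius_family R) (K L : hilbert R) (V : bop K L).
Hypothesis isoV : adj V \oB V = id_bop K.
Hypothesis (Kp : hproper K) (Lp : hproper L).

Lemma isoVK x : adj V (V x) = x. Proof. by rewrite -[LHS]compE isoV. Qed.

(** Admissibility speaks of unitaries and subspaces only, so an isometry [V] is factored through its
    range, described as the fixed points of [V V^*] to make closedness immediate. *)
Lemma range_linear : linear_set [set z | V (adj V z) = z].
Proof.
split=> [|a x y /= hx hy]; first by rewrite /= !bop0.
by rewrite !(bopD, bopZ) hx hy.
Qed.

Lemma range_closed (u : nat -> L) l :
  (forall k, V (adj V (u k)) = u k) -> hcvg \oo u l -> V (adj V l) = l.
Proof.
move=> hu ul.
have h : hcvg \oo (fun k => (V \oB adj V) (u k)) ((V \oB adj V) l) by exact: hcvg_bop.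
have e : (fun k => (V \oB adj V) (u k)) = u by apply/funext => k; rewrite compE.
by rewrite e in h; exact: hcvg_unique h ul.
Qed.

Let M : hsubspace L := @HSubspace R L [set z | V (adj V z) = z]
  (linear_set_submod range_linear) range_closed.
Let U : bop K (sub_hilbert M) := proj_bop M \oB V.

Lemma corangeE x : incl_bop M (U x) = V x.
Proof. by rewrite compE incl_projK //= isoVK. Qed.

Lemma adj_corange : adj U = adj V \oB incl_bop M.
Proof. by rewrite adj_comp adj_proj. Qed.

Lemma corange_unitary : unitary_bop U.
Proof.
split; apply: bopP => x.
  by rewrite adj_corange !compE -[proj_bop M (V x)]compE corangeE isoVK.
apply: incl_inj; rewrite adj_corange compE corangeE compE.
exact: (incl_in x).
Qed.

Lemma range_proper : hproper (sub_hilbert M).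
Proof.
have [sL _] := Lp; have [_ [x x0]] := Kp; split; first exact: sub_separable.
exists (U x); apply: contra_neq x0 => e.
have [UU _] := corange_unitary.
by rewrite -[x]id_bopE -UU compE e bop0.
Qed.

Lemma radius_corange d (S : 'I_d -> bop (sub_hilbert M) (sub_hilbert M)) :
  radius_unitary omega -> (0 < d)%N ->
  omega (fun l => adj U \oB S l \oB U) = omega S.
Proof. by move=> h d0; apply: h => //; [exact: range_proper|exact: corange_unitary]. Qed.

Lemma radius_isometry_compression d (Z : 'I_d -> bop L L) :
  strongly_admissible omega -> (0 < d)%N ->
  omega (fun l => adj V \oB Z l \oB V) <= omega Z.
Proof.
move=> [hu _ hc] d0; have [_ Mn] := range_proper.
apply: le_trans (hc L M d Z Lp Mn d0).
rewrite -(radius_corange _ hu d0).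
have -> // : (fun l => adj V \oB Z l \oB V) =
    (fun l => adj U \oB compression M (Z l) \oB U).
apply/funext => l; apply: bopP => x; apply: inner_ext => y.
by rewrite !(compE _ U) !compE !adjP' inner_proj !corangeE.
Qed.

(** The relation [Z V = V A] makes the range of [V] invariant under [Z] and [A] unitarily equivalent
    to the restriction. *)
Lemma radius_isometry_restriction d (Z : 'I_d -> bop L L) (A : 'I_d -> bop K K) :
  admissible omega -> (0 < d)%N -> (forall l, Z l \oB V = V \oB A l) ->
  omega A <= omega Z.
Proof.
move=> [hu _ hr] d0 hA; have [_ Mn] := range_proper; have [UU _] := corange_unitary.
have := hr L M d Z (fun l => U \oB A l \oB adj U) Lp Mn d0; rewrite -(radius_corange _ hu d0).
have -> : (fun l => adj U \oB (U \oB A l \oB adj U) \oB U) = A.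
  apply/funext => l; transitivity ((adj U \oB U) \oB A l \oB (adj U \oB U)); first exact/val_inj.
  by rewrite UU id_comp comp_id.
apply=> l x; rewrite !compE -[proj_bop M (V _)]compE corangeE -[V _]compE -hA.
rewrite compE adj_corange compE; congr (Z l _).
exact: (incl_in x).
Qed.
End Radius.

(** * The constrained Poisson transform *)

Section TensorClosure.
Variables (R : realType) (G N E : hilbert R) (t : G -> N -> E).
Hypothesis tl : forall h, linear (fun g => t g h).
Hypothesis tr : forall g, linear (t g).
Hypothesis ti : forall g g' h h', '[t g h, t g' h'] = '[g, g'] * '[h, h'].

(** Realizes [G (x) N] as the closed span of prescribed vectors of [E]. The last clause is the
    double orthogonal complement test, which places the range of the Poisson kernel in it. *)
Lemma tensor_closure_exists : exists (M : hsubspace E) (tau : G -> N -> sub_hilbert M),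
  [/\ hilbert_tensor tau, forall g h, incl_bop M (tau g h) = t g h &
      forall x, (forall z, (forall g h, '[z, t g h] = 0) -> '[x, z] = 0) -> subspace_set M x].
Proof.
pose S := [set x | exists g h, x = t g h].
pose M := closure_subspace (lspan_linear S).
have tM g h : t g h \in subspace_pred M.
  by apply/subspaceP/sub_hclosure/sub_lspan; exists g, h.
pose tau g h : sub_hilbert M := SubVec (tM g h).
have tauE g h : incl_bop M (tau g h) = t g h by [].
exists M, tau; split=> //; first split.
- by move=> h a x y; apply: incl_inj; rewrite bopD bopZ !tauE tl.
- by move=> g a x y; apply: incl_inj; rewrite bopD bopZ !tauE tr.
- by move=> g g' h h'; rewrite -incl_inner !tauE.
- apply: dense_of_orth => x hx; apply: incl_inj; rewrite bop0.
  apply: hnorm_eq0; apply/eqP; rewrite -sqrf_eq0 -Re_innerxx.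
  rewrite (orth_hspan (S := S)) //; last exact: (incl_in x).
  move=> _ [g [h ->]]; rewrite -tauE incl_inner; apply: hx.
  by exists g, h.
- move=> x hx; have [m Mm hm] := projection_exists M x.
  suff -> : x = m by [].
  apply/eqP; rewrite -subr_eq0; apply/eqP/hnorm_eq0/eqP; rewrite -sqrf_eq0 -Re_innerxx.
  have h0 : '[x - m, m] = 0 by exact: hm.
  have h1 : '[x, x - m] = 0.
    apply: hx => g h; apply: hm; rewrite -tauE; exact: incl_in.
  by rewrite {1}innerBl h1 innerC h0 conjC0 subr0.
Qed.
End TensorClosure.

Section MatrixOperators.
Variables (R : realType) (p : nat).
Implicit Types H K : hilbert R.

(* The finite-index lemmas restated at the choice structure of ['I_p] used by
   [mx_bop]. *)
Lemma ord_inner H (x y : l2_hilbert 'I_p H) : '[x, y] = \sum_i '[x i, y i].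
Proof. exact: l2_fin_inner. Qed.

Lemma ord_build H (u : 'I_p -> H) : exists x : l2_hilbert 'I_p H, forall i, x i = u i.
Proof. exact: l2_fin_build. Qed.

Lemma mx_bopE H K (X : 'M[bop H K]_p) x i : mx_bop X x i = \sum_j X i j (x j).
Proof. by []. Qed.

Lemma adj_mx_bop H K (X : 'M[bop H K]_p) :
  adj (mx_bop X) = mx_bop (\matrix_(i, j) adj (X j i)).
Proof.
apply: adjE => x y; rewrite !ord_inner.
transitivity (\sum_i \sum_j '[X i j (x j), y i]).
  by apply: eq_bigr => i _; rewrite -inner_suml.
rewrite exchange_big; apply: eq_bigr => j _; rewrite mx_bopE inner_sumr.
by apply: eq_bigr => i _; rewrite mxE adjP.
Qed.

Definition diag_bop H K (A : bop H K) : bop (l2_hilbert 'I_p H) (l2_hilbert 'I_p K) :=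
  mx_bop (\matrix_(i, j) if i == j then A else 0).

Lemma diag_bopE H K (A : bop H K) x i : diag_bop A x i = A (x i).
Proof.
rewrite mx_bopE (bigD1 i) //= mxE eqxx big1 ?addr0 // => j.
by rewrite mxE eq_sym => /negPf ->.
Qed.
End MatrixOperators.

Lemma opnorm_le (R : realType) (H K H' K' : hilbert R) (A : bop H K) (B : bop H' K') :
  (forall M, bounded_by A M -> bounded_by B M) -> opnorm B <= opnorm A.
Proof.
move=> h; apply: lb_le_inf; first by have [M hM] := bounded_byP A; exists M.
by move=> M /h hM; apply: ge_inf => //; exists 0 => x [].
Qed.

Section ConstrainedPoisson.
Variables (R : realType) (n : nat) (J : set (bop (fock R n) (fock R n))).
Hypothesis JP : wot_ideal J.
Local Notation W := (seq 'I_n).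
Local Notation N := (orthocomp (MJ J)).
Local Notation VN := (incl_bop N).
Local Notation PN := (proj_bop N).

Lemma NJP x : subspace_set N x <-> forall f y, J f -> '[x, f y] = 0.
Proof.
split=> [h f y Jf|h s]; first by apply: h; apply/sub_hclosure/sub_lspan; exists f, y.
by apply: orth_hspan => _ [f [y [Jf ->]]]; exact: h.
Qed.

Lemma NJ_adj_Finf g x : Finf g -> subspace_set N x -> subspace_set N (adj g x).
Proof.
have [_ _ Jideal _] := JP.
move=> hg /NJP hx; apply/NJP => f y Jf; rewrite adjP' -compE.
by apply: hx; have [] := Jideal g f hg Jf.
Qed.

(** Elements of [J] commute with right shifts, so the range space of [J] is invariant under
    these. *)
Lemma NJ_adj_rcreation i x : subspace_set N x -> subspace_set N (adj (rcreation R i) x).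
Proof.
have [JF _ _ _] := JP.
move=> /NJP hx; apply/NJP => f y Jf; rewrite adjP' -compE.
by rewrite -(Finf_rcommutant (JF f Jf)) compE; exact: hx.
Qed.

Lemma fcalc_BJ f : Finf f -> fcalc (BJ J) f = compression N f.
Proof.
move=> hf; apply: fcalcE; apply: is_fcalc_compression; last exact: Finf_rcommutant.
by move=> i x; apply: NJ_adj_Finf; exact: Finf_creation.
Qed.

(** The generators commute with the compressed right shifts, and a commutant is a WOT-closed
    algebra, so [X] commutes with them too; the symbol [f] is its lifting. *)
Lemma WJinf_fcalc X : WJinf (J := J) X -> exists2 f, Finf f & X = fcalc (BJ J) f.
Proof.
move=> hX; have [|f hf Xf] := commutant_lifting (X := X) NJ_adj_rcreation; last first.
  by have Ff := rcommutant_Finf hf; exists f; rewrite ?fcalc_BJ.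
move=> i; apply: (hX [set A | A \oB compression N (rcreation R i) =
  compression N (rcreation R i) \oB A]); [|exact: commutant_subalgebra|exact: commutant_wot_closed].
move=> _ [[j _ <-]|->] /=; last by rewrite comp_id id_comp.
rewrite !compression_comp ?creation_rcreation // => x; first exact: NJ_adj_rcreation.
by apply: NJ_adj_Finf; exact: Finf_creation.
Qed.

Section Poisson.
Variables (H : hilbert R) (T : 'I_n -> bop H H).
Hypothesis hT : row_contraction T.
Hypothesis hC0 : C0_row T.
Hypothesis TJ : forall phi, J phi -> fcalc T phi = 0.
Local Notation K := (poisson T).
Local Notation tP := (l2_tensP W H).
Local Notation "A ^#" := (ampl (@l2_tens R W H) A) (at level 2, format "A ^#").
Let hP := C0_row_pure hC0.

Lemma fcalc_poisson f : Finf f -> fcalc T f = adj K \oB f^# \oB K.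
Proof.
move=> /Finf_rcommutant hf; apply: fcalcE.
by have [] := is_fcalc_poisson hT hP hf.
Qed.

Lemma fcalc_adj_poisson f : Finf f -> fcalc T f \oB adj K = adj K \oB f^#.
Proof.
move=> hF; rewrite fcalc_poisson //.
by have [] := is_fcalc_poisson hT hP (Finf_rcommutant hF).
Qed.

Lemma poisson_adj_fcalc f : Finf f -> K \oB adj (fcalc T f) = (adj f)^# \oB K.
Proof.
move=> hF; rewrite -[LHS]adjK -[RHS]adjK; congr (adj _).
by rewrite !adj_comp !adjK (adj_ampl tP) adjK fcalc_adj_poisson.
Qed.

(* The range of the Poisson kernel is orthogonal to [J F^2 (x) H]. *)
Lemma adj_poisson_NJ : adj K \oB (VN \oB PN)^# = adj K.
Proof.
apply: (tensor_eq tP) => g h; rewrite compE (amplE tP); apply/esym.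
have [B hB] := tensl_exists h tP.
apply: inner_ext => k; rewrite -!hB !adjP'.
apply/eqP; rewrite -subr_eq0 -innerBl -bopB adjP compE; apply/eqP/projP/NJP => f y Jf.
have [JF _ _ _] := JP; rewrite adjP' hB -(amplE tP) adjP -compE -fcalc_adj_poisson; last exact: JF.
by rewrite TJ // compE inner0r.
Qed.

Lemma poisson_NJ : (VN \oB PN)^# \oB K = K.
Proof.
rewrite -[LHS]adjK -[RHS]adjK; congr (adj _).
by rewrite adj_comp (adj_ampl tP) adj_comp adj_incl adj_proj adj_poisson_NJ.
Qed.

(** [Y] is extended by zero to the Fock space before being amplified, so the formula makes sense and
    is linear on all operators on [N_J]. *)
Definition PhiJ (Y : bop (NJ J) (NJ J)) : bop H H := adj K \oB (VN \oB Y \oB PN)^# \oB K.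

Lemma PhiJ_linear : linear PhiJ.
Proof.
move=> a X Y; rewrite /PhiJ.
have -> : VN \oB (a *: X + Y) \oB PN = a *: (VN \oB X \oB PN) + VN \oB Y \oB PN.
  by apply: bopP => x; rewrite !(compE, bopDE, bopZE, bopD, bopZ).
rewrite (ampl_linear tP); apply: bopP => x.
by rewrite !(compE, bopDE, bopZE, bopD, bopZ).
Qed.

Lemma incl_adj_fcalc_BJ g : Finf g ->
  VN \oB adj (fcalc (BJ J) g) \oB PN = adj g \oB (VN \oB PN).
Proof.
move=> hg; rewrite fcalc_BJ // /compression !adj_comp adj_incl adj_proj.
apply: bopP => x; rewrite !compE incl_projK //.
by apply: NJ_adj_Finf => //; exact: incl_in.
Qed.

Lemma incl_fcalc_BJ f : Finf f ->
  VN \oB fcalc (BJ J) f \oB PN = VN \oB PN \oB f.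
Proof.
move=> hf; rewrite -[LHS]adjK -[RHS]adjK; congr (adj _).
rewrite !adj_comp adj_incl adj_proj -incl_adj_fcalc_BJ //.
by rewrite compA.
Qed.

(** The projections on [N_J] are absorbed by [K^*] on the left and [K] on the right. Moving [f] and
    [g^*] across then leaves [K^* K = I] in the middle. *)
Lemma PhiJ_fcalc f g : Finf f -> Finf g ->
  PhiJ (fcalc (BJ J) f \oB adj (fcalc (BJ J) g)) = fcalc T f \oB adj (fcalc T g).
Proof.
move=> hf hg; rewrite /PhiJ.
have -> : VN \oB (fcalc (BJ J) f \oB adj (fcalc (BJ J) g)) \oB PN =
    (VN \oB PN) \oB f \oB (adj g \oB (VN \oB PN)).
  rewrite -incl_fcalc_BJ // -incl_adj_fcalc_BJ //.
  by apply: bopP => x; rewrite !compE proj_inclK.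
rewrite !(ampl_comp tP) !compA adj_poisson_NJ -fcalc_adj_poisson //.
rewrite -[LHS]compA poisson_NJ -[LHS]compA -poisson_adj_fcalc //.
by rewrite !compA -(compA _ (adj K)) adj_poisson_poisson // comp_id.
Qed.

Lemma is_PhiJ_PhiJ : is_PhiJ (J := J) T PhiJ.
Proof. by split=> [a X Y _ _|f g]; [exact: PhiJ_linear|exact: PhiJ_fcalc]. Qed.

(** [Phi] is linear on [WJ] only, hence membership in [WJ] is carried through the induction on the
    span. *)
Lemma is_PhiJ_unique Phi X : is_PhiJ (J := J) T Phi -> WJ X -> Phi X = PhiJ X.
Proof.
move=> [PL PE] hX.
have PL0 : Phi 0 = 0.
  have w0 : WJ (J := J) 0 by case: (lspan_linear [set X | exists f g, [/\ Finf f, Finf g,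
    WJinf (fcalc (BJ J) f), WJinf (fcalc (BJ J) g) & X = fcalc (BJ J) f \oB adj (fcalc (BJ J) g)]]).
  have := PL 1 0 0 w0 w0; rewrite !scale1r addr0 => /esym/eqP.
  by rewrite -subr_eq0 addrK => /eqP.
have PJ0 : PhiJ 0 = 0 by have := PhiJ_linear (-1) 0 0; rewrite !scaleN1r !addNr.
suff [] : WJ X /\ Phi X = PhiJ X by [].
move: X hX; apply: (lspan_ind (P := [set X | WJ X /\ Phi X = PhiJ X])).
  split; first by split=> //; [exact: (lspan_linear _).1|rewrite PL0 PJ0].
  move=> a X Y [WX EX] [WY EY]; split; first exact: (lspan_linear _).2.
  by rewrite PL // PhiJ_linear EX EY.
move=> X hX; split; first exact: sub_lspan.
have [f [g [hf hg _ _ ->]]] := hX.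
by rewrite PE // PhiJ_fcalc.
Qed.

Section Amplification.
Variable p : nat.
Local Notation F2H := (l2_hilbert W H).
Local Notation Kp := (diag_bop p K).

Definition mx_ampl (X : 'M[bop (NJ J) (NJ J)]_p) :
    bop (l2_hilbert 'I_p F2H) (l2_hilbert 'I_p F2H) :=
  mx_bop (map_mx (fun Y => (VN \oB Y \oB PN)^#) X).

(** [H (x) N_J^p] is realized inside the sum of [p] copies of [F^2 (x) H], and [V] is the diagonal
    Poisson kernel with its codomain cut down to it. The factor [H] comes first because
    [radius_ampliation] amplifies on the left. *)
Lemma NJ_dilation : exists (M : hsubspace (l2_hilbert 'I_p F2H))
    (tau : H -> l2_hilbert 'I_p (NJ J) -> sub_hilbert M) (V : bop (l2_hilbert 'I_p H) (sub_hilbert M)),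
  [/\ hilbert_tensor tau, adj V \oB V = id_bop _, forall x, incl_bop M (V x) = Kp x &
    forall X z, incl_bop M (tensor_bop tau (id_bop H) (mx_bop X) z) = mx_ampl X (incl_bop M z)].
Proof.
have /boolp.choice[t tE] : forall gx : H * l2_hilbert 'I_p (NJ J),
    exists y : l2_hilbert 'I_p F2H, forall i, y i = l2_tens (VN (gx.2 i)) gx.1.
  by move=> gx; exact: ord_build.
have [||| M [tau [tauP tauE hM]]] := @tensor_closure_exists R H (l2_hilbert 'I_p (NJ J))
    (l2_hilbert 'I_p F2H) (fun g x => t (g, x)).
- move=> x a g g' /=; apply: l2P => i; rewrite l2E !tE /=.
  by rewrite (tensorDr tP) (tensorZr tP).
- move=> g a x x' /=; apply: l2P => i; rewrite [RHS]l2E !tE.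
  rewrite (_ : (g, a *: x + x').2 i = a *: x i + x' i) // bopD bopZ.
  by rewrite (tensorDl tP) (tensorZl tP).
- move=> g g' x x'; rewrite !ord_inner mulr_sumr; apply: eq_bigr => i _.
  by rewrite !tE (tensor_inner tP) incl_inner mulrC.
(* A vector orthogonal to the elementary tensors has components killed by [P_N (x) I], and
   [K = (P_N (x) I) K]. *)
have KM x : subspace_set M (Kp x).
  apply: hM => z hz; rewrite ord_inner big1 // => i _; rewrite diag_bopE.
  rewrite -[in LHS]poisson_NJ compE adjP (adj_ampl tP) adj_comp adj_incl adj_proj.
  have -> : (VN \oB PN)^# (z i) = 0; last exact: inner0r.
  apply: (tensor_inner_eq tP) => g h; rewrite inner0l adjP (adj_ampl tP) adj_comp.
  rewrite adj_incl adj_proj (amplE tP).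
  have := hz h (l2_delta i (PN g)); rewrite ord_inner (bigD1 i) //= big1 => [|j ji].
    by rewrite addr0 tE l2_deltaE eqxx.
  by rewrite tE l2_deltaE (negPf ji) bop0 (tensor0l tP) inner0r.
exists M, tau, (proj_bop M \oB Kp).
have VE x : incl_bop M ((proj_bop M \oB Kp) x) = Kp x by rewrite compE incl_projK.
split=> //.
  apply: bopP => x; apply: inner_ext => y; rewrite compE adjP' -incl_inner !VE.
  rewrite !ord_inner; apply: eq_bigr => i _; rewrite !diag_bopE -adjP' -compE.
  by rewrite adj_poisson_poisson.
move=> X z; rewrite -[LHS]compE -[RHS]compE; congr (bop_fun _ z).
apply: (tensor_eq tauP) => g x; rewrite !compE (tensor_id_bopE tauP) !tauE.
apply: l2P => i; rewrite tE (_ : (g, mx_bop X x).2 i = \sum_j X i j (x j)) //.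
have [B hB] := tensl_exists g tP.
rewrite -[LHS]/(l2_tens (VN (\sum_j X i j (x j))) g) -hB bop_sum bop_sum /mx_ampl mx_bopE.
apply: eq_bigr => j _; rewrite mxE tE (amplE tP) hB !compE.
by rewrite proj_inclK.
Qed.

Lemma PhiJ_dilation M tau (V : bop (l2_hilbert 'I_p H) (sub_hilbert M)) X :
  (forall x, incl_bop M (V x) = Kp x) ->
  (forall X z, incl_bop M (tensor_bop tau (id_bop H) (mx_bop X) z) = mx_ampl X (incl_bop M z)) ->
  adj V \oB tensor_bop tau (id_bop H) (mx_bop X) \oB V = mx_bop (map_mx PhiJ X).
Proof.
move=> VE hX; apply: bopP => x; apply: inner_ext => y.
rewrite !compE adjP' -incl_inner hX !VE !ord_inner; apply: eq_bigr => i _.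
rewrite diag_bopE -adjP'; congr (inner _ _).
rewrite /mx_ampl !mx_bopE bop_sum; apply: eq_bigr => j _.
by rewrite !mxE diag_bopE !compE.
Qed.
End Amplification.
End Poisson.
End ConstrainedPoisson.

Section Main.
Variables (R : realType) (n : nat) (J : set (bop (fock R n) (fock R n))).
Hypothesis JP : wot_ideal J.
Variables (H : hilbert R) (T : 'I_n -> bop H H).
Hypothesis HP : hproper H.
Hypothesis hT : row_contraction T.
Hypothesis hC0 : C0_row T.
Hypothesis TJ : forall phi, J phi -> fcalc T phi = 0.
Variables (omega : radius_family R) (Phi : bop (NJ J) (NJ J) -> bop H H).
Hypothesis PhiP : is_PhiJ T Phi.
Variable p : nat.
Local Notation MX := ('M[bop (NJ J) (NJ J)]_p).
Let hP := C0_row_pure hC0.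

(** If [N_J] were zero, [K = (P_N (x) I) K] would vanish, although it is an isometry on the nonzero
    space [H]. *)
Lemma NJ_proper : hproper (NJ J).
Proof.
split; first exact/sub_separable/fock_separable.
have [_ [x x0]] := HP; apply: contrapT => h.
have y0 (y : NJ J) : y = 0.
  by apply/eqP; apply: contra_notT h => yn; exists y.
have P0 : incl_bop (orthocomp (MJ J)) \oB proj_bop (orthocomp (MJ J)) = 0.
  by apply: bopP => z; rewrite compE (y0 (proj_bop _ z)) bop0.
have A0 : ampl (@l2_tens R (seq 'I_n) H) 0 = 0.
  by apply: (tensor_eq (l2_tensP _ H)) => g k; rewrite (amplE (l2_tensP _ H)) (tensor0l (l2_tensP _ H)).
have := poisson_NJ JP hT hC0 TJ; rewrite P0 A0 => K0.
move/eqP: x0; apply; apply: hnorm_eq0; rewrite -(poisson_isometry x hT hP) -K0.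
by rewrite compE bop0E hnorm0.
Qed.

Lemma fcalc_BJ_id : fcalc (BJ J) (id_bop (fock R n)) = id_bop (NJ J).
Proof.
rewrite (fcalc_BJ JP); last exact: Finf_id.
by rewrite /compression comp_id proj_incl_comp.
Qed.

Lemma fcalc_T_id : fcalc T (id_bop (fock R n)) = id_bop H.
Proof.
rewrite (fcalc_poisson hT hC0); last exact: Finf_id.
by rewrite (ampl_id (l2_tensP _ H)) comp_id adj_poisson_poisson.
Qed.

Lemma Phi_fcalc f : Finf f -> Phi (fcalc (BJ J) f) = fcalc T f.
Proof.
move=> hf; have [_ PE] := PhiP; have := PE f (id_bop _) hf (@Finf_id R n).
by rewrite fcalc_BJ_id fcalc_T_id !adj_id !comp_id.
Qed.

Lemma map_Phi (X : MX) : (forall i j, WJ (X i j)) -> map_mx Phi X = map_mx (PhiJ T) X.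
Proof.
by move=> hX; apply/matrixP => i j; rewrite !mxE (is_PhiJ_unique JP hT hC0 TJ PhiP).
Qed.

Lemma Phi_completely_contractive (X : MX) : (forall i j, WJ (X i j)) ->
  opnorm (mx_bop (map_mx Phi X)) <= opnorm (mx_bop X).
Proof.
move=> hX; rewrite map_Phi //; apply: opnorm_le => M bM.
have [N [tau [V [tauP VV VE hZ]]]] := NJ_dilation JP hT hC0 TJ p.
rewrite -(PhiJ_dilation X VE hZ).
have bV : bounded_by V 1.
  split=> // x; rewrite mul1r; apply: hnorm_sqr_le; rewrite -!Re_innerxx -adjP'.
  by rewrite -[adj V (V x)]compE VV.
rewrite -[M]mul1r -[1 * M]mulr1.
exact: comp_bounded (comp_bounded (adj_bounded bV) (tensor_id_bounded tauP bM)) bV.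
Qed.

Section Radius.
Hypothesis p0 : (0 < p)%N.

Lemma dilation_proper (N : hsubspace (l2_hilbert 'I_p (l2_hilbert (seq 'I_n) H)))
    (V : bop (l2_hilbert 'I_p H) (sub_hilbert N)) :
  adj V \oB V = id_bop _ -> hproper (sub_hilbert N).
Proof.
move=> VV; have [sH _] := HP; split; first by do 3!apply/sub_separable || apply: l2_separable.
have [_ [x x0]] := l2_ord_proper p0 HP.
by exists (V x); apply: contra_neq x0 => e; rewrite -[x]id_bopE -VV compE e bop0.
Qed.

Lemma Phi_radius_adj k (F : 'I_k -> MX) : admissible omega -> (0 < k)%N ->
  (forall l i j, WJinf (F l i j)) ->
  omega (fun l => adj (mx_bop (map_mx Phi (F l)))) <= omega (fun l => adj (mx_bop (F l))).
Proof.
move=> hw k0 hF; have [_ ha _] := hw.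
have [N [tau [V [tauP VV VE hZ]]]] := NJ_dilation JP hT hC0 TJ p.
have -> : (fun l => adj (mx_bop (F l))) = (fun l => mx_bop (\matrix_(i, j) adj (F l j i))).
  by apply/funext => l; rewrite adj_mx_bop.
rewrite -(ha _ _ _ tau _ _ HP (l2_ord_proper p0 NJ_proper) k0 tauP).
apply: (radius_isometry_restriction VV (l2_ord_proper p0 HP) (dilation_proper VV) hw k0) => l.
apply: bopP => x; apply: incl_inj; rewrite !compE hZ !VE.
apply: l2P => i; rewrite diag_bopE adj_mx_bop /mx_ampl !mx_bopE bop_sum.
apply: eq_bigr => j _; rewrite !mxE diag_bopE.
have [f hf ->] := WJinf_fcalc JP (hF l j i).
rewrite Phi_fcalc // (incl_adj_fcalc_BJ JP) // (ampl_comp (l2_tensP _ H)).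
rewrite -!compE -compA (poisson_NJ JP hT hC0 TJ) (poisson_adj_fcalc hT hC0) //.
Qed.

Lemma Phi_radius k (X : 'I_k -> MX) : strongly_admissible omega -> (0 < k)%N ->
  (forall l i j, WJ (X l i j)) ->
  omega (fun l => mx_bop (map_mx Phi (X l))) <= omega (fun l => mx_bop (X l)).
Proof.
move=> hw k0 hX; have [_ ha _] := hw.
have [N [tau [V [tauP VV VE hZ]]]] := NJ_dilation JP hT hC0 TJ p.
rewrite -(ha _ _ _ tau _ _ HP (l2_ord_proper p0 NJ_proper) k0 tauP).
have -> : (fun l => mx_bop (map_mx Phi (X l))) =
    (fun l => adj V \oB tensor_bop tau (id_bop H) (mx_bop (X l)) \oB V).
  by apply/funext => l; rewrite map_Phi // (PhiJ_dilation (X l) VE hZ).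
exact: (radius_isometry_compression VV (l2_ord_proper p0 HP) (dilation_proper VV) _ hw k0).
Qed.
End Radius.
End Main.

Theorem theorem6p1 (R : realType) (omega : radius_family R) (n : nat)
    (J : set (bop (fock R n) (fock R n))) (H : hilbert R)
    (T : 'I_n -> bop H H)
    (n_gt0 : (0 < n)%N)
    (omegaP : joint_radius omega)
    (JP : wot_ideal J)
    (HP : hproper H)
    (T_contr : row_contraction T)
    (T_C0 : C0_row T)
    (TJ : forall phi, J phi -> fcalc T phi = 0) :
  (exists Phi : bop (NJ J) (NJ J) -> bop H H, is_PhiJ T Phi) /\
  forall Phi : bop (NJ J) (NJ J) -> bop H H, is_PhiJ T Phi ->
    [/\ Phi (id_bop (NJ J)) = id_bop H,
        (forall (p : nat) (X : 'M[bop (NJ J) (NJ J)]_p),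
           (0 < p)%N -> (forall i j, WJ (X i j)) ->
           opnorm (mx_bop (map_mx Phi X)) <= opnorm (mx_bop X)),
        (forall f g, Finf f -> Finf g ->
           Phi (fcalc (BJ J) f \oB adj (fcalc (BJ J) g)) =
           adj (poisson T)
             \oB tensor_bop (@l2_tens R _ H) (f \oB adj g) (id_bop H)
             \oB poisson T),
        (admissible omega ->
         forall (k p : nat) (F : 'I_k -> 'M[bop (NJ J) (NJ J)]_p),
           (0 < k)%N -> (0 < p)%N -> (forall l i j, WJinf (F l i j)) ->
           omega _ _ (fun l => adj (mx_bop (map_mx Phi (F l)))) <=
           omega _ _ (fun l => adj (mx_bop (F l)))) &
        (strongly_admissible omega ->
         forall (k p : nat) (X : 'I_k -> 'M[bop (NJ J) (NJ J)]_p),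
           (0 < k)%N -> (0 < p)%N -> (forall l i j, WJ (X l i j)) ->
           omega _ _ (fun l => mx_bop (map_mx Phi (X l))) <=
           omega _ _ (fun l => mx_bop (X l)))].
Proof.
split; first by exists (PhiJ T); exact: is_PhiJ_PhiJ.
move=> Phi PhiP; split.
- have := Phi_fcalc JP T_contr T_C0 PhiP (@Finf_id R n).
  by rewrite (fcalc_BJ_id JP) (fcalc_T_id T_contr T_C0).
- by move=> p X _; exact: Phi_completely_contractive.
- move=> f g hf hg; have [_ ->] := PhiP; [|exact: hf|exact: hg].
  rewrite (fcalc_poisson T_contr T_C0 hf) -/(ampl (@l2_tens R (seq 'I_n) H) _).
  rewrite (ampl_comp (l2_tensP _ H)) -[RHS]compA -(compA _ (ampl _ (adj g))).
  by rewrite -(poisson_adj_fcalc T_contr T_C0 hg) !compA.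
- by move=> hw k p F k0 p0; exact: (Phi_radius_adj JP HP T_contr T_C0 TJ PhiP p0).
- by move=> hw k p X k0 p0; exact: (Phi_radius JP HP T_contr T_C0 TJ PhiP p0).
Qed.
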